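(* Let $h,s\in\mathcal{T}$, let $H=\mathcal{R}(h)$ be the hypothesis region and $S=\mathcal{R}(s)^c$ the selective region. Let $y=(0,-r_0)$ and $\hat\mu=(u_0,-h(u_0)+O(n^{-1}))$ for any $u_0=O(n^{-1/2})$; that is, an error of $O(n^{-1/2})$ is allowed in the $u$-axis of $\mathrm{proj}(H|y)$, whose $u$-coordinates are $u_i=-(h_0-r_0)h_i=O(n^{-1/2})$. For some $\sigma^2\in\mathbb{R}$ define $$p_{\mathrm{BP},1}(H|S,y)=\frac{p_{\sigma^2}(H|y)}{P_1(Y^*\in S\mid\hat\mu)},$$ and define $p_{\mathrm{BP},2}(H|S,y)$ by $$p_{\mathrm{BP},2}(H|S,y)=\frac{P_1\{p_{\mathrm{BP},1}(H|S,Y^* )<p_{\mathrm{BP},1}(H|S,y)\mid\hat\mu\}}{P_1(Y^*\in S\mid\hat\mu)}.$$ Then $$p_{\mathrm{BP},1}(H|S,y)\doteq\frac{\bar\Phi(h_0-r_0+h_{ii}\sigma^2)}{\bar\Phi(h_0-s_0-s_{ii})},\qquad p_{\mathrm{BP},2}(H|S,y)\doteq\frac{\bar\Phi(h_0-r_0-h_{ii})}{\bar\Phi(h_0-s_0-h_{ii})}.$$ Therefore $p_{\mathrm{BP},2}(H|S,y)\doteq p_{\mathrm{SI}}(H|S,y)$, and $p_{\mathrm{BP},2}(H|S,y)$ is second order accurate. This result for $p_{\mathrm{BP},2}$ does not depend on $\sigma^2$. On the other hand, $p_{\mathrm{BP},1}(H|S,y)=p_{\mathrm{BP},2}(H|S,y)+O_p(n^{-1/2})$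 is only first order accurate, but $p_{\mathrm{BP},1}(H|S,y)$ becomes second order accurate if $S=H^c$ and $\sigma^2=-1$.
   Context: Large sample setting. $m\ge 0$ is fixed, $n\to\infty$. All functions and regions may depend on $n$. $\doteq$ denotes equality up to an error of order $O(n^{-1})$. Points of $\mathbb{R}^{m+1}$ are written $(u,v)$, $u\in\mathbb{R}^m$, $v\in\mathbb{R}$, and are considered in a neighborhood of the origin of size $O(1)$ (local alternatives; in particular $r_0=O(1)$). The model is $Y\sim N_{m+1}(\mu,I_{m+1})$, with probabilities $P(\cdot\mid\mu)$. $\bar\Phi=1-\Phi$ is the upper tail probability of $N(0,1)$. A smooth function $h:\mathbb{R}^m\to\mathbb{R}$ is expanded (repeated indices are summed over $1,\dots,m$; thus $h_{ii}=\sum_{i=1}^m h_{ii}$) as $h(u)=h_0+h_iu_i+h_{ij}u_iu_j+h_{ijk}u_iu_ju_k+\cdots$, with $h_0=h(0)$, $h_i=\partial h/\partial u_i|_0$, $h_{ij}=\frac12\partial^2h/\partial u_i\partial u_j|_0$, etc. The class $\mathcal{T}$ (nearly parallel surfaces) consists of smooth $h$ with $h_0=O(1)$, $h_i=O(n^{-1/2})$, $h_{ij}=O(n^{-1/2})$ and, for $k\ge3$, $k$-th derivatives of order $O(n^{-(k-1)/2})$ (so $O(n^{-1})$), so that $h(u)\doteq h_0+h_iu_i+h_{ij}u_iu_j$. Put $\mathcal{R}(h)=\{(u,v)\mid v\le -h(u),\,u\in\mathbb{R}^m\}$. $\mathrm{proj}(H|y)=\arg\min_{\mu\in\partial H}\|y-\mu\|$.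 For $\sigma^2>0$, $P_{\sigma^2}(\cdot\mid y)$ is the probability with respect to $Y^*\mid y\sim N_{m+1}(y,\sigma^2I_{m+1})$; the bootstrap probability of a region $D$ is $\alpha_{\sigma^2}(D|y)=P_{\sigma^2}(Y^*\in D\mid y)$, $\psi_{\sigma^2}(D|y)=\sigma\bar\Phi^{-1}(\alpha_{\sigma^2}(D|y))$ and $p_{\sigma^2}(D|y)=\bar\Phi(\psi_{\sigma^2}(D|y))$. For $\sigma^2\le0$, $\psi_{\sigma^2}(D|y)$ (and hence $p_{\sigma^2}(D|y)$) is defined by extrapolation: fit the linear model $\beta_0+\beta_1\sigma^2$ to the values of $\psi_{\sigma^2}(D|y)$ at several (at least two) distinct fixed $\sigma^2>0$, and evaluate the fitted line at the required $\sigma^2$. The double bootstrap uses, for a general point $y$, $\mathrm{proj}(H|y)$ in place of $\hat\mu$, where an error of order $O(n^{-1/2})$ in its $u$-coordinates (and $O(n^{-1})$ deviation in $v$ from the surface $v=-h(u)$) is allowed; the same convention applies to evaluating $p_{\mathrm{BP},1}(H|S,Y^* )$. The selective $p$-value is $$p_{\mathrm{SI}}(H|S,y)=\frac{\bar\Phi(\psi_{-1}(H|y))}{\bar\Phi(\psi_{-1}(H|y)+\psi_0(S|y))}.$$ A $p$-value $p(H|S,y)$ is second order accurate (resp. first order accurate) if, for any $0<\alpha<1$, $P(p(H|S,Y)<\alpha\mid\mu)/P(Y\in S\mid\mu)$ equals $\alpha$ with error $O(n^{-1})$ (resp. $O(n^{-1/2})$) for all $\mu\in\partial H$. *)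

(* Defs.v *)
From HB Require Import structures.
From mathcomp Require Import all_boot all_order all_algebra.
From mathcomp Require Import all_classical all_reals all_analysis.
From mathcomp Require Import measurable_realfun.

Set Implicit Arguments.
Unset Strict Implicit.
Unset Printing Implicit Defensive.

Import Order.TTheory GRing.Theory Num.Theory.
Import numFieldNormedType.Exports.

Local Open Scope classical_set_scope.
Local Open Scope ring_scope.

(* Row vectors carry the sigma-algebra generated by the coordinates, as tuples
   do in the library; for T = R it is the Borel sigma-algebra of R^n. *)
Definition rV_display : measure_display -> measure_display.
Proof. exact. Qed.

Section measurable_rV.
Context {d} {T : sigmaRingType d} (n : nat).

Let coord : 'I_n -> 'rV[T]_n -> T := fun i x => x 0 i.

Let rV_set0 : g_sigma_preimage coord set0.
Proof. exact: sigma_algebra0. Qed.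

Let rV_setC A : g_sigma_preimage coord A -> g_sigma_preimage coord (~` A).
Proof. exact: sigma_algebraC. Qed.

Let rV_bigcup (F : (set _)^nat) : (forall i, g_sigma_preimage coord (F i)) ->
  g_sigma_preimage coord (\bigcup_i (F i)).
Proof. exact: sigma_algebra_bigcup. Qed.

HB.instance Definition _ := @isMeasurable.Build (rV_display d)
  'rV[T]_n (g_sigma_preimage coord) rV_set0 rV_setC rV_bigcup.

End measurable_rV.

Lemma measurable_rV_coord d (T : sigmaRingType d) n (i : 'I_n) :
  measurable_fun [set: 'rV[T]_n] (fun x => x 0 i).
Proof.
move=> _ Y mY; rewrite setTI; apply: sub_sigma_algebra => /=.
rewrite -bigcup_seq/=; exists i => /=; first by rewrite mem_index_enum.
by exists Y => //; rewrite setTI.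
Qed.

Lemma measurable_fun_rVP d1 d2 (T1 : measurableType d1) (T2 : measurableType d2)
    n (f : T1 -> 'rV[T2]_n) :
  (forall i, measurable_fun [set: T1] (fun x => f x 0 i)) ->
  measurable_fun [set: T1] f.
Proof.
move=> mf; apply: (@measurability _ _ _ _ [set: T1] f
  (\big[setU/set0]_(i < n)
     preimage_set_system setT (fun x : 'rV[T2]_n => x 0 i) measurable)) => //.
move=> _ [B + <-]; rewrite -bigcup_seq => -[i _ [A mA <-]].
rewrite [X in measurable (_ `&` X)](_ : _ = (fun x => f x 0 i) @^-1` A).
  exact: mf.
by rewrite setTI.
Qed.

Section gaussian.
Context {R : realType}.

Definition rV_cons k (z : R * 'rV[R]_k) : 'rV[R]_k.+1 :=
  @row_mx _ 1 1 k (const_mx z.1) z.2.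

Lemma measurable_rV_cons k : measurable_fun setT (@rV_cons k).
Proof.
apply: measurable_fun_rVP => i.
case: (@splitP 1 k i) => j ij.
  have -> : i = lshift k j by exact: ord_inj.
  have -> : (fun z => rV_cons z 0 (lshift k j)) = fst.
    by apply/funext => z; apply: etrans (row_mxEl _ _ _ _) _; rewrite mxE.
  exact: measurable_fst.
have -> : i = rshift 1 j by exact: ord_inj.
have -> : (fun z => rV_cons z 0 (rshift 1 j)) =
    (fun v : 'rV[R]_k => v 0 j) \o snd.
  by apply/funext => z; exact: row_mxEr.
by apply: measurableT_comp => //; exact: measurable_rV_coord.
Qed.

HB.instance Definition _ k :=
  isMeasurableFun.Build _ _ _ _ (@rV_cons k) (@measurable_rV_cons k).

(* N(0, 1) transported along the identity from measurableTypeR R, the carrier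
   of normal_prob, to R itself (the two sigma-algebras are convertible) *)
Definition idTR : measurableTypeR R -> R := idfun.

Lemma measurable_idTR : measurable_fun setT idTR.
Proof. exact: measurable_id. Qed.

HB.instance Definition _ :=
  isMeasurableFun.Build _ _ _ _ idTR measurable_idTR.

Definition std_normal1 : probability R R :=
  distribution (normal_prob (0 : R) 1) idTR.

Lemma std_normal1E (A : set R) : std_normal1 A = normal_prob 0 1 A.
Proof. by []. Qed.

(* N_k(0, I_k) as the k-fold product of N(0, 1) *)
Fixpoint std_normal k : probability 'rV[R]_k R :=
  if k is k'.+1 then
    distribution (std_normal1 \x std_normal k')%E (@rV_cons k')
  else \d_(0 : 'rV[R]_0).

Definition affine m (sigma : R) (mu z : 'rV[R]_m * R) : 'rV[R]_m * R :=
  (mu.1 + sigma *: z.1, mu.2 + sigma * z.2).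

Lemma measurable_affine m sigma mu : measurable_fun setT (@affine m sigma mu).
Proof.
have mline (a b : R) : measurable_fun setT (fun x : R => a + b * x).
  by apply: continuous_measurable_fun => x; apply: cvgD; [exact: cvg_cst|
    apply: cvgM; [exact: cvg_cst|exact: cvg_id]].
apply/measurable_fun_pairP; split => /=.
  apply: measurable_fun_rVP => i.
  rewrite (_ : (fun _ => _) =
    (fun x => mu.1 0 i + sigma * x) \o (fun v : 'rV[R]_m => v 0 i) \o fst);
    last by apply/funext => z /=; rewrite !mxE.
  apply: measurableT_comp => //; apply: measurableT_comp => //.
  exact: measurable_rV_coord.
exact: (measurableT_comp (mline _ _)).
Qed.

HB.instance Definition _ m sigma mu :=
  isMeasurableFun.Build _ _ _ _ (@affine m sigma mu)
    (@measurable_affine m sigma mu).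

(* N_{m+1}(mu, sigma^2 I_{m+1}) on the points (u, v) of R^m x R = R^(m+1) *)
Definition mvnormal m (sigma : R) (mu : 'rV[R]_m * R) :
    probability ('rV[R]_m * R)%type R :=
  distribution (std_normal m \x std_normal1)%E (affine sigma mu).

End gaussian.

Notation pt R m := ('rV[R]_m * R)%type.

Section bootstrap.
Context {R : realType}.

Definition Phibar (x : R) : R := fine (std_normal1 `]x, +oo[%classic).

Definition Phibar_inv (p : R) : R := xget 0 [set x | Phibar x = p].

(* P_{sigma2}(Y* in D | mu) *)
Definition Pr m (sigma2 : R) (mu : pt R m) (D : set (pt R m)) : R :=
  fine (mvnormal (Num.sqrt sigma2) mu D).

Definition psi_pos m (D : set (pt R m)) (y : pt R m) (sigma2 : R) : R :=
  Num.sqrt sigma2 * Phibar_inv (Pr sigma2 y D).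

Definition wmean (grid : seq R) (w f : R -> R) : R :=
  (\sum_(t <- grid) w t * f t) / \sum_(t <- grid) w t.

(* Value at x of the line b0 + b1 * t fitted to the values f t, t in grid, by
   least squares with weights w (w = 1 is ordinary least squares). *)
Definition fitted_line (grid : seq R) (w f : R -> R) (x : R) : R :=
  let tbar := wmean grid w id in
  let b1 := (\sum_(t <- grid) w t * (t - tbar) * f t) /
            (\sum_(t <- grid) w t * (t - tbar) ^+ 2) in
  wmean grid w f + b1 * (x - tbar).

Definition psi (grid : seq R) (w : R -> R) m
    (sigma2 : R) (D : set (pt R m)) (y : pt R m) : R :=
  if 0 < sigma2 then psi_pos D y sigma2
  else fitted_line grid w (psi_pos D y) sigma2.

Definition pval (grid : seq R) (w : R -> R) m
    (sigma2 : R) (D : set (pt R m)) (y : pt R m) : R :=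
  Phibar (psi grid w sigma2 D y).

Definition pSI (grid : seq R) (w : R -> R) m
    (H S : set (pt R m)) (y : pt R m) : R :=
  Phibar (psi grid w (-1) H y) /
  Phibar (psi grid w (-1) H y + psi grid w 0 S y).

(* [_at] versions: mu is the point used as mu^ at the observed y, while muhat
   is the map used at the bootstrap replicates Y* *)
Definition pBP1_at (grid : seq R) (w : R -> R) m
    (sigma2 : R) (H S : set (pt R m)) (y mu : pt R m) : R :=
  pval grid w sigma2 H y / Pr 1 mu S.

Definition pBP1 (grid : seq R) (w : R -> R) m (sigma2 : R)
    (muhat : pt R m -> pt R m) (H S : set (pt R m)) (y : pt R m) : R :=
  pBP1_at grid w sigma2 H S y (muhat y).

Definition pBP2_at (grid : seq R) (w : R -> R) m (sigma2 : R)
    (muhat : pt R m -> pt R m) (H S : set (pt R m)) (y mu : pt R m) : R :=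
  Pr 1 mu [set ystar | pBP1 grid w sigma2 muhat H S ystar <
                       pBP1_at grid w sigma2 H S y mu] / Pr 1 mu S.

Definition pBP2 (grid : seq R) (w : R -> R) m (sigma2 : R)
    (muhat : pt R m -> pt R m) (H S : set (pt R m)) (y : pt R m) : R :=
  pBP2_at grid w sigma2 muhat H S y (muhat y).

End bootstrap.

Section geometry.
Context {R : realType} {m : nat}.

Definition region (h : 'rV[R]_m -> R) : set (pt R m) :=
  [set y | y.2 <= - h y.1].

Definition boundary (D : set (pt R m)) : set (pt R m) :=
  closure D `\` interior D.

(* The norm of the library on R^m x R is the sup norm, hence this one. *)
Definition enorm (y : pt R m) : R :=
  Num.sqrt (\sum_(i < m) y.1 0 i ^+ 2 + y.2 ^+ 2).

(* mu is a minimiser in proj(D|y) = argmin_{mu in boundary D} ||y - mu|| *)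
Definition is_proj (D : set (pt R m)) (y mu : pt R m) : Prop :=
  boundary D mu /\ forall nu, boundary D nu -> enorm (y - mu) <= enorm (y - nu).

(* pderiv [:: i1; ...; ik] f = d^k f / du_i1 ... du_ik *)
Definition pderiv (I : seq 'I_m) (f : 'rV[R]_m -> R) : 'rV[R]_m -> R :=
  foldr (fun i (g : 'rV[R]_m -> R) => 'D_(delta_mx 0 i) g) f I.

Definition smooth (f : 'rV[R]_m -> R) : Prop :=
  forall (I : seq 'I_m) (u : 'rV[R]_m), differentiable (pderiv I f) u.

(* Coefficients of h(u) = h_0 + h_i u_i + h_ij u_i u_j + ... *)
Definition taylor0 (f : 'rV[R]_m -> R) : R := f 0.
Definition taylor1 (f : 'rV[R]_m -> R) (i : 'I_m) : R := pderiv [:: i] f 0.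
Definition taylor2 (f : 'rV[R]_m -> R) (i j : 'I_m) : R :=
  pderiv [:: i; j] f 0 / 2.
Definition taylor2_tr (f : 'rV[R]_m -> R) : R := \sum_(i < m) taylor2 f i i.

End geometry.

Section asymptotics.
Context {R : realType}.

Definition rsqrt (n : nat) : R := (Num.sqrt n%:R)^-1.

Definition isO (a f : nat -> R) : Prop :=
  (f : nat -> R^o) =O_\oo (a : nat -> R^o).

Definition aeq (f g : nat -> R) : Prop :=
  isO (fun n => n%:R^-1) (fun n => f n - g n).

(* f_n(x) = O(a_n) in the neighbourhood of size O(1) of the origin.  The
   estimates are integrated against Gaussian laws, so uniformity on each fixed
   ball is not enough (the mass outside a fixed ball does not vanish); the bound
   is required on a ball of radius c * sqrt n, with constants that may grow
   polynomially in |x|. *)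
Definition locO (V : normedZmodType R) (a : nat -> R) (f : nat -> V -> R) :
    Prop :=
  exists c C : R, exists q : nat, 0 < c /\
    \forall n \near \oo, forall x : V, `|x| <= c * Num.sqrt n%:R ->
      `|f n x| <= C * (1 + `|x|) ^+ q * a n.

Definition nearly_parallel m (h : nat -> 'rV[R]_m -> R) : Prop :=
  [/\ forall n, smooth (h n),
      isO (fun=> 1) (fun n => taylor0 (h n)),
      forall i, isO rsqrt (fun n => taylor1 (h n) i),
      forall i j, isO rsqrt (fun n => taylor2 (h n) i j) &
      forall I : seq 'I_m, (3 <= size I)%N ->
        locO (fun n => rsqrt n ^+ (size I).-1) (fun n => pderiv I (h n))].

(* muhat n y is a projection of y onto the boundary of region (h n), up to
   O(n^(-1/2)) in the coordinates u, and lies within O(n^-1) of the surface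
   v = - h u.  Measurability makes the double bootstrap probability
   meaningful. *)
Definition approx_proj m (h : nat -> 'rV[R]_m -> R)
    (muhat : nat -> pt R m -> pt R m) : Prop :=
  (forall n, measurable_fun setT (muhat n)) /\
  exists proj : nat -> pt R m -> pt R m,
    [/\ forall n y, is_proj (region (h n)) y (proj n y),
        locO rsqrt (fun n y => `|(muhat n y).1 - (proj n y).1|) &
        locO (fun n => n%:R^-1)
          (fun n y => (muhat n y).2 + h n (muhat n y).1)].

(* The p-value p is accurate with error O(a_n), uniformly over the boundary
   points mu of H within any distance B = O(1) of the origin. *)
Definition accurate (a : nat -> R) m (H S : nat -> set (pt R m))
    (p : nat -> pt R m -> R) : Prop :=
  forall alpha : R, 0 < alpha < 1 -> forall B : R, exists C : R,
    \forall n \near \oo, forall mu, boundary (H n) mu -> `|mu| <= B ->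
      `|Pr 1 mu [set y | p n y < alpha] / Pr 1 mu (S n) - alpha| <= C * a n.

Definition second_order_accurate m := @accurate (fun n => n%:R^-1) m.
Definition first_order_accurate m := @accurate rsqrt m.

(* f_n(Y) = O_p(a_n) for Y ~ N(mu, I), uniformly in |mu| <= B = O(1) *)
Definition isOp m (a : nat -> R) (f : nat -> pt R m -> R) : Prop :=
  forall B e : R, 0 < e -> exists C : R,
    \forall n \near \oo, forall mu, `|mu| <= B ->
      Pr 1 mu [set y | C * a n < `|f n y|] <= e.

End asymptotics.

(* Main.v *)
From HB Require Import structures.
Require Import Defs.
From mathcomp Require Import all_boot all_order all_algebra.
From mathcomp Require Import all_classical all_reals all_analysis.
From mathcomp Require Import measurable_realfun ring lra.

Set Implicit Arguments.
Unset Strict Implicit.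
Unset Printing Implicit Defensive.

Import Order.TTheory GRing.Theory Num.Theory.
Import numFieldNormedType.Exports.

Local Open Scope classical_set_scope.
Local Open Scope ring_scope.

(* Conditionally on u, the event {v > x + q(u)} has probability Phibar(x + q(u)).
   For a quadratic polynomial q with coefficients O(n^(-1/2)) the second order
   expansion of Phibar at x + E q(U) = x + tr q shows that its probability is
   Phibar(x + tr q) + O(n^-1); errors O(n^-1) in the event, polynomial in u, and
   the part of the space outside a ball of radius ln n are negligible.

   All probabilities of the theorem are of this kind.  Applied to the regions,
   this gives P_1(S | mu) and psi_t(H | y) = v + h(u) + t h_ii + O(n^-1), affine
   in t.  Hence near the surface of H the p-value p_BP1 has the form
   Phibar(v + h(u) + tau h_ii) / Phibar(h(u) - s(u) - f_ii) with tau = sigma2 and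
   f = s.  For a p-value of this form {p < c} is again such an event, of
   probability Phibar(x - (tau + 1) h_ii + K (h_ii - s_ii)) where x is the value
   matching c and K the relative slope of numerator and denominator.  The double
   bootstrap therefore has the same form with tau = -1 and f = h, whatever
   sigma2, and then a second use of the formula gives
   P(p < alpha | mu) = alpha P(S | mu) + O(n^-1), whereas for other tau or f an
   explicit term of order n^(-1/2) remains. *)

(** The expansions are nested: an approximation of [pBP1] enters a Gaussian probability that defines
    [pBP2], and this one enters a rejection probability. Pointwise O(n^-1) statements do not survive
    such nesting, so every estimate is proved for an arbitrary family of instances with common
    constants, and the observed point may then be replaced by a Gaussian replicate. Replicates reach
    distance ln n, while the expansions hold only at bounded distance from the surface; farther out
    only the side of the threshold on which the p-value falls is established. [sigma2] drops out
    because the value x matched by the observed p-value contains sigma2 h_ii and the level set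
    formula subtracts the same term. The trace s_ii turns into h_ii because, with rho = phi / Phibar
    at the argument of the denominator, the term K (h_ii - s_ii) multiplies the numerator by 1 - rho
    (h_ii - s_ii), while putting h_ii for s_ii multiplies the denominator by 1 + rho (h_ii - s_ii):
    to first order the quotient changes equally. The same cancellation frees the rejection
    probability of s_ii, which leaves an error in tau + 1 and h_ii - f_ii only. *)

Notation gamma1 := (@std_normal1 _).

(** * The normal tail function *)

Section Phibar.
Context {R : realType}.
Implicit Types x y t p : R.
Local Notation leb := (@lebesgue_measure R).

Definition phi : R -> R := normal_pdf 0 1.

Lemma phiE x : phi x = normal_peak (1 : R) * expR (- (x ^+ 2) / 2).
Proof.
rewrite /phi normal_pdfE ?oner_neq0//= /normal_fun subr0; congr (_ * expR _).
by rewrite expr1n mulNr.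
Qed.

Lemma phi_gt0 x : 0 < phi x.
Proof. by rewrite phiE mulr_gt0 ?expR_gt0 ?normal_peak_gt0 ?oner_neq0. Qed.

Lemma phi_ge0 x : 0 <= phi x. Proof. exact: ltW (phi_gt0 x). Qed.

Lemma phiN x : phi (- x) = phi x.
Proof. by rewrite !phiE sqrrN. Qed.

Lemma normal_peak1_le : normal_peak (1 : R) <= 2^-1.
Proof.
rewrite /normal_peak expr1n mul1r lef_pV2 ?posrE ?sqrtr_gt0//; last first.
  by rewrite mulrn_wgt0// pi_gt0.
rewrite -(@ler_pXn2r _ 2) ?nnegrE ?sqrtr_ge0//.
rewrite sqr_sqrtr; last by rewrite mulrn_wge0// pi_ge0.
by have := pi_ge2 R; rewrite -mulr_natr => h; lra.
Qed.

Lemma phi_le1 x : phi x <= 1.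
Proof.
apply: (le_trans (normal_pdf_ub 0 x (oner_neq0 R))).
by apply: (le_trans normal_peak1_le); lra.
Qed.

(* For |x| <= |y|, e^(-x^2/2) - e^(-y^2/2) <= e^(-x^2/2) (y^2 - x^2) / 2. *)
Lemma phi_lip x y : `|phi x - phi y| <= `|x - y|.
Proof.
wlog xy : x y / `|x| <= `|y|.
  move=> H; case: (leP `|x| `|y|) => [|/ltW] /H //.
  by rewrite distrC (distrC y).
have [xy1|xy1] := leP 1 `|x - y|.
  apply: le_trans xy1; rewrite ler_norml.
  by move: (phi_ge0 x) (phi_ge0 y) (phi_le1 x) (phi_le1 y) => *; lra.
have xy2 : x ^+ 2 <= y ^+ 2.
  by rewrite -(real_normK (num_real x)) -(real_normK (num_real y)) ler_pXn2r.
have phile : phi y <= phi x.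
  rewrite !phiE ler_pM2l ?normal_peak_gt0 ?oner_neq0// ler_expR; lra.
rewrite ger0_norm ?subr_ge0// !phiE -mulrBr.
set E := expR (- x ^+ 2 / 2).
have E0 : 0 <= E by exact: expR_ge0.
have E1 : E <= 1 by rewrite expR_le1; have := sqr_ge0 x; lra.
have h1 : E - expR (- y ^+ 2 / 2) <= E * ((y ^+ 2 - x ^+ 2) / 2).
  have -> : expR (- y ^+ 2 / 2) = E * expR (- ((y ^+ 2 - x ^+ 2) / 2)).
    by rewrite -expRD; congr expR; lra.
  have := expR_ge1Dx (- ((y ^+ 2 - x ^+ 2) / 2)).
  by move=> ?; nra.
have h2 : E * `|x| <= 1.
  have : 1 + x ^+ 2 / 2 <= expR (x ^+ 2 / 2) by exact: expR_ge1Dx.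
  have -> : expR (x ^+ 2 / 2) = E^-1 by rewrite /E mulNr expRN invrK.
  move=> h3; have Egt0 : 0 < E by exact: expR_gt0.
  rewrite mulrC -ler_pdivlMr// mul1r; apply: le_trans h3.
  by rewrite -(real_normK (num_real x)); have := sqr_ge0 (`|x| - 1); nra.
have h3 : y ^+ 2 - x ^+ 2 <= `|x - y| * (2 * `|x| + 1).
  have -> : y ^+ 2 - x ^+ 2 = (y - x) * (y + x) by ring.
  apply: (le_trans (ler_norm _)); rewrite normrM distrC ler_wpM2l//.
  have : `|y| <= `|x| + `|x - y|.
    by have := ler_normB x (x - y); rewrite opprB subrKC.
  by have := ler_normD y x; lra.
have := normal_peak1_le; have := normal_peak_ge0 (1 : R).
set P := normal_peak _ => P0 P1.
have D0 := normr_ge0 (x - y); have x0 := normr_ge0 x.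
have h4 : E * ((y ^+ 2 - x ^+ 2) / 2) <= `|x - y| * (3 / 2).
  have l1 : E * (y ^+ 2 - x ^+ 2) <= E * (`|x - y| * (2 * `|x| + 1)).
    by rewrite ler_wpM2l.
  have l2 : `|x - y| * (E * `|x|) <= `|x - y| * 1 by rewrite ler_wpM2l.
  have l3 : `|x - y| * E <= `|x - y| * 1 by rewrite ler_wpM2l.
  lra.
have : P * (E - expR (- y ^+ 2 / 2)) <= P * (`|x - y| * (3 / 2)).
  by rewrite ler_wpM2l//; lra.
nra.
Qed.

Lemma continuous_phi : continuous phi.
Proof. exact: continuous_normal_pdf (oner_neq0 R). Qed.

Lemma gamma1E (A : set R) : gamma1 A = (\int[leb]_(x in A) (phi x)%:E)%E.
Proof. by []. Qed.

Lemma gamma1_fin (A : set R) : measurable A -> std_normal1 A \is a fin_num.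
Proof. by move=> mA; exact: fin_num_measure. Qed.

Lemma PhibarE x : (Phibar x)%:E = gamma1 `]x, +oo[%classic.
Proof. by rewrite /Phibar fineK// gamma1_fin. Qed.

Lemma Phibar_itv x y : x <= y ->
  (Phibar x - Phibar y)%:E = gamma1 `]x, y]%classic.
Proof.
move=> xy; rewrite EFinB !PhibarE.
have -> : `]x, +oo[%classic = `]x, y]%classic `|` `]y, +oo[%classic :> set R.
  apply/seteqP; split => z /=; rewrite !in_itv /= ?andbT.
    by move=> xz; case: (leP z y) => zy; [left; rewrite xz|right].
  by case=> [/andP[]//|]; exact: le_lt_trans.
rewrite measureU//; last first.
  apply/seteqP; split => z //=; rewrite !in_itv /= andbT => -[/andP[_ zy]].
  by rewrite ltNge zy.
by rewrite addeK// gamma1_fin.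
Qed.

Lemma Phibar_diff_le (M x y : R) : x <= y ->
  (forall z, x <= z <= y -> phi z <= M) ->
  Phibar x - Phibar y <= M * (y - x).
Proof.
move=> xy HM; rewrite -lee_fin Phibar_itv// gamma1E.
apply: (@le_trans _ _ (\int[leb]_(z in `]x, y]) M%:E)%E).
  apply: ge0_le_integral => //.
  - by move=> z _; rewrite lee_fin phi_ge0.
  - apply/measurable_EFinP/measurable_funTS; exact: measurable_normal_pdf.
  - by move=> z; rewrite /= in_itv /= lee_fin => ?; apply: HM; lra.
rewrite integral_cst//= lebesgue_measure_itv/= lte_fin.
case: ltP => h; first by rewrite -EFinB -EFinM.
have -> : y = x by lra.
by rewrite subrr mulr0 mule0.
Qed.

Lemma Phibar_diff_ge (M x y : R) : x <= y -> 0 <= M ->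
  (forall z, x <= z <= y -> M <= phi z) ->
  M * (y - x) <= Phibar x - Phibar y.
Proof.
move=> xy M0 HM; rewrite -lee_fin Phibar_itv// gamma1E.
apply: (@le_trans _ _ (\int[leb]_(z in `]x, y]) M%:E)%E); last first.
  apply: ge0_le_integral => //.
  - apply/measurable_EFinP/measurable_funTS; exact: measurable_normal_pdf.
  - by move=> z; rewrite /= in_itv /= lee_fin => ?; apply: HM; lra.
rewrite integral_cst//= lebesgue_measure_itv/= lte_fin.
case: ltP => h; first by rewrite -EFinB -EFinM.
have -> : y = x by lra.
by rewrite subrr mulr0 mule0.
Qed.

Lemma Phibar_anti x y : x <= y -> Phibar y <= Phibar x.
Proof.
by move=> xy; rewrite -subr_ge0 -lee_fin Phibar_itv//; exact: measure_ge0.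
Qed.

Lemma Phibar_lt x y : x < y -> Phibar y < Phibar x.
Proof.
move=> xy; have xley := ltW xy.
set r := Num.max `|x| `|y|.
have := @Phibar_diff_ge (phi r) x y xley (phi_ge0 _).
have h z : x <= z <= y -> phi r <= phi z.
  move=> zxy; rewrite !phiE ler_pM2l ?normal_peak_gt0 ?oner_neq0// ler_expR.
  have : z ^+ 2 <= r ^+ 2; last by lra.
  rewrite -(real_normK (num_real z)) ler_pXn2r ?nnegrE//; last first.
    by rewrite /r le_max normr_ge0.
  rewrite /r le_max; have [z0|z0] := leP 0 z.
    apply/orP; right; rewrite ger0_norm//.
    by apply: le_trans (ler_norm y); lra.
  apply/orP; left; rewrite ler0_norm ?(ltW z0)// -normrN.
  by apply: le_trans (ler_norm _); lra.
move=> /(_ h); have := phi_gt0 r.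
have : 0 < y - x by rewrite subr_gt0.
nra.
Qed.

Lemma Phibar_lip x y : `|Phibar x - Phibar y| <= `|x - y|.
Proof.
wlog xy : x y / x <= y.
  by move=> H; case: (leP x y) => [|/ltW] /H //; rewrite distrC (distrC y).
rewrite ger0_norm ?subr_ge0 ?Phibar_anti//.
rewrite ler0_norm ?subr_le0// opprB -[leRHS]mul1r.
by apply: Phibar_diff_le => // z _; exact: phi_le1.
Qed.

(** Between x and x + t the density stays within |t| of [phi x] by the Lipschitz bound, so its
    integral differs from [phi x * t] by at most t^2. *)
Lemma Phibar_taylor x t : `|Phibar (x + t) - Phibar x + phi x * t| <= t ^+ 2.
Proof.
have hz z : `|z - x| <= `|t| -> phi x - `|t| <= phi z <= phi x + `|t|.
  move=> hz; have := phi_lip z x; rewrite ler_norml => ?; lra.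
have [t0|/ltW t0] := leP 0 t.
  have h1 : Phibar x - Phibar (x + t) <= (phi x + t) * (x + t - x).
    apply: Phibar_diff_le => [|z xz]; first lra.
    by have := @hz z; rewrite !ger0_norm; lra.
  have h2 : (phi x - t) * (x + t - x) <= Phibar x - Phibar (x + t).
    (* [Phibar_diff_ge] asks for a nonnegative lower bound of the density; when [phi x - t] is
       negative, monotonicity of [Phibar] is already enough. *)
    have [h|/ltW h] := leP 0 (phi x - t).
      apply: Phibar_diff_ge => // [|z xz]; first lra.
      by have := @hz z; rewrite !ger0_norm; lra.
    have : 0 <= Phibar x - Phibar (x + t) by rewrite subr_ge0 Phibar_anti//; lra.
    nra.
  by rewrite ler_norml; apply/andP; split; nra.
have h1 : Phibar (x + t) - Phibar x <= (phi x - t) * (x - (x + t)).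
  apply: Phibar_diff_le => [|z xz]; first lra.
  by have := @hz z; rewrite !ler0_norm; lra.
have h2 : (phi x + t) * (x - (x + t)) <= Phibar (x + t) - Phibar x.
  have [h|/ltW h] := leP 0 (phi x + t).
    apply: Phibar_diff_ge => // [|z xz]; first lra.
    by have := @hz z; rewrite !ler0_norm; lra.
  have : 0 <= Phibar (x + t) - Phibar x by rewrite subr_ge0 Phibar_anti//; lra.
  nra.
by rewrite ler_norml; apply/andP; split; nra.
Qed.

Lemma PhibarN x : Phibar (- x) = 1 - Phibar x.
Proof.
apply: EFin_inj; rewrite EFinB !PhibarE.
have -> : 1%E = gamma1 setT :> \bar R by rewrite probability_setT.
have -> : gamma1 setT = (gamma1 `]-oo, x]%classic + gamma1 `]x, +oo[%classic)%E.
  rewrite -measureU//.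
    congr (gamma1 _); apply/seteqP; split => z //= _; rewrite !in_itv/= andbT.
    by case: (leP z x); [left|right].
  apply/seteqP; split => z //=; rewrite !in_itv /= andbT => -[zx].
  by rewrite ltNge zx.
rewrite addeK ?gamma1_fin// !gamma1E.
(* The half-line below x becomes the one below -(-x), the shape required by the reflection of the
   variable; the endpoint that the reflection adds is then removed. *)
rewrite -[in RHS](opprK x).
rewrite ge0_integration_by_substitutionNy//; last 2 first.
- by apply: continuous_subspaceT; exact: continuous_phi.
- by move=> z _; exact: phi_ge0.
rewrite -integral_itv_obnd_cbnd; last first.
  apply/measurable_EFinP/measurable_funTS.
  rewrite (_ : _ \o _ = phi); first exact: measurable_normal_pdf.
  by apply/funext => z /=; rewrite phiN.
by apply: eq_integral => z _ /=; rewrite phiN.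
Qed.

End Phibar.

(** * Integration against the normal density *)

Section density.
Context {R : realType}.
Local Notation leb := (@lebesgue_measure R).
Local Notation N01 := (normal_prob (0 : R) 1).

Let phi_ge0E (x : measurableTypeR R) : (0 <= (phi x)%:E)%E.
Proof. by rewrite lee_fin phi_ge0. Qed.

Let mphi : measurable_fun setT (fun x : measurableTypeR R => (phi x)%:E).
Proof. by apply/measurable_EFinP; exact: measurable_normal_pdf. Qed.

Let integral_normal_indic (E : set (measurableTypeR R)) : measurable E ->
  (\int[N01]_x (\1_E x)%:E = \int[leb]_x ((\1_E x)%:E * (phi x)%:E))%E.
Proof.
move=> mE; rewrite integral_indic// setIT.
transitivity (\int[leb]_(x in E) (phi x)%:E)%E; first by [].
rewrite [LHS]integral_mkcond.
apply: eq_integral => x _; rewrite patchE indicE.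
by case: ifPn => xE; rewrite ?mul1e ?mul0e.
Qed.

Import HBNNSimple.

Let integral_normal_nnsfun (f : {nnsfun measurableTypeR R >-> R}) :
  (\int[N01]_x (f x)%:E = \int[leb]_x ((f x)%:E * (phi x)%:E))%E.
Proof.
under [LHS]eq_integral do rewrite fimfunE -fsumEFin//.
rewrite [LHS]ge0_integral_fsum//; last 2 first.
  - by move=> r; exact/measurable_EFinP/measurableT_comp.
  - by move=> n x _; rewrite EFinM nnfun_muleindic_ge0.
under [RHS]eq_integral.
  move=> x xD; rewrite fimfunE -fsumEFin// ge0_mule_fsuml; last first.
    by move=> r; rewrite EFinM nnfun_muleindic_ge0.
  over.
rewrite [RHS]ge0_integral_fsum//; last 2 first.
  - move=> r; apply: emeasurable_funM => //.
    by apply/measurable_EFinP; do 2 apply/measurableT_comp => //.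
  - by move=> n x _; rewrite EFinM mule_ge0// nnfun_muleindic_ge0.
apply: eq_fsbigr => r _.
rewrite integralZl_indic_nnsfun//= integral_normal_indic//.
have [r0|r0] := leP 0 r.
  rewrite -ge0_integralZl//.
  - by apply: eq_integral => x _; rewrite EFinM muleA.
  - apply: emeasurable_funM => //.
    exact/measurable_EFinP/measurable_indic.
  - by move=> x _; rewrite mule_ge0.
(* A nonnegative simple function does not take the negative value r, so both sides vanish. *)
have f0 : f @^-1` [set r] = set0.
  apply/seteqP; split => x //= fx; have : 0 <= f x by [].
  by rewrite fx leNgt r0.
rewrite f0 [X in (_ * X)%E]integral0_eq ?mule0; last first.
  by move=> x _; rewrite indic0 mul0e.
by rewrite integral0_eq// => x _; rewrite indic0 mulr0 mul0e.
Qed.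

(** Standard extension: indicators, then simple functions by linearity, then monotone limits of
    simple functions. *)
Lemma ge0_integral_normal_prob (f : measurableTypeR R -> \bar R) :
  measurable_fun setT f -> (forall x, 0 <= f x)%E ->
  (\int[N01]_x f x = \int[leb]_x (f x * (phi x)%:E))%E.
Proof.
move=> mf f0.
pose f_ := nnsfun_approx measurableT mf.
transitivity (lim (\int[N01]_x (f_ n x)%:E @[n --> \oo])%E).
  rewrite -monotone_convergence//=.
  - apply: eq_integral => ? /[!inE] xD; apply/esym/cvg_lim => //=.
    exact: cvg_nnsfun_approx.
  - by move=> n; exact/measurable_EFinP/measurable_funTS.
  - by move=> n ? _; rewrite lee_fin.
  - by move=> ? _ ? ? mn; rewrite lee_fin; exact/lefP/nd_nnsfun_approx.
rewrite (_ : \int[leb]_x _ = lim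
    (\int[leb]_x ((f_ n x)%:E * (phi x)%:E) @[n --> \oo]))%E.
  by apply: congr_lim; apply/funext => n /=; exact: integral_normal_nnsfun.
rewrite -monotone_convergence//=.
- apply: eq_integral => x /[!inE] xD; apply/esym/cvg_lim => //.
  by apply: cvgeZr => //; exact: cvg_nnsfun_approx.
- move=> n; apply: emeasurable_funM => //.
  exact/measurable_EFinP/measurable_funTS.
- by move=> n ? _; rewrite mule_ge0// lee_fin.
- move=> ? _ ? ? mn; rewrite lee_wpmul2r// lee_fin.
  exact/lefP/nd_nnsfun_approx.
Qed.

Lemma ge0_integral_gamma1 (f : R -> \bar R) :
  measurable_fun setT f -> (forall x, 0 <= f x)%E ->
  (\int[gamma1]_x f x = \int[leb]_x (f x * (phi x)%:E))%E.
Proof.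
move=> mf f0; rewrite -ge0_integral_normal_prob//.
rewrite /std_normal1 /distribution.
by rewrite (@ge0_integral_pushforward _ _ _ _ _ idTR).
Qed.

(** Completing the square turns e^(tx) times the N(0, 1) density into e^(t^2/2) times the N(t, 1)
    density. *)
Lemma mgf_gamma1 (t : R) :
  (\int[gamma1]_x (expR (t * x))%:E = (expR (t ^+ 2 / 2))%:E)%E.
Proof.
rewrite ge0_integral_gamma1//; last first.
  by apply/measurable_EFinP; apply: measurableT_comp => //; exact: measurable_funM.
transitivity (\int[leb]_x ((expR (t ^+ 2 / 2))%:E * (normal_pdf t 1 x)%:E))%E.
  apply: eq_integral => x _; rewrite -!EFinM; congr EFin.
  rewrite phiE normal_pdfE ?oner_neq0//= /normal_fun.
  rewrite mulrCA [RHS]mulrCA -!expRD; congr (_ * expR _).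
  by rewrite expr1n; lra.
rewrite ge0_integralZl//; last 2 first.
- by apply/measurable_EFinP; exact: measurable_normal_pdf.
- by move=> x _; rewrite lee_fin normal_pdf_ge0.
by rewrite integral_normal_pdf mule1.
Qed.

End density.

Opaque Phibar std_normal1.

Section probability_integrals.
Context d (T : measurableType d) {R : realType} (P : probability T R).
Implicit Types f g : T -> R.

Lemma prob_integrable_le f g :
  P.-integrable setT (EFin \o g) -> measurable_fun setT f ->
  (forall x, `|f x| <= g x) -> P.-integrable setT (EFin \o f).
Proof.
move=> ig mf fg; apply: le_integrable ig => //; first exact/measurable_EFinP.
by move=> x _ /=; rewrite lee_fin; exact: le_trans (ler_norm _).
Qed.

Lemma prob_integrable_cst (c : R) : P.-integrable setT (EFin \o (fun=> c)).
Proof. exact: finite_measure_integrable_cst. Qed.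

Lemma prob_Rintegral_cst (c : R) : \int[P]_x c = c.
Proof. by rewrite Rintegral_cst//= probability_setT mulr1. Qed.

Lemma prob_integrableD f g : P.-integrable setT (EFin \o f) ->
  P.-integrable setT (EFin \o g) ->
  P.-integrable setT (EFin \o (fun x => f x + g x)).
Proof. by move=> fi gi; apply: eq_integrable (integrableD _ fi gi). Qed.

Lemma prob_integrableZ c f : P.-integrable setT (EFin \o f) ->
  P.-integrable setT (EFin \o (fun x => c * f x)).
Proof. by move=> fi; apply: eq_integrable (integrableZl _ c fi). Qed.

Lemma prob_integrable_sum (I : Type) (s : seq I) (F : I -> T -> R) :
  (forall i, P.-integrable setT (EFin \o F i)) ->
  P.-integrable setT (EFin \o (fun x => \sum_(i <- s) F i x)).
Proof.
move=> Fi; elim: s => [|a s IH].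
  by under [X in EFin \o X]eq_fun do rewrite big_nil; exact: prob_integrable_cst.
by under [X in EFin \o X]eq_fun do rewrite big_cons; exact: prob_integrableD.
Qed.

Lemma prob_Rintegral_sum (I : Type) (s : seq I) (F : I -> T -> R) :
  (forall i, P.-integrable setT (EFin \o F i)) ->
  \int[P]_x (\sum_(i <- s) F i x) = \sum_(i <- s) \int[P]_x F i x.
Proof.
move=> Fi; elim: s => [|a s IH].
  rewrite big_nil; under eq_Rintegral do rewrite big_nil.
  exact: prob_Rintegral_cst.
rewrite big_cons -IH; under eq_Rintegral do rewrite big_cons.
by rewrite RintegralD//; exact: prob_integrable_sum.
Qed.

Lemma prob_fine_le (A B : set T) : measurable A -> measurable B -> A `<=` B ->
  fine (P A) <= fine (P B).
Proof.
move=> mA mB AB; rewrite fine_le ?fin_num_measure//.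
by apply: le_measure; rewrite ?inE.
Qed.

Lemma prob_fine_setU (A B : set T) : measurable A -> measurable B ->
  fine (P (A `|` B)) <= fine (P A) + fine (P B).
Proof.
move=> mA mB; rewrite -fineD ?fin_num_measure//.
apply: fine_le; rewrite ?fin_numD ?fin_num_measure//; first exact: measurableU.
exact: measureU2.
Qed.

Lemma prob_fine_setC (A : set T) : measurable A ->
  fine (P (~` A)) = 1 - fine (P A).
Proof. by move=> mA; rewrite probability_setC// fineB ?fin_num_measure. Qed.

Lemma prob_fine_ge0 (A : set T) : 0 <= fine (P A).
Proof. exact/fine_ge0/measure_ge0. Qed.

Lemma prob_fine_le1 (A : set T) : measurable A -> fine (P A) <= 1.
Proof.
move=> mA; rewrite -[leRHS]/(fine 1%E) fine_le ?fin_num_measure//.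
exact: probability_le1.
Qed.

End probability_integrals.

(** * Moments and tails of N(0, 1) *)

Section gamma1_moments.
Context {R : realType}.
Implicit Types x t r : R.

Lemma measurable_normR : measurable_fun setT (fun x : R => `|x|).
Proof. by apply: continuous_measurable_fun; exact: norm_continuous. Qed.

Lemma expRV_sub1 x : 0 <= x -> expR x <= 1 + x * expR x.
Proof.
move=> x0; have := expR_ge1Dx (- x); have := expR_gt0 x.
have := expRxMexpNx_1 x => e1 e2 e3.
have : expR x * (1 - x) <= expR x * expR (- x) by rewrite ler_wpM2l// ltW.
by lra.
Qed.

Lemma integrable_gamma1_exp t :
  gamma1.-integrable setT (EFin \o (fun x : R => expR (t * x))).
Proof.
have mexp : measurable_fun setT (fun x : R => expR (t * x)).
  by apply: measurableT_comp => //; exact: measurable_funM.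
apply/integrableP; split; first exact/measurable_EFinP.
under eq_integral do rewrite /= ger0_norm ?expR_ge0//.
by rewrite mgf_gamma1 ltry.
Qed.

Lemma gamma1_exp t : \int[gamma1]_x expR (t * x) = expR (t ^+ 2 / 2).
Proof. by rewrite /Rintegral mgf_gamma1. Qed.

(** Since (1 + |x|)^q <= q! e^(1 + |x|), the bound is dominated by a multiple of e^(2|x|) <= e^(2x)
    + e^(-2x), which the moment generating function shows integrable. *)
Lemma gamma1_integrable_le (f : R -> R) (C : R) (q : nat) :
  measurable_fun setT f -> (forall x, `|f x| <= C * ((1 + `|x|) ^+ q * expR `|x|)) ->
  gamma1.-integrable setT (EFin \o f).
Proof.
move=> mf fC.
have /(_ (`|C| * (q`!%:R * expR 1))) :=
  prob_integrableZ _ (prob_integrableD (integrable_gamma1_exp 2) (integrable_gamma1_exp (- 2))).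
move/prob_integrable_le; apply => // x; apply: (le_trans (fC x)).
rewrite -mulrA; apply: (@le_trans _ _ (`|C| * ((1 + `|x|) ^+ q * expR `|x|))).
  by rewrite ler_wpM2r// ?ler_norm// mulr_ge0 ?expR_ge0// exprn_ge0// addr_ge0.
rewrite ler_wpM2l//.
have h : (1 + `|x|) ^+ q <= q`!%:R * (expR 1 * expR `|x|).
  have x0 : 0 <= 1 + `|x| by rewrite addr_ge0.
  rewrite -expRD; case: q {fC} => [|q].
    by rewrite expr0 fact0 mul1r -expR0 ler_expR.
  have := expR_ge1Dxn q x0; rewrite -ler_pdivrMl ?ltr0n ?fact_gt0//.
  by rewrite mulrC; lra.
have e0 := expR_gt0 `|x|.
apply: (@le_trans _ _ (q`!%:R * (expR 1 * expR `|x|) * expR `|x|)).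
  by rewrite ler_wpM2r// ltW.
rewrite -!mulrA; do 2 rewrite ler_wpM2l ?ler0n ?expR_ge0//.
rewrite -expRD; have [x0|x0] := leP 0 x.
  rewrite (ger0_norm x0); have := expR_gt0 (- 2 * x); have -> : x + x = 2 * x by ring.
  by lra.
rewrite (ltr0_norm x0); have := expR_gt0 (2 * x); have -> : - x - x = - 2 * x by ring.
by lra.
Qed.

Lemma gamma1_integrable_poly (f : R -> R) (C : R) (q : nat) :
  measurable_fun setT f -> (forall x, `|f x| <= C * (1 + `|x|) ^+ q) ->
  gamma1.-integrable setT (EFin \o f).
Proof.
move=> mf fC; apply: (gamma1_integrable_le (C := `|C|) (q := q) mf) => x.
apply: (le_trans (fC x)); apply: (@le_trans _ _ (`|C| * (1 + `|x|) ^+ q)).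
  by rewrite ler_wpM2r ?ler_norm// exprn_ge0 ?addr_ge0.
rewrite ler_wpM2l// ler_peMr ?exprn_ge0 ?addr_ge0//.
by rewrite -[leLHS]expR0 ler_expR.
Qed.

(* The first two moments are read off the moment generating function as t
   tends to 0. *)
Lemma gamma1_mean : \int[gamma1]_x (x : R) = 0.
Proof.
set v := (X in X = 0).
have ix : gamma1.-integrable setT (EFin \o (fun x : R => x)).
  apply: (@gamma1_integrable_poly _ 1 1) => // x; rewrite expr1 mul1r; lra.
have h t : 1 + t * v <= expR (t ^+ 2 / 2).
  rewrite -gamma1_exp -[X in X + _](prob_Rintegral_cst gamma1 1).
  rewrite -RintegralZl// -RintegralD//; last 2 first.
  - exact: prob_integrable_cst.
  - exact: prob_integrableZ.
  apply: le_Rintegral => //; last by move=> x _; exact: expR_ge1Dx.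
  + apply: (prob_integrableD (prob_integrable_cst _ _)).
    exact: prob_integrableZ.
  + exact: integrable_gamma1_exp.
have h' t : t ^+ 2 <= 1 -> t * v <= t ^+ 2.
  move=> t1; have := h t; have := expRV_sub1 (_ : 0 <= t ^+ 2 / 2).
  have t0 := sqr_ge0 t; have := expR_gt0 (t ^+ 2 / 2).
  by set e := expR _ => e0 /(_ ltac:(lra)) => h1 h2; nra.
have w0 : 0 < 2 * (1 + v ^+ 2) by have := sqr_ge0 v; lra.
(* With t = s v the inequality t v <= t^2 reads s v^2 <= s^2 v^2, which forces v = 0 when 0 < s < 1;
   this s is also small enough to ensure t^2 <= 1. *)
pose s := (2 * (1 + v ^+ 2))^-1.
have s0 : 0 < s by rewrite invr_gt0.
have s1 : s * (2 * (1 + v ^+ 2)) = 1 by rewrite mulVf// gt_eqF.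
have s2 : s <= 2^-1 by have := sqr_ge0 v; nra.
have sv : (s * v) ^+ 2 <= 1.
  have : s * (s * v ^+ 2) <= s * 1 by rewrite ler_wpM2l ?ltW//; lra.
  by rewrite exprMn; lra.
have := h' _ sv => h3.
have : s * v ^+ 2 * (1 - s) <= 0 by lra.
rewrite pmulr_lle0; last by lra.
by rewrite pmulr_rle0// => v2; apply/eqP; rewrite -sqrf_eq0 eq_le v2 sqr_ge0.
Qed.

(* Both bounds on cosh come from 1 - a <= e^(-a). *)
Lemma expR_cosh_ge x : x ^+ 2 - `|x| ^+ 3 <= expR x + expR (- x) - 2.
Proof.
wlog x0 : x / 0 <= x.
  move=> H; have [/H//|x0] := leP 0 x.
  have := H (- x); rewrite oppr_ge0 (ltW x0) normrN sqrrN opprK => /(_ isT).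
  by lra.
rewrite ger0_norm//.
have e1 := expRxMexpNx_1 (x / 2).
have e2 : expR x = expR (x / 2) ^+ 2 by rewrite expr2 -expRD; congr expR; lra.
have e3 : expR (- x) = expR (- (x / 2)) ^+ 2.
  by rewrite expr2 -expRD; congr expR; lra.
have e4 : expR (- x) * expR (x / 2) = expR (- (x / 2)).
  by rewrite -expRD; congr expR; lra.
have l1 := expR_ge1Dx x; have l2 := expR_ge1Dx (- x).
have p1 := expR_gt0 (- (x / 2)).
have p2 := expR_gt0 (- x).
have l3 : x * expR (- (x / 2)) <= expR (x / 2) - expR (- (x / 2)).
  have : expR (- (x / 2)) * (1 + x) <= expR (- (x / 2)) * expR x.
    by rewrite ler_wpM2l// ltW.
  have -> : expR (- (x / 2)) * expR x = expR (x / 2).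
    by rewrite -expRD; congr expR; lra.
  by lra.
have -> : expR x + expR (- x) - 2 = (expR (x / 2) - expR (- (x / 2))) ^+ 2.
  by rewrite e2 e3 sqrrB e1; lra.
apply: (@le_trans _ _ ((x * expR (- (x / 2))) ^+ 2)); last first.
  by rewrite ler_pXn2r ?nnegrE// ?mulr_ge0 ?(ltW p1)//; apply: le_trans l3; rewrite mulr_ge0 ?(ltW p1).
rewrite exprMn -e3.
have : x ^+ 2 * (1 - x) <= x ^+ 2 * expR (- x) by rewrite ler_wpM2l ?sqr_ge0.
by rewrite mulrBr mulr1 -exprSr.
Qed.

Lemma expR_cosh_le x :
  expR x + expR (- x) - 2 <= x ^+ 2 + `|x| ^+ 3 * expR `|x|.
Proof.
wlog x0 : x / 0 <= x.
  move=> H; have [/H//|x0] := leP 0 x.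
  have := H (- x); rewrite oppr_ge0 (ltW x0) normrN sqrrN opprK => /(_ isT).
  by lra.
rewrite ger0_norm//.
have e1 := expRxMexpNx_1 (x / 2).
have e2 : expR x = expR (x / 2) ^+ 2 by rewrite expr2 -expRD; congr expR; lra.
have e3 : expR (- x) = expR (- (x / 2)) ^+ 2.
  by rewrite expr2 -expRD; congr expR; lra.
have p1 := expR_gt0 (x / 2).
have l3 : expR (x / 2) - expR (- (x / 2)) <= x * expR (x / 2).
  have : expR (x / 2) * (1 - x) <= expR (x / 2) * expR (- x).
    by rewrite ler_wpM2l ?(ltW p1)// expR_ge1Dx.
  have -> : expR (x / 2) * expR (- x) = expR (- (x / 2)).
    by rewrite -expRD; congr expR; lra.
  by lra.
have -> : expR x + expR (- x) - 2 = (expR (x / 2) - expR (- (x / 2))) ^+ 2.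
  by rewrite e2 e3 sqrrB e1; lra.
have l4 : 0 <= expR (x / 2) - expR (- (x / 2)).
  by rewrite subr_ge0 ler_expR; lra.
apply: (@le_trans _ _ ((x * expR (x / 2)) ^+ 2)).
  by rewrite ler_pXn2r ?nnegrE// mulr_ge0// ltW.
rewrite exprMn -e2.
have : x ^+ 2 * expR x <= x ^+ 2 * (1 + x * expR x).
  by rewrite ler_wpM2l ?sqr_ge0// expRV_sub1.
by rewrite mulrDr mulr1 mulrA -exprSr.
Qed.

(** The mean of e^(tX) + e^(-tX) - 2 equals 2 e^(t^2/2) - 2, that is t^2 up to O(t^4); the two cosh
    bounds show that it is t^2 v up to O(t^3). Dividing by t^2 and letting t tend to 0 gives v =
    1. *)
Lemma gamma1_var : \int[gamma1]_x ((x : R) ^+ 2) = 1.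
Proof.
set v := LHS.
have ix2 : gamma1.-integrable setT (EFin \o (fun x : R => x ^+ 2)).
  apply: (@gamma1_integrable_poly _ 1 2) => // x.
  rewrite mul1r normrX ler_pXn2r ?nnegrE ?addr_ge0//; lra.
have ix3 : gamma1.-integrable setT (EFin \o (fun x : R => `|x| ^+ 3)).
  apply: (@gamma1_integrable_poly _ 1 3).
    by apply: measurable_funX; exact: measurable_normR.
  move=> x; rewrite mul1r normrX normr_id ler_pXn2r ?nnegrE ?addr_ge0//; lra.
have ix3e : gamma1.-integrable setT
    (EFin \o (fun x : R => `|x| ^+ 3 * expR `|x|)).
  apply: (@gamma1_integrable_le _ 1 3).
    apply: measurable_funM; first by apply: measurable_funX; exact: measurable_normR.
    by apply: measurableT_comp => //; exact: measurable_normR.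
  move=> x; rewrite mul1r normrM normrX normr_id (ger0_norm (expR_ge0 _)).
  by rewrite ler_wpM2r ?expR_ge0// ler_pXn2r ?nnegrE ?addr_ge0//; lra.
pose C3 := \int[gamma1]_x (`|x : R| ^+ 3).
pose C := \int[gamma1]_x (`|x : R| ^+ 3 * expR `|x : R|).
have C30 : 0 <= C3 by apply: Rintegral_ge0 => x _; rewrite exprn_ge0.
have C0 : 0 <= C.
  by apply: Rintegral_ge0 => x _; rewrite mulr_ge0 ?expR_ge0 ?exprn_ge0.
have icosh t : gamma1.-integrable setT
    (EFin \o (fun x : R => expR (t * x) + expR (- t * x) + - 2)).
  apply: prob_integrableD; last exact: prob_integrable_cst.
  by apply: prob_integrableD; exact: integrable_gamma1_exp.
have cosh t : \int[gamma1]_x (expR (t * x) + expR (- t * x) + - 2) =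
    2 * expR (t ^+ 2 / 2) - 2.
  rewrite RintegralD//; last 2 first.
  - by apply: prob_integrableD; exact: integrable_gamma1_exp.
  - exact: prob_integrable_cst.
  rewrite prob_Rintegral_cst RintegralD//; last 2 first.
  - exact: integrable_gamma1_exp.
  - exact: integrable_gamma1_exp.
  by rewrite !gamma1_exp sqrrN; lra.
have lo t : 0 < t -> t <= 1 -> v - t * C3 <= 1 + t.
  move=> t0 t1.
  have : t ^+ 2 * v + - t ^+ 3 * C3 <= 2 * expR (t ^+ 2 / 2) - 2.
    rewrite -cosh -!RintegralZl// -RintegralD//; last 2 first.
    - exact: prob_integrableZ.
    - exact: prob_integrableZ.
    apply: le_Rintegral => //; first by apply: prob_integrableD; exact: prob_integrableZ.
    move=> x _; have := expR_cosh_ge (t * x).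
    by rewrite normrM (gtr0_norm t0) !exprMn [- t * x]mulNr; lra.
  have := expRV_sub1 (_ : 0 <= t ^+ 2 / 2).
  have t20 : 0 < t ^+ 2 by rewrite exprn_gt0.
  have tt : t ^+ 2 <= t by rewrite expr2; nra.
  have := expR_gt0 (t ^+ 2 / 2).
  set e := expR _ => e0 /(_ ltac:(lra)) => h1 h2.
  have e2 : e <= 2.
    have : t ^+ 2 / 2 * e <= 2^-1 * e by rewrite ler_wpM2r ?(ltW e0)//; lra.
    lra.
  have e3 : e <= 1 + t ^+ 2 / 2 + t ^+ 2 / 2 * (t ^+ 2).
    have : t ^+ 2 / 2 * e <= t ^+ 2 / 2 * (1 + t ^+ 2 / 2 * 2).
      rewrite ler_wpM2l//; first lra.
      have : t ^+ 2 / 2 * e <= t ^+ 2 / 2 * 2 by rewrite ler_wpM2l//; lra.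
      lra.
    lra.
  have : t ^+ 2 * (v - t * C3) <= t ^+ 2 * (1 + t).
    have -> : t ^+ 2 * (v - t * C3) = t ^+ 2 * v + - t ^+ 3 * C3 by ring.
    have : t ^+ 2 * t ^+ 2 <= t ^+ 2 * t by rewrite ler_wpM2l// ltW.
    lra.
  by rewrite ler_pM2l.
have hi t : 0 < t -> t <= 1 -> 1 <= v + t * C.
  move=> t0 t1.
  have : 2 * expR (t ^+ 2 / 2) - 2 <= t ^+ 2 * v + t ^+ 3 * C.
    rewrite -cosh -!RintegralZl// -RintegralD//; last 2 first.
    - exact: prob_integrableZ.
    - exact: prob_integrableZ.
    apply: le_Rintegral => //; first by apply: prob_integrableD; exact: prob_integrableZ.
    move=> x _; have := expR_cosh_le (t * x).
    rewrite normrM (gtr0_norm t0) !exprMn [- t * x]mulNr => h; apply: (le_trans h).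
    rewrite lerD2l -mulrA ler_wpM2l ?exprn_ge0 ?(ltW t0)//.
    by rewrite ler_wpM2l ?exprn_ge0// ler_expR ler_piMl.
  have t20 : 0 < t ^+ 2 by rewrite exprn_gt0.
  have := expR_ge1Dx (t ^+ 2 / 2) => h1 h2.
  have : t ^+ 2 * 1 <= t ^+ 2 * (v + t * C).
    have -> : t ^+ 2 * (v + t * C) = t ^+ 2 * v + t ^+ 3 * C by ring.
    lra.
  by rewrite ler_pM2l.
apply/eqP; rewrite eq_le; apply/andP; split.
- apply/ler_addgt0Pl => e e0.
  pose t := Num.min 1 (e / (1 + C3)).
  have p0 : 0 < 1 + C3 by lra.
  have t0 : 0 < t by rewrite lt_min ltr01 divr_gt0.
  have t1 : t <= 1 by rewrite ge_min lexx.
  have te : t * (1 + C3) <= e.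
    by rewrite -ler_pdivlMr// ge_min lexx orbT.
  by have := lo t t0 t1; lra.
- apply/ler_addgt0Pl => e e0.
  pose t := Num.min 1 (e / (1 + C)).
  have p0 : 0 < 1 + C by lra.
  have t0 : 0 < t by rewrite lt_min ltr01 divr_gt0.
  have t1 : t <= 1 by rewrite ge_min lexx.
  have te : t * (1 + C) <= e.
    by rewrite -ler_pdivlMr// ge_min lexx orbT.
  by have := hi t t0 t1; lra.
Qed.

(** Chernoff bound with parameter r: beyond r one has e^(r^2) <= e^(r x), and the mean of the
    right-hand side is e^(r^2/2). *)
Lemma Phibar_tail r : 0 <= r -> Phibar r <= expR (- (r ^+ 2 / 2)).
Proof.
move=> r0.
have : expR (r ^+ 2) * Phibar r <= expR (r ^+ 2 / 2).
  rewrite -lee_fin EFinM (PhibarE r) -(mgf_gamma1 r).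
  have mI : measurable (`]r, +oo[%classic : set R) by [].
  rewrite -(setIT `]r, +oo[%classic) -integral_indic//.
  rewrite -ge0_integralZl//; last exact/measurable_EFinP/measurable_indic.
  apply: ge0_le_integral => //.
  - by apply: emeasurable_funM => //; exact/measurable_EFinP/measurable_indic.
  - exact: (measurable_int _ (integrable_gamma1_exp r)).
  - move=> x _; rewrite -EFinM lee_fin indicE.
    case: (boolP (x \in _)); rewrite ?mulr0 ?expR_ge0// mulr1.
    by rewrite inE /= in_itv /= andbT => rx; rewrite ler_expR expr2; nra.
have -> : expR (r ^+ 2 / 2) = expR (r ^+ 2) * expR (- (r ^+ 2 / 2)).
  by rewrite -expRD; congr expR; lra.
by rewrite ler_pM2l ?expR_gt0.
Qed.

Lemma gamma1_tail r : 0 <= r ->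
  fine (gamma1 [set x : R | r < `|x|]) <= 2 * expR (- (r ^+ 2 / 2)).
Proof.
move=> r0.
have h := Phibar_tail r0.
have mI (a : R) : measurable (`]a, +oo[%classic : set R) by [].
apply: (@le_trans _ _ (fine (gamma1 (`]r, +oo[%classic `|` ~` `]- r, +oo[%classic)))).
  apply: prob_fine_le.
  - rewrite (_ : [set x | _] = (fun x : R => `|x|) @^-1` `]r, +oo[%classic); last first.
      by apply/seteqP; split => x /=; rewrite in_itv/= andbT.
    by rewrite -[X in measurable X]setTI; exact: measurable_normR.
  - by apply: measurableU => //; exact: measurableC.
  - move=> x /=; rewrite !in_itv/= !andbT => rx.
    have [x0|x0] := leP 0 x; first by left; rewrite -(ger0_norm x0).
    by right; apply/negP; rewrite -leNgt; rewrite ltr0_norm// in rx; lra.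
apply: (le_trans (prob_fine_setU _ _ _)) => //; first exact: measurableC.
have gE a : fine (gamma1 `]a, +oo[%classic) = Phibar a by rewrite -PhibarE.
by rewrite prob_fine_setC// !gE PhibarN; lra.
Qed.

End gamma1_moments.

(** * The inverse of the tail function *)

Section Phibar_inverse.
Context {R : realType}.
Implicit Types x y p : R.

Lemma Phibar_gt0 x : 0 < Phibar x.
Proof.
apply: (@le_lt_trans _ _ (Phibar (x + 1))); last by apply: Phibar_lt; lra.
by apply: fine_ge0; exact: measure_ge0.
Qed.

Lemma Phibar_lt1 x : Phibar x < 1.
Proof. by have := Phibar_gt0 (- x); rewrite PhibarN subr_gt0. Qed.

Lemma Phibar_le x y : (Phibar x <= Phibar y) = (y <= x).
Proof.
have [yx|xy] := leP y x; first by apply/idP; exact: Phibar_anti.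
by apply/negbTE; rewrite -ltNge; exact: Phibar_lt.
Qed.

Lemma Phibar_inj : injective (@Phibar R).
Proof. by move=> x y e; apply/eqP; rewrite eq_le -(Phibar_le y x) -(Phibar_le x y) e lexx. Qed.

Lemma continuous_Phibar : continuous (@Phibar R).
Proof.
move=> x; apply/cvgrPdist_le => e e0; near=> y.
apply: (le_trans (Phibar_lip _ _)); near: y.
by move: e e0; apply/cvgrPdist_le; exact: cvg_id.
Unshelve. all: by end_near. Qed.

Lemma measurable_Phibar : measurable_fun setT (@Phibar R).
Proof. exact: continuous_measurable_fun continuous_Phibar. Qed.

(** The tail bound at 2/p is e^(-2/p^2), and e^(2/p^2) >= 1 + 2/p^2 > 1/p. This gives an explicit
    point whenever a small tail is needed. *)
Lemma Phibar_small p : 0 < p -> Phibar (2 / p) < p.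
Proof.
move=> p0; apply: (le_lt_trans (Phibar_tail _)); first by rewrite divr_ge0 ?(ltW p0).
set u := (2 / p) ^+ 2 / 2; rewrite expRN invf_plt ?posrE ?expR_gt0//.
apply: lt_le_trans (expR_ge1Dx u).
have q0 : 0 < p^-1 by rewrite invr_gt0.
have -> : u = 2 * p^-1 ^+ 2 by rewrite /u exprMn; lra.
by move: (p^-1) q0 => q q0; have := sqr_ge0 (q - 1); rewrite sqrrB expr1n mulr1; nra.
Qed.

Lemma Phibar_onto p : 0 < p < 1 -> exists x, Phibar x = p.
Proof.
move=> /andP[p0 p1].
pose r := Num.max (2 / p) (2 / (1 - p)).
have r0 : 0 < r by rewrite lt_max divr_gt0.
have q0 : 0 < 1 - p by lra.
have h1 : Phibar r <= p.
  apply: le_trans (ltW (Phibar_small p0)).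
  by rewrite Phibar_le le_max lexx.
have h2 : p <= Phibar (- r).
  have : Phibar r <= 1 - p.
    apply: le_trans (ltW (Phibar_small q0)).
    by rewrite Phibar_le le_max lexx orbT.
  by rewrite PhibarN; lra.
have [|||x _ xp] := @IVT R Phibar (- r) r p; first lra.
- by apply: continuous_subspaceT; exact: continuous_Phibar.
- by rewrite ge_min le_max h1 h2 orbT.
- by exists x.
Qed.

Lemma Phibar_invK x : Phibar_inv (Phibar x) = x.
Proof.
apply: Phibar_inj; rewrite /Phibar_inv.
by apply: (@xgetPex _ 0 [set y | Phibar y = Phibar x]); exists x.
Qed.

Lemma Phibar_invE p : 0 < p < 1 -> Phibar (Phibar_inv p) = p.
Proof. by move=> /Phibar_onto[x <-]; rewrite Phibar_invK. Qed.

Lemma Phibar_inv_out p : ~~ (0 < p < 1) -> Phibar_inv p = 0.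
Proof.
move=> np; apply: xgetPN => x xp; move: np; rewrite -xp.
by rewrite Phibar_gt0 Phibar_lt1.
Qed.

(** No range is imposed on p: outside the open unit interval both inverses take the default value 0,
    its own opposite. *)
Lemma Phibar_invN p : Phibar_inv (1 - p) = - Phibar_inv p.
Proof.
have [p01|p01] := boolP (0 < p < 1).
  have [x xp] := Phibar_onto p01.
  by rewrite -xp -PhibarN !Phibar_invK.
rewrite !Phibar_inv_out ?oppr0//.
by apply: contra p01 => /andP[? ?]; apply/andP; split; lra.
Qed.

Lemma measurable_Phibar_inv : measurable_fun setT (@Phibar_inv R).
Proof.
apply: (measurability (@RGenOInfty.G R)) => [|/= _ [_] [x ->] <-].
  exact: RGenOInfty.measurableE.
rewrite setTI.
(* On the open unit interval the inverse is decreasing, which gives the first interval; elsewhere it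
   is 0, so the complement belongs to the preimage exactly when x < 0. *)
have -> : Phibar_inv @^-1` `]x, +oo[ =
   `]0, Phibar x[%classic `|` (if 0 > x then `]-oo, 0]%classic `|` `[1, +oo[%classic else set0).
  apply/seteqP; split => p /=; rewrite !in_itv/= andbT.
    have [p01|p01] := boolP (0 < p < 1).
      have [y <-] := Phibar_onto p01.
      rewrite Phibar_invK => xy; left.
      by rewrite Phibar_gt0/= Phibar_lt.
    rewrite Phibar_inv_out// => x0; right; rewrite x0 /= !in_itv/= andbT.
    by move: p01; rewrite negb_and -!leNgt => /orP.
  case=> [/andP[p0 px]|].
    have p1 := lt_trans px (Phibar_lt1 x).
    have p01 : 0 < p < 1 by rewrite p0.
    move: px; have [y <-] := Phibar_onto p01; rewrite Phibar_invK.
    by rewrite !ltNge Phibar_le.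
  case: ifPn => //= x0; rewrite !in_itv/= andbT => pout.
  rewrite Phibar_inv_out//; apply/negP => /andP[].
  by case: pout => *; lra.
by apply: measurableU => //; case: ifPn => // _; exact: measurableU.
Qed.

(* The derivative of Phibar_inv is bounded away from the ends of the unit
   interval. *)
Lemma Phibar_inv_lip (B : R) : exists C e : R, [/\ 0 < C, 0 < e &
  forall x p, `|x| <= B -> `|p - Phibar x| <= e ->
    `|Phibar_inv p - x| <= C * `|p - Phibar x|].
Proof.
pose b := phi (`|B| + 1).
have b0 : 0 < b by exact: phi_gt0.
have bphi z : `|z| <= `|B| + 1 -> b <= phi z.
  move=> zB; rewrite /b !phiE ler_pM2l ?normal_peak_gt0 ?oner_neq0// ler_expR.
  have : z ^+ 2 <= (`|B| + 1) ^+ 2.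
    by rewrite -(real_normK (num_real z)) ler_pXn2r ?nnegrE// addr_ge0.
  by lra.
(* A deviation q <= b in probability is covered by a displacement q / b <= 1 of the argument, which
   does not leave the range where the density is at least b. *)
exists b^-1, b; split; rewrite ?invr_gt0//.
move=> x p xB; set q := `|_| => pq.
have BB := ler_norm B.
have lo : q / b <= 1 by rewrite ler_pdivrMr// mul1r.
have q0 : 0 <= q / b by rewrite divr_ge0 ?(ltW b0)// /q normr_ge0.
have h1 : q <= Phibar (x - q / b) - Phibar x.
  have := @Phibar_diff_ge R b (x - q / b) x.
  have -> : b * (x - (x - q / b)) = q by field; rewrite gt_eqF.
  apply; [lra|exact: ltW|move=> z zx; apply: bphi].
  by move: xB; rewrite !ler_norml; lra.
have h2 : q <= Phibar x - Phibar (x + q / b).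
  have := @Phibar_diff_ge R b x (x + q / b).
  have -> : b * (x + q / b - x) = q by field; rewrite gt_eqF.
  apply; [lra|exact: ltW|move=> z zx; apply: bphi].
  by move: xB; rewrite !ler_norml; lra.
have : - q <= p - Phibar x <= q by rewrite -ler_norml.
move=> h3.
have p0 : Phibar (x + q / b) <= p by lra.
have p1 : p <= Phibar (x - q / b) by lra.
have p01 : 0 < p < 1.
  by rewrite (lt_le_trans (Phibar_gt0 _) p0) (le_lt_trans p1 (Phibar_lt1 _)).
move: p0 p1; have [y <-] := Phibar_onto p01; rewrite Phibar_invK !Phibar_le.
by rewrite [_^-1 * _]mulrC ler_norml; lra.
Qed.

End Phibar_inverse.

(** * Standard normal vectors *)

Section row_vectors.
Context {R : realType}.

Lemma row_normP m (u : 'rV[R]_m) (B : R) : 0 <= B ->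
  `|u| <= B <-> forall i, `|u 0 i| <= B.
Proof.
move=> B0; rewrite [`|u|]mx_normrE; split.
  by move=> /bigmax_leP[_ h] i; exact: (h (0, i)).
by move=> h; apply: bigmax_le => // -[i j] _ /=; rewrite (ord1 i).
Qed.

Lemma row_coord_le m (u : 'rV[R]_m) i : `|u 0 i| <= `|u|.
Proof. by have /row_normP := lexx `|u|; apply. Qed.

(** The first alternative accounts for m = 0, where there is no coordinate to exhibit. *)
Lemma row_norm_witness m (u : 'rV[R]_m) :
  `|u| = 0 \/ exists i, `|u| = `|u 0 i|.
Proof.
have [u0|/mx_norm_neq0[[i j] /= h]] := eqVneq (mx_norm u) 0; first by left.
by right; exists j; rewrite [LHS]h (ord1 i).
Qed.

Lemma measurable_forall d (T : measurableType d) m (A : 'I_m -> set T) :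
  (forall i, measurable (A i)) -> measurable [set x | forall i, A i x].
Proof.
move=> mA; rewrite (_ : [set x | _] = \bigcap_(i in [set: 'I_m]) A i).
  by apply: fin_bigcap_measurable => //; exact: finite_finset.
by apply/seteqP; split => [x h i _|x h i]; exact: h.
Qed.

(* f is the pointwise limit of its compositions with the roundings of the
   coordinates to multiples of 1/(k+1), which have countable range. *)
Lemma continuous_measurable_rV m (f : 'rV[R]_m -> R) :
  continuous f -> measurable_fun setT f.
Proof.
move=> cf.
pose F (k : nat) (u : 'rV[R]_m) : 'rV[R]_m :=
  \row_i ((Num.floor (k.+1%:R * u 0 i))%:~R / k.+1%:R).
have FE k u : `|F k u - u| <= k.+1%:R^-1.
  apply/row_normP => // i; rewrite !mxE.
  have k0 : 0 < k.+1%:R :> R by rewrite ltr0n.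
  have -> : (Num.floor (k.+1%:R * u 0 i))%:~R / k.+1%:R - u 0 i =
     ((Num.floor (k.+1%:R * u 0 i))%:~R - k.+1%:R * u 0 i) / k.+1%:R.
    by field; rewrite gt_eqF.
  rewrite normrM [X in _ * X]ger0_norm ?invr_ge0 ?(ltW k0)//.
  rewrite ler_piMl ?invr_ge0 ?(ltW k0)//.
  have := floor_le (k.+1%:R * u 0 i); have := floorD1_gt (k.+1%:R * u 0 i).
  by rewrite ler_norml intrD; lra.
apply: (@measurable_fun_cvg _ _ _ _ (fun k => f \o F k)) => [k|u _].
- move=> _ B mB; rewrite setTI.
  pose G (a : 'rV[int]_m) := [set u : 'rV[R]_m |
     forall i, [set u : 'rV[R]_m | Num.floor (k.+1%:R * u 0 i) == a 0 i] u].
  pose cand (a : 'rV[int]_m) : 'rV[R]_m := \row_i ((a 0 i)%:~R / k.+1%:R).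
  have -> : (f \o F k) @^-1` B =
    \bigcup_(a : 'rV[int]_m) (if f (cand a) \in B then G a else set0).
    apply/seteqP; split => u /=.
      move=> Bu; exists (\row_i Num.floor (k.+1%:R * u 0 i)) => //.
      have -> : cand (\row_i Num.floor (k.+1%:R * u 0 i)) = F k u.
        by apply/rowP => i; rewrite !mxE.
      by rewrite mem_set// => i /=; rewrite mxE.
    case=> a _; case: ifPn => //; rewrite inE => Bc Ga.
    have -> : F k u = cand a by apply/rowP => i; rewrite !mxE; have /eqP -> := Ga i.
    by [].
  apply: countable_bigcupT_measurable => [|a]; first exact: countableP.
  case: ifPn => // _; apply: measurable_forall => i.
  rewrite (_ : [set u | _] = (fun u : 'rV[R]_m => u 0 i) @^-1`
      `[(a 0 i)%:~R / k.+1%:R, ((a 0 i)%:~R + 1) / k.+1%:R[%classic); last first.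
    have k0 : 0 < k.+1%:R :> R by rewrite ltr0n.
    apply/seteqP; split => u /=; rewrite in_itv /= floor_eq;
    by rewrite ler_pdivrMr// ltr_pdivlMr// intrD [u 0 i * _]mulrC.
  by rewrite -[X in measurable X]setTI; exact: measurable_rV_coord.
- apply: (@cvg_comp _ _ _ (F ^~ u) f _ (nbhs u)); last exact: cf.
  apply/cvgrPdist_le => e e0; near=> k.
  rewrite distrC; apply: (le_trans (FE k u)).
  apply: ltW; near: k; exact: (near_infty_natSinv_lt (PosNum e0)).
Unshelve. all: by end_near. Qed.

Lemma measurable_rV_norm m : measurable_fun setT (fun u : 'rV[R]_m => `|u|).
Proof. by apply: continuous_measurable_rV => u; exact: norm_continuous. Qed.

End row_vectors.

Lemma prob_integral_cst d (T : measurableType d) {R : realType}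
  (P : probability T R) (c : \bar R) : (\int[P]_x c = c)%E.
Proof.
by rewrite -[RHS]mule1 -(@probability_setT _ _ _ P) -integral_cst.
Qed.

Section std_normal_structure.
Context {R : realType}.

Lemma rV_cons0 k (z : R * 'rV[R]_k) : rV_cons z 0 ord0 = z.1.
Proof.
have -> : ord0 = lshift k (ord0 : 'I_1) :> 'I_(1 + k) by exact: val_inj.
by apply: etrans (row_mxEl _ _ _ _) _; rewrite mxE.
Qed.

Lemma rV_consS k (z : R * 'rV[R]_k) j : rV_cons z 0 (lift ord0 j) = z.2 0 j.
Proof.
have -> : lift ord0 j = rshift 1 j :> 'I_(1 + k) by exact: val_inj.
exact: row_mxEr.
Qed.

Lemma ge0_integral_std_normalS k (f : 'rV[R]_k.+1 -> \bar R) :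
  measurable_fun setT f -> (forall x, 0 <= f x)%E ->
  (\int[std_normal k.+1]_z f z =
   \int[gamma1]_x \int[std_normal k]_u f (rV_cons (x, u)))%E.
Proof.
move=> mf f0; rewrite /= /distribution.
rewrite (@ge0_integral_pushforward _ _ _ _ _ (@rV_cons R k))//.
rewrite preimage_setT fubini_tonelli1//.
- by apply: measurableT_comp => //; exact: measurable_rV_cons.
- by move=> x; exact: f0.
Qed.

Lemma integral_std_normalS k (f : 'rV[R]_k.+1 -> R) :
  (std_normal k.+1).-integrable setT (EFin \o f) ->
  (\int[std_normal k.+1]_z (f z)%:E =
   \int[gamma1]_x \int[std_normal k]_u (f (rV_cons (x, u)))%:E)%E.
Proof.
move=> fi; have mf := measurable_int _ fi.
have mcons := @measurable_rV_cons R k.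
have fi' : (std_normal1 \x std_normal k)%E.-integrable setT
    ((EFin \o f) \o @rV_cons R k).
  move/integrableP : fi => [_ fi]; apply/integrableP; split.
    exact: measurableT_comp.
  move: fi; rewrite /= /distribution.
  rewrite (@ge0_integral_pushforward _ _ _ _ _ (@rV_cons R k))//.
  move/measurable_EFinP : mf => mf; apply/measurable_EFinP.
  exact: (measurableT_comp measurable_normR mf).
rewrite /= /distribution.
rewrite (@integral_pushforward _ _ _ _ _ (@rV_cons R k))//.
by rewrite preimage_setT -integral12_prod_meas1.
Qed.

Lemma ge0_integral_std_normal_coord m (i : 'I_m) (f : R -> \bar R) :
  measurable_fun setT f -> (forall x, 0 <= f x)%E ->
  (\int[std_normal m]_z f (z 0%R i) = \int[gamma1]_x f x)%E.
Proof.
move=> mf f0; elim: m i => [[]//|m IH] i.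
rewrite ge0_integral_std_normalS//; last first.
  by apply: measurableT_comp => //; exact: measurable_rV_coord.
case: (unliftP ord0 i) => [j|] ->.
  under eq_integral do under eq_integral do rewrite rV_consS.
  under eq_integral do rewrite IH.
  exact: prob_integral_cst.
apply: eq_integral => x _; under eq_integral do rewrite rV_cons0.
exact: (prob_integral_cst (std_normal m) (f x)).
Qed.

(** The sup norm is attained at a coordinate, so the polynomial is at most 1 plus the sum of the
    same polynomials in the single coordinates, each of them a one-dimensional integral; the 1
    covers a vector of norm 0. *)
Lemma std_normal_integrable_poly m (f : 'rV[R]_m -> R) (C : R) (q : nat) :
  measurable_fun setT f -> (forall z, `|f z| <= C * (1 + `|z|) ^+ q) ->
  (std_normal m).-integrable setT (EFin \o f).
Proof.
move=> mf fC.
have ig i : (std_normal m).-integrable setT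
    (EFin \o (fun z : 'rV[R]_m => (1 + `|z 0 i|) ^+ q)).
  have mg : measurable_fun setT (fun x : R => (1 + `|x|) ^+ q).
    by apply: measurable_funX; apply: measurable_funD.
  apply/integrableP; split.
    apply/measurable_EFinP.
    apply: (@measurableT_comp _ _ _ _ _ _ (fun x : R => (1 + `|x|) ^+ q)) => //.
    exact: measurable_rV_coord.
  under eq_integral do
    rewrite /= ger0_norm ?exprn_ge0 ?addr_ge0//.
  rewrite (ge0_integral_std_normal_coord i
    (f := fun x => ((1 + `|x|) ^+ q)%:E)); last 2 first.
  - exact/measurable_EFinP.
  - by move=> x; rewrite lee_fin exprn_ge0 ?addr_ge0.
  have : gamma1.-integrable setT (EFin \o (fun x : R => (1 + `|x|) ^+ q)).
    apply: (@gamma1_integrable_poly _ _ 1 q) => // x.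
    by rewrite mul1r ger0_norm ?exprn_ge0 ?addr_ge0.
  move=> /integrableP[_]; apply: le_lt_trans.
  apply: ge0_le_integral => //.
  - exact/measurable_EFinP.
  - by apply: measurableT_comp => //; exact/measurable_EFinP.
  - by move=> x _ /=; rewrite lee_fin ler_norm.
have /(prob_integrableZ `|C|) :=
  prob_integrableD (prob_integrable_cst (std_normal m) 1)
    (prob_integrable_sum (index_enum 'I_m) ig).
move/prob_integrable_le; apply => // z; apply: (le_trans (fC z)).
apply: (@le_trans _ _ (`|C| * (1 + `|z|) ^+ q)).
  by rewrite ler_wpM2r ?ler_norm// exprn_ge0 ?addr_ge0.
rewrite ler_wpM2l//.
have s0 : 0 <= \sum_(i < m) (1 + `|z 0 i|) ^+ q.
  by apply: sumr_ge0 => i _; rewrite exprn_ge0 ?addr_ge0.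
have [->|[i ->]] := row_norm_witness z; first by rewrite addr0 expr1n; lra.
rewrite (bigD1 i)//=.
have : 0 <= \sum_(j < m | j != i) (1 + `|z 0 j|) ^+ q.
  by apply: sumr_ge0 => j _; rewrite exprn_ge0 ?addr_ge0.
by lra.
Qed.

End std_normal_structure.

Section std_normal_moments.
Context {R : realType}.

Lemma prob_RintegralE d (T : measurableType d) (P : probability T R)
    (f : T -> R) : P.-integrable setT (EFin \o f) ->
  (\int[P]_x (f x)%:E = (\int[P]_x f x)%:E)%E.
Proof. by move=> fi; rewrite /Rintegral fineK// integrable_fin_num. Qed.

Lemma integrable_coord m (i : 'I_m) :
  (std_normal m).-integrable setT (EFin \o (fun z : 'rV[R]_m => z 0 i)).
Proof.
apply: (@std_normal_integrable_poly _ _ _ 1 1); first exact: measurable_rV_coord.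
by move=> z; rewrite expr1 mul1r; have := row_coord_le z i; lra.
Qed.

Lemma integrable_coord2 m (i j : 'I_m) : (std_normal m).-integrable setT
  (EFin \o (fun z : 'rV[R]_m => z 0 i * z 0 j)).
Proof.
apply: (@std_normal_integrable_poly _ _ _ 1 2).
  by apply: measurable_funM; exact: measurable_rV_coord.
move=> z; rewrite mul1r normrM expr2.
have := row_coord_le z i; have := row_coord_le z j.
by move=> *; apply: ler_pM => //; lra.
Qed.

Lemma std_normal_mean m (i : 'I_m) :
  (\int[std_normal m]_z (z 0%R i)%:E = 0%:E :> \bar R)%E.
Proof.
have ix : gamma1.-integrable setT (EFin \o (fun x : R => x)).
  apply: (@gamma1_integrable_poly _ _ 1 1) => // x; rewrite expr1 mul1r; lra.
elim: m i => [[]//|m IH] i.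
rewrite (integral_std_normalS (integrable_coord i)).
case: (unliftP ord0 i) => [j|] ->.
  under eq_integral do under eq_integral do rewrite rV_consS.
  under eq_integral do rewrite IH.
  exact: (prob_integral_cst gamma1 0%E).
transitivity (\int[gamma1]_x (x : R)%:E)%E.
  apply: eq_integral => x _; under eq_integral do rewrite rV_cons0.
  exact: (prob_integral_cst (std_normal m) x%:E).
by rewrite prob_RintegralE// gamma1_mean.
Qed.

Lemma std_normal_cov m (i j : 'I_m) :
  (\int[std_normal m]_z (z 0%R i * z 0%R j)%:E = ((i == j)%:R)%:E :> \bar R)%E.
Proof.
have ix : gamma1.-integrable setT (EFin \o (fun x : R => x ^+ 2)).
  apply: (@gamma1_integrable_poly _ _ 1 2) => // x.
  by rewrite mul1r normrX ler_pXn2r ?nnegrE ?addr_ge0//; lra.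
elim: m i j => [[]//|m IH] i j.
rewrite (integral_std_normalS (integrable_coord2 i j)).
case: (unliftP ord0 i) => [i'|] ->; case: (unliftP ord0 j) => [j'|] ->.
- under eq_integral do under eq_integral do rewrite !rV_consS.
  under eq_integral do rewrite IH.
  rewrite (inj_eq lift_inj).
  exact: (prob_integral_cst gamma1).
- rewrite (_ : _ == _ = false); last by apply/negbTE; rewrite eq_sym neq_lift.
  transitivity (\int[gamma1]_(x in [set: R]) (0%:E : \bar R))%E; last first.
    exact: (prob_integral_cst gamma1).
  apply: eq_integral => x _.
  under eq_integral do rewrite rV_cons0 rV_consS mulrC EFinM.
  by rewrite integralZl ?std_normal_mean ?mule0//; exact: integrable_coord.
- rewrite (_ : _ == _ = false); last by apply/negbTE; rewrite neq_lift.
  transitivity (\int[gamma1]_(x in [set: R]) (0%:E : \bar R))%E; last first.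
    exact: (prob_integral_cst gamma1).
  apply: eq_integral => x _.
  under eq_integral do rewrite rV_cons0 rV_consS EFinM.
  by rewrite integralZl ?std_normal_mean ?mule0//; exact: integrable_coord.
- rewrite eqxx.
  transitivity (\int[gamma1]_x ((x : R) ^+ 2)%:E)%E.
    apply: eq_integral => x _; under eq_integral do rewrite !rV_cons0.
    exact: (prob_integral_cst (std_normal m) (x * x)%:E).
  by rewrite prob_RintegralE// gamma1_var.
Qed.

(* Q need not be symmetric. *)
Definition quad m (l : 'I_m -> R) (Q : 'I_m -> 'I_m -> R) (z : 'rV[R]_m) : R :=
  \sum_i l i * z 0 i + \sum_i \sum_j Q i j * (z 0 i * z 0 j).

Definition tr m (Q : 'I_m -> 'I_m -> R) : R := \sum_i Q i i.

Lemma measurable_quad m (l : 'I_m -> R) Q : measurable_fun setT (quad l Q).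
Proof.
apply: measurable_funD.
  apply: measurable_sum => i; apply: measurable_funM => //.
  exact: measurable_rV_coord.
apply: measurable_sum => i; apply: measurable_sum => j.
by apply: measurable_funM => //; apply: measurable_funM; exact: measurable_rV_coord.
Qed.

Lemma quad_le m (l : 'I_m -> R) Q r (z : 'rV[R]_m) :
  0 <= r -> (forall i, `|l i| <= r) -> (forall i j, `|Q i j| <= r) ->
  `|quad l Q z| <= r * (m%:R + m%:R ^+ 2) * (1 + `|z|) ^+ 2.
Proof.
move=> r0 hl hQ; rewrite mulrDr mulrDl.
have z1 : 1 <= (1 + `|z|) ^+ 2 by rewrite exprn_ege1// lerDl.
have sumc (c : R) : \sum_(i < m) c = c * m%:R.
  by rewrite sumr_const card_ord mulr_natr.
apply: (le_trans (ler_normD _ _)); apply: lerD.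
  apply: (le_trans (ler_norm_sum _ _ _)).
  apply: (@le_trans _ _ (\sum_(i < m) r * (1 + `|z|) ^+ 2)).
    apply: ler_sum => i _; rewrite normrM; apply: ler_pM => //.
    apply: (le_trans (row_coord_le z i)).
    by have := normr_ge0 z; rewrite expr2; nra.
  by rewrite sumc; lra.
apply: (le_trans (ler_norm_sum _ _ _)).
apply: (@le_trans _ _ (\sum_(i < m) \sum_(j < m) r * (1 + `|z|) ^+ 2)).
  apply: ler_sum => i _; apply: (le_trans (ler_norm_sum _ _ _)).
  apply: ler_sum => j _; rewrite !normrM; apply: ler_pM => //.
  rewrite expr2; have := row_coord_le z i; have := row_coord_le z j.
  by move=> *; apply: ler_pM => //; lra.
by rewrite !sumc expr2; lra.
Qed.

Lemma tr_le m Q r : 0 <= r -> (forall i j, `|Q i j| <= r) ->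
  `|@tr m Q| <= r * m%:R.
Proof.
move=> r0 hQ; apply: (le_trans (ler_norm_sum _ _ _)).
apply: (@le_trans _ _ (\sum_(i < m) r)); first exact: ler_sum.
by rewrite sumr_const card_ord mulr_natr.
Qed.

Lemma integrable_quad m (l : 'I_m -> R) Q :
  (std_normal m).-integrable setT (EFin \o quad l Q).
Proof.
apply: prob_integrableD.
  apply: prob_integrable_sum => i; apply: prob_integrableZ.
  exact: integrable_coord.
apply: prob_integrable_sum => i; apply: prob_integrable_sum => j.
by apply: prob_integrableZ; exact: integrable_coord2.
Qed.

Lemma Rintegral_quad m (l : 'I_m -> R) Q :
  \int[std_normal m]_z quad l Q z = tr Q.
Proof.
rewrite /quad RintegralD//; last 2 first.
- by apply: prob_integrable_sum => i; apply: prob_integrableZ; exact: integrable_coord.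
- apply: prob_integrable_sum => i; apply: prob_integrable_sum => j.
  by apply: prob_integrableZ; exact: integrable_coord2.
rewrite prob_Rintegral_sum; last first.
  by move=> i; apply: prob_integrableZ; exact: integrable_coord.
rewrite big1 ?add0r; last first.
  move=> i _; rewrite RintegralZl//; last exact: integrable_coord.
  by rewrite /Rintegral std_normal_mean mulr0.
rewrite prob_Rintegral_sum; last first.
  move=> i; apply: prob_integrable_sum => j.
  by apply: prob_integrableZ; exact: integrable_coord2.
apply: eq_bigr => i _; rewrite prob_Rintegral_sum; last first.
  by move=> j; apply: prob_integrableZ; exact: integrable_coord2.
rewrite (bigD1 i)//= big1 ?addr0.
  rewrite RintegralZl//; last exact: integrable_coord2.
  by rewrite /Rintegral std_normal_cov eqxx mulr1.
move=> j ji; rewrite RintegralZl//; last exact: integrable_coord2.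
by rewrite /Rintegral std_normal_cov eq_sym (negbTE ji) mulr0.
Qed.

Lemma integrable_poly m q : (std_normal m).-integrable setT
  (EFin \o (fun z : 'rV[R]_m => (1 + `|z|) ^+ q)).
Proof.
apply: (@std_normal_integrable_poly _ _ _ 1 q).
  apply: measurable_funX; apply: measurable_funD => //.
  exact: measurable_rV_norm.
by move=> z; rewrite mul1r ger0_norm// exprn_ge0 ?addr_ge0.
Qed.

Lemma integrable_Phibar m (G : 'rV[R]_m -> R) : measurable_fun setT G ->
  (std_normal m).-integrable setT (EFin \o (fun z => Phibar (G z))).
Proof.
move=> mG; apply: (@std_normal_integrable_poly _ _ _ 1 0).
  exact: measurableT_comp measurable_Phibar mG.
move=> z; rewrite mul1r expr0 ger0_norm; last exact: ltW (Phibar_gt0 _).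
exact: ltW (Phibar_lt1 _).
Qed.

Lemma Rintegral_dist_le m (f g h : 'rV[R]_m -> R) :
  (std_normal m).-integrable setT (EFin \o f) ->
  (std_normal m).-integrable setT (EFin \o g) ->
  (std_normal m).-integrable setT (EFin \o h) ->
  (forall z, `|f z - g z| <= h z) ->
  `|\int[std_normal m]_z f z - \int[std_normal m]_z g z| <=
    \int[std_normal m]_z h z.
Proof.
move=> fi gi hi H; rewrite ler_norml -RintegralB//.
have fgi : (std_normal m).-integrable setT (EFin \o (fun z => f z - g z)).
  by apply: eq_integrable (integrableB _ fi gi).
apply/andP; split.
  rewrite -mulN1r -RintegralZl//; apply: le_Rintegral => //.
    exact: prob_integrableZ.
  by move=> z _; have := H z; rewrite ler_norml mulN1r => /andP[].
by apply: le_Rintegral => // z _; have := H z; rewrite ler_norml => /andP[].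
Qed.

(* Phibar (x + quad z) is replaced by its second order expansion at
   x + tr Q = E (x + quad Z). *)
Lemma Rintegral_Phibar_quad m : exists C : R, 0 <= C /\
  forall (x r : R) (l : 'I_m -> R) Q,
  0 <= r -> (forall i, `|l i| <= r) -> (forall i j, `|Q i j| <= r) ->
  `|\int[std_normal m]_z Phibar (x + quad l Q z) - Phibar (x + tr Q)|
    <= C * r ^+ 2.
Proof.
pose K : R := m%:R + m%:R ^+ 2 + m%:R.
pose M : R := \int[std_normal m]_z ((1 + `|z|) ^+ 4).
have K0 : 0 <= K by rewrite /K !addr_ge0// ?exprn_ge0.
exists (K ^+ 2 * M); split.
  by rewrite mulr_ge0 ?sqr_ge0//; apply: Rintegral_ge0 => z _; rewrite exprn_ge0 ?addr_ge0.
move=> x r l Q r0 hl hQ; set x0 := x + tr Q.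
have i0 := prob_integrable_cst (std_normal m) (Phibar x0).
have iq := integrable_quad l Q.
have iX : (std_normal m).-integrable setT
    (EFin \o (fun z => - phi x0 * (quad l Q z + - tr Q))).
  by apply: prob_integrableZ; apply: prob_integrableD => //; exact: prob_integrable_cst.
have -> : Phibar x0 = \int[std_normal m]_z
    (Phibar x0 + - phi x0 * (quad l Q z + - tr Q)).
  rewrite RintegralD// RintegralZl//; last first.
    by apply: prob_integrableD => //; exact: prob_integrable_cst.
  rewrite RintegralD// ?Rintegral_quad ?prob_Rintegral_cst; last first.
    exact: prob_integrable_cst.
  by rewrite subrr mulr0 addr0.
have -> : K ^+ 2 * M * r ^+ 2 =
    \int[std_normal m]_z ((K * r) ^+ 2 * (1 + `|z|) ^+ 4).
  by rewrite RintegralZl//; [rewrite exprMn -/M; lra|exact: integrable_poly].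
apply: Rintegral_dist_le.
- apply: integrable_Phibar; apply: measurable_funD => //.
  exact: measurable_quad.
- exact: prob_integrableD.
- by apply: prob_integrableZ; exact: integrable_poly.
- move=> z; have := Phibar_taylor x0 (quad l Q z - tr Q).
  have -> : x0 + (quad l Q z - tr Q) = x + quad l Q z by rewrite /x0; lra.
  rewrite (_ : _ - (_ + _) = Phibar (x + quad l Q z) - Phibar x0 +
    phi x0 * (quad l Q z - tr Q)); last by ring.
  move=> h; apply: (le_trans h).
  rewrite -(real_normK (num_real _)) (_ : 4%N = (2 * 2)%N)// exprM -exprMn.
  rewrite ler_pXn2r ?nnegrE//; last first.
    by rewrite !mulr_ge0// exprn_ge0 ?addr_ge0.
  apply: (le_trans (ler_normB _ _)).
  have := quad_le z r0 hl hQ; have := tr_le r0 hQ.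
  have z1 : 1 <= (1 + `|z|) ^+ 2 by rewrite exprn_ege1// lerDl.
  have m0 : 0 <= r * m%:R :> R by rewrite mulr_ge0.
  have : r * m%:R <= r * m%:R * (1 + `|z|) ^+ 2 :> R by rewrite ler_peMr.
  by rewrite /K; lra.
Qed.

End std_normal_moments.

(** * Gaussian probability of events close to a half-space *)

Section product_normal.
Context {R : realType}.

Definition gauss m : probability (pt R m) R :=
  (std_normal m \x std_normal1)%E.

Lemma PrE m (t : R) (mu : pt R m) D :
  Pr t mu D = fine (gauss m (affine (Num.sqrt t) mu @^-1` D)).
Proof. by []. Qed.

Lemma gauss_halfspace m (G : 'rV[R]_m -> R) : measurable_fun setT G ->
  fine (gauss m [set y | G y.1 < y.2]) = \int[std_normal m]_z Phibar (G z).
Proof.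
move=> mG; rewrite /gauss /= /product_measure1 /Rintegral; congr fine.
apply: eq_integral => z _; rewrite PhibarE /=; congr (std_normal1 _).
by apply/seteqP; split => v /=; rewrite /xsection/= inE /= in_itv/= andbT.
Qed.

Lemma measurable_halfspace m (G : 'rV[R]_m -> R) : measurable_fun setT G ->
  measurable [set y : pt R m | G y.1 < y.2].
Proof.
move=> mG; rewrite (_ : [set y | _] = (fun y : pt R m => G y.1 < y.2) @^-1` [set true]).
  rewrite -[X in measurable X]setTI; apply: measurable_fun_ltr => //.
  exact: measurableT_comp mG measurable_fst.
by apply/seteqP; split => y /=.
Qed.

Lemma measurable_fst_set m (A : set 'rV[R]_m) : measurable A ->
  measurable [set y : pt R m | A y.1].
Proof.
move=> mA; rewrite (_ : [set y | _] = A `*` setT); first exact: measurableX.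
by apply/seteqP; split => y //= [].
Qed.

Lemma measurable_snd_set m (A : set R) : measurable A ->
  measurable [set y : pt R m | A y.2].
Proof.
move=> mA; rewrite (_ : [set y | _] = setT `*` A); first exact: measurableX.
by apply/seteqP; split => y //= [].
Qed.

Lemma gauss_fst m (A : set 'rV[R]_m) : measurable A ->
  gauss m [set y | A y.1] = std_normal m A.
Proof.
move=> mA; rewrite (_ : [set y | _] = A `*` setT).
  by rewrite [LHS]product_measure1E//= probability_setT mule1.
by apply/seteqP; split => y //= [].
Qed.

Lemma gauss_snd m (A : set R) : measurable A ->
  gauss m [set y | A y.2] = std_normal1 A.
Proof.
move=> mA; rewrite (_ : [set y | _] = setT `*` A).
  by rewrite [LHS]product_measure1E//= probability_setT mul1e.
by apply/seteqP; split => y //= [].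
Qed.

Lemma std_normal_coordE m (i : 'I_m) (A : set R) : measurable A ->
  std_normal m [set z | A (z 0 i)] = std_normal1 A.
Proof.
move=> mA.
have mB : measurable [set z : 'rV[R]_m | A (z 0 i)].
  by rewrite -[X in measurable X]setTI; exact: measurable_rV_coord.
rewrite -[X in std_normal m X]setIT -integral_indic//.
transitivity (\int[std_normal m]_z ((EFin \o \1_A) (z 0%R i)))%E.
  by apply: eq_integral => z _; rewrite /= !indicE.
rewrite (ge0_integral_std_normal_coord i (f := EFin \o \1_A)).
- by rewrite integral_indic// setIT.
- by apply/measurable_EFinP; exact: measurable_indic.
- by move=> x; rewrite /= lee_fin.
Qed.

Lemma prob_fine_exists d (T : measurableType d) (P : probability T R) m
    (A : 'I_m -> set T) (a : R) :
  (forall i, measurable (A i)) -> (forall i, fine (P (A i)) <= a) ->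
  fine (P [set x | exists i, A i x]) <= m%:R * a.
Proof.
elim: m A => [|m IH] A mA hA.
  rewrite mul0r (_ : [set x | _] = set0) ?measure0//.
  by apply/seteqP; split => x //= [[]].
have mA' : measurable [set x | exists i, A (lift ord0 i) x].
  rewrite (_ : [set x | _] = \bigcup_(i in [set: 'I_m]) A (lift ord0 i)).
    by apply: fin_bigcup_measurable => //; exact: finite_finset.
  by apply/seteqP; split => [x [i h]|x [i _ h]]; exists i.
rewrite (_ : [set x | _] = A ord0 `|` [set x | exists i, A (lift ord0 i) x]).
  apply: (le_trans (prob_fine_setU _ _ _)) => //.
  rewrite -natr1 mulrDl mul1r addrC; apply: lerD => //.
  by apply: IH => // i.
apply/seteqP; split => x /= => [[i]|[h|[i h]]]; last 2 first.
- by exists ord0.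
- by exists (lift ord0 i).
by case: (unliftP ord0 i) => [j|] ->; [right; exists j|left].
Qed.

Lemma measurable_norm_gt : forall r : R, measurable [set x : R | r < `|x|].
Proof.
move=> r; rewrite (_ : [set x | _] = (fun x : R => `|x|) @^-1` `]r, +oo[%classic).
  by rewrite -[X in measurable X]setTI; exact: measurable_normR.
by apply/seteqP; split => x /=; rewrite in_itv/= andbT.
Qed.

Lemma measurable_rV_norm_gt m (r : R) : measurable [set x : 'rV[R]_m | r < `|x|].
Proof.
rewrite (_ : [set x | _] = (fun x : 'rV[R]_m => `|x|) @^-1` `]r, +oo[%classic).
  by rewrite -[X in measurable X]setTI; exact: measurable_rV_norm.
by apply/seteqP; split => x /=; rewrite in_itv/= andbT.
Qed.

Lemma std_normal_tail m (r : R) : 0 <= r ->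
  fine (std_normal m [set z | r < `|z|]) <= m%:R * (2 * expR (- (r ^+ 2 / 2))).
Proof.
move=> r0.
have mA (i : 'I_m) : measurable [set z : 'rV[R]_m | r < `|z 0 i|].
  rewrite -[X in measurable X]setTI.
  exact: (measurable_rV_coord i measurableT (measurable_norm_gt r)).
apply: (@le_trans _ _ (fine (std_normal m [set z : 'rV[R]_m | exists i, r < `|z 0 i|]))).
  apply: prob_fine_le.
  - exact: measurable_rV_norm_gt.
  - rewrite (_ : [set x | _] = \bigcup_(i in [set: 'I_m]) [set z : 'rV[R]_m | r < `|z 0 i|]).
      by apply: fin_bigcup_measurable => //; exact: finite_finset.
    by apply/seteqP; split => [x [i h]|x [i _ h]]; exists i.
  - move=> z /= rz; have [z0|[i zi]] := row_norm_witness z.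
      by move: rz; rewrite z0 ltNge r0.
    by exists i; rewrite -zi.
apply: (@prob_fine_exists _ _ _ _ (fun i => [set z : 'rV[R]_m | r < `|z 0 i|])) => // i.
rewrite (@std_normal_coordE _ i [set x : R | r < `|x|]); last exact: measurable_norm_gt.
exact: gamma1_tail.
Qed.

Definition outside m (r : R) : set (pt R m) :=
  [set y | r < `|y.1|] `|` [set y | r < `|y.2|].

Lemma measurable_outside m r : measurable (@outside m r).
Proof.
apply: measurableU.
  exact: (measurable_fst_set (measurable_rV_norm_gt r)).
exact: (measurable_snd_set (measurable_norm_gt r)).
Qed.

Lemma gauss_tail m (r : R) : 0 <= r ->
  fine (gauss m (outside r)) <= m.+1%:R * (2 * expR (- (r ^+ 2 / 2))).
Proof.
move=> r0; apply: (le_trans (prob_fine_setU _ _ _)).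
- exact: (measurable_fst_set (measurable_rV_norm_gt r)).
- exact: (measurable_snd_set (measurable_norm_gt r)).
rewrite -natr1 mulrDl mul1r; apply: lerD.
  rewrite (gauss_fst (A := [set z | r < `|z|])); last exact: measurable_rV_norm_gt.
  exact: std_normal_tail.
rewrite (gauss_snd m (A := [set z | r < `|z|])); last exact: measurable_norm_gt.
exact: gamma1_tail.
Qed.

Let event_arith (C1 M C2 r2 A e p t x g1 g2 : R) :
  0 <= C1 /\ 0 <= M /\ 0 <= C2 -> 0 <= r2 -> 0 <= A -> 0 <= e ->
  `|g1 - x| <= C1 * r2 + A * M -> `|g2 - x| <= C1 * r2 + 2 * A * M ->
  p <= g2 + t -> g1 <= p + t -> t <= C2 * e ->
  `|p - x| <= (C1 + 2 * M + C2) * (r2 + A + e).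
Proof.
move=> [C10 [M0 C20]] r20 A0 e0 + + pt1 pt2 te.
rewrite !ler_norml => /andP[a1 a2] /andP[b1 b2].
have p1 : 0 <= M * r2 by rewrite mulr_ge0.
have p2 : 0 <= C2 * r2 by rewrite mulr_ge0.
have p3 : 0 <= C1 * A by rewrite mulr_ge0.
have p4 : 0 <= C2 * A by rewrite mulr_ge0.
have p5 : 0 <= C1 * e by rewrite mulr_ge0.
have p6 : 0 <= M * e by rewrite mulr_ge0.
have p7 : 0 <= M * A by rewrite mulr_ge0.
by apply/andP; split; lra.
Qed.

(** Inside the box of size L the event is squeezed between two half-spaces above graphs that differ
    by multiples of A (1 + |z|)^q. The Lipschitz bound for [Phibar] turns this shift into A times a
    Gaussian moment, and the outside of the box costs a tail. The constant depends on m and q alone,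
    so the estimate is uniform over all instances. *)
Lemma gauss_event m q : exists C : R, 0 <= C /\
  forall (x r A L : R) (l : 'I_m -> R) Q (E : set (pt R m)),
  0 <= r -> 0 < A -> 0 <= L ->
  (forall i, `|l i| <= r) -> (forall i j, `|Q i j| <= r) -> measurable E ->
  (forall z v, `|z| <= L -> `|v| <= L ->
     x + quad l Q z + A * (1 + `|z|) ^+ q < v -> E (z, v)) ->
  (forall z v, `|z| <= L -> `|v| <= L ->
     v < x + quad l Q z - A * (1 + `|z|) ^+ q -> ~ E (z, v)) ->
  `|fine (gauss m E) - Phibar (x + tr Q)| <=
    C * (r ^+ 2 + A + expR (- (L ^+ 2 / 2))).
Proof.
have [C1 [C10 hC1]] := @Rintegral_Phibar_quad R m.
pose M : R := \int[std_normal m]_z ((1 + `|z|) ^+ q).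
have M0 : 0 <= M.
  by apply: Rintegral_ge0 => z _; rewrite exprn_ge0 ?addr_ge0.
pose C2 : R := m.+1%:R * 2.
have C20 : 0 <= C2 by rewrite mulr_ge0.
exists (C1 + 2 * M + C2); split; first by rewrite !addr_ge0// mulr_ge0.
move=> x r A L l Q E r0 A0 L0 hl hQ mE EL EU.
set e := expR _; have e0 : 0 <= e by exact: expR_ge0.
pose G (s : R) (z : 'rV[R]_m) := x + quad l Q z + s * (1 + `|z|) ^+ q.
have mG s : measurable_fun setT (G s).
  apply: measurable_funD.
    by apply: measurable_funD => //; exact: measurable_quad.
  apply: measurable_funM => //; apply: measurable_funX.
  by apply: measurable_funD => //; exact: measurable_rV_norm.
have tailL := @gauss_tail m L L0.
have hG s : `|fine (gauss m [set y | G s y.1 < y.2]) - Phibar (x + tr Q)| <=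
    C1 * r ^+ 2 + `|s| * M.
  rewrite gauss_halfspace//.
  have := hC1 x r l Q r0 hl hQ.
  set I0 := \int[_]_z Phibar (x + quad l Q z) => h1.
  have h2 : `|\int[std_normal m]_z Phibar (G s z) - I0| <= `|s| * M.
    rewrite /M -RintegralZl//; last exact: integrable_poly.
    apply: Rintegral_dist_le.
    - exact: integrable_Phibar.
    - apply: integrable_Phibar; apply: measurable_funD => //.
      exact: measurable_quad.
    - by apply: prob_integrableZ; exact: integrable_poly.
    - move=> z; apply: (le_trans (Phibar_lip _ _)).
      by rewrite /G addrAC subrr add0r normrM [X in _ * X]ger0_norm// exprn_ge0 ?addr_ge0.
  by apply: (le_trans (ler_distD I0 _ _)); rewrite addrC; exact: lerD h1 h2.
have mH s := measurable_halfspace (mG s).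
have mO := @measurable_outside m L.
have inO (z : 'rV[R]_m) (v : R) : ~ @outside m L (z, v) -> `|z| <= L /\ `|v| <= L.
  by move=> /not_orP[/= /negP + /negP]; rewrite -!leNgt.
have poly0 (z : 'rV[R]_m) : 0 < (1 + `|z|) ^+ q.
  by rewrite exprn_gt0// (lt_le_trans ltr01)// lerDl.
(* The shift is 2 A, not A: a point not strictly above the graph lowered by 2 A lies strictly below
   the one lowered by A, as the hypothesis on the complement of E demands. This uses A > 0. *)
have upper : fine (gauss m E) <=
    fine (gauss m [set y | G (- (2 * A)) y.1 < y.2]) + fine (gauss m (outside L)).
  apply: le_trans (prob_fine_setU _ (mH _) mO).
  apply: prob_fine_le => //; first exact: measurableU.
  move=> [z v] Ezv; have [|/inO[zL vL]] := pselect (outside L (z, v)); first by right.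
  left => /=; rewrite ltNge; apply/negP => h.
  apply: (EU z v zL vL) Ezv; apply: (le_lt_trans h).
  by rewrite /G mulNr; have := mulr_gt0 A0 (poly0 z); lra.
have lower : fine (gauss m [set y | G A y.1 < y.2]) <=
    fine (gauss m E) + fine (gauss m (outside L)).
  apply: le_trans (prob_fine_setU _ mE mO).
  apply: prob_fine_le => //; first exact: measurableU.
  move=> [z v] /= Gzv; have [|/inO[zL vL]] := pselect (outside L (z, v)); first by right.
  by left; apply: EL.
have nA : `|A| = A by rewrite gtr0_norm.
have nA2 : `|- (2 * A)| = 2 * A by rewrite normrN gtr0_norm// mulr_gt0.
move: (hG A) (hG (- (2 * A))); rewrite nA nA2 => hG1 hG2.
have hC : 0 <= C1 /\ 0 <= M /\ 0 <= C2 by [].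
apply: (event_arith hC (sqr_ge0 r) (ltW A0) e0 hG1 hG2 upper lower).
by rewrite /C2 -mulrA.
Qed.

End product_normal.

Opaque Phibar_inv Pr.

(** * Measurability of probabilities as functions of the mean *)

Section measurability.
Context {R : realType}.

Lemma measurable_affine2 d (T : measurableType d) m (s : R) (f g : T -> pt R m) :
  measurable_fun setT f -> measurable_fun setT g ->
  measurable_fun setT (fun x => affine s (f x) (g x)).
Proof.
move=> mf mg; apply/measurable_fun_pairP; split => /=.
  apply: measurable_fun_rVP => i.
  rewrite (_ : (fun _ => _) = (fun x => (f x).1 0 i + s * (g x).1 0 i)); last first.
    by apply/funext => x /=; rewrite !mxE.
  have mc (h : T -> pt R m) : measurable_fun setT h ->
      measurable_fun setT (fun x => (h x).1 0 i).
    move=> mh.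
    have := measurableT_comp (measurable_rV_coord i) (measurableT_comp measurable_fst mh).
    exact.
  by apply: measurable_funD; [exact: mc|apply: measurable_funM => //; exact: mc].
apply: measurable_funD; first exact: (measurableT_comp measurable_snd mf).
by apply: measurable_funM => //; exact: (measurableT_comp measurable_snd mg).
Qed.

(** The event may depend on x: it is a section of a jointly measurable set. The double bootstrap
    needs this form, since its event compares the replicate with the observation. *)
Lemma measurable_Pr_joint d (T : measurableType d) m (t : R) (f : T -> pt R m)
    (E : set (T * pt R m)) :
  measurable_fun setT f -> measurable E ->
  measurable_fun setT (fun x => Pr t (f x) [set y | E (x, y)]).
Proof.
move=> mf mE.
pose F (xz : T * pt R m) := (xz.1, affine (Num.sqrt t) (f xz.1) xz.2).
have mF : measurable_fun setT F.
  apply/measurable_fun_pairP; split; first exact: measurable_fst.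
  apply: measurable_affine2; last exact: measurable_snd.
  exact: (measurableT_comp mf measurable_fst).
have mE' : measurable (F @^-1` E) by rewrite -[X in measurable X]setTI; exact: mF.
rewrite (_ : (fun _ => _) = fine \o (gauss m \o xsection (F @^-1` E))).
  apply: measurableT_comp; first by [].
  exact: measurable_fun_xsection.
apply/funext => x; rewrite PrE /=; congr (fine (gauss m _)).
by apply/seteqP; split => z; rewrite /xsection /= inE.
Qed.

Lemma measurable_Pr d (T : measurableType d) m (t : R) (f : T -> pt R m) D :
  measurable_fun setT f -> measurable D ->
  measurable_fun setT (fun x => Pr t (f x) D).
Proof.
move=> mf mD; rewrite (_ : (fun _ => _) =
    (fun x => Pr t (f x) [set y | (setT `*` D) (x, y)])).
  by apply: measurable_Pr_joint => //; exact: measurableX.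
apply/funext => x; congr (Pr t (f x) _).
by apply/seteqP; split => y //= [].
Qed.

(** The preimage of a ray above r is read off from the sign of r; as 0^-1 = 0, the point 0 belongs
    to it exactly when r < 0. *)
Lemma measurable_inv : measurable_fun setT (fun x : R => x^-1).
Proof.
apply: (measurability (@RGenOInfty.G R)) => [|/= _ [_] [r ->] <-].
  exact: RGenOInfty.measurableE.
rewrite setTI.
have key (x : R) : 0 < x * r^-1 -> (x < r^-1) = (r < x^-1).
  move=> xr; have x0 : x != 0 by apply: contraTneq xr => ->; rewrite mul0r ltxx.
  have r0 : r != 0 by apply: contraTneq xr => ->; rewrite invr0 mulr0 ltxx.
  rewrite -subr_lt0 -[in RHS]subr_lt0.
  rewrite (_ : x - r^-1 = x * r^-1 * (r - x^-1)); last by field; rewrite x0.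
  by rewrite pmulr_rlt0.
rewrite (_ : _ @^-1` _ =
  if r > 0 then `]0, r^-1[%classic else
  if r == 0 then `]0, +oo[%classic else
  `]-oo, r^-1[%classic `|` `[0, +oo[%classic).
  by case: ifPn => // _; case: ifPn => // _; exact: measurableU.
apply/seteqP; split => x /=; rewrite in_itv/= andbT;
  have [r0|r0|->] := ltgtP r 0; rewrite /= !in_itv/= ?andbT ?invr_gt0//.
- have [x0 rx|x0 _] := ltP x 0; last by right.
  by left; rewrite key// nmulr_rgt0 ?invr_lt0.
- move=> rx; have x0 : 0 < x by rewrite -invr_gt0; exact: lt_trans rx.
  by rewrite x0 key// mulr_gt0 ?invr_gt0.
- case=> [xr|x0]; last by apply: (lt_le_trans r0); rewrite invr_ge0.
  have x0 : x < 0 by apply: lt_trans xr _; rewrite invr_lt0.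
  by rewrite -key// nmulr_rgt0 ?invr_lt0.
- by move=> /andP[x0 xr]; rewrite -key// mulr_gt0 ?invr_gt0.
Qed.

Lemma measurable_div d (T : measurableType d) (f g : T -> R) :
  measurable_fun setT f -> measurable_fun setT g ->
  measurable_fun setT (fun x => f x / g x).
Proof.
by move=> mf mg; apply: measurable_funM => //; exact: measurableT_comp measurable_inv mg.
Qed.

End measurability.

(** * Extrapolation by fitted lines *)

Section fitted_line.
Context {R : realType}.

Lemma sumr_seq_gt0 (s : seq R) (F : R -> R) (t0 : R) :
  t0 \in s -> 0 < F t0 -> (forall t, t \in s -> 0 <= F t) ->
  0 < \sum_(t <- s) F t.
Proof.
elim: s => // a s IH; rewrite in_cons big_cons => /orP[/eqP <-|t0s] F0 Fge.
  apply: ltr_wpDr => //; rewrite big_seq; apply: sumr_ge0 => t ts.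
  by apply: Fge; rewrite in_cons ts orbT.
apply: ltr_wpDl; first by apply: Fge; rewrite mem_head.
by apply: IH => // t ts; apply: Fge; rewrite in_cons ts orbT.
Qed.

(** A weighted least squares fit evaluated at x is linear in the data and reproduces affine
    functions, which is what the two moment identities say. Two distinct grid points cannot both
    equal the weighted mean, so the weighted variance V is positive. *)
Lemma fitted_line_weights (grid : seq R) (w : R -> R) (x : R) :
  (1 < size grid)%N -> uniq grid -> (forall t, t \in grid -> 0 < w t) ->
  exists c : R -> R, [/\ \sum_(t <- grid) c t = 1,
    \sum_(t <- grid) c t * t = x &
    forall f, fitted_line grid w f x = \sum_(t <- grid) c t * f t].
Proof.
move=> gs gu w0.
pose W := \sum_(t <- grid) w t.
pose tb := wmean grid w id.
pose V := \sum_(t <- grid) w t * (t - tb) ^+ 2.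
have [a [b [ag bg ab]]] : exists a b, [/\ a \in grid, b \in grid & a != b].
  case: grid gs gu {w0 W tb V} => [|a [|b g]]//= _ /andP[+ _].
  rewrite in_cons negb_or => /andP[ab _].
  by exists a, b; rewrite !in_cons !eqxx ?orbT.
have W0 : W != 0.
  apply/lt0r_neq0/(sumr_seq_gt0 ag); first exact: w0.
  by move=> t /w0/ltW.
have V0 : V != 0.
  have Vge t : t \in grid -> 0 <= w t * (t - tb) ^+ 2.
    by move=> /w0/ltW ?; rewrite mulr_ge0// sqr_ge0.
  apply: lt0r_neq0; have [/eqP at0|at0] := eqVneq (a - tb) 0.
    apply: (sumr_seq_gt0 bg) => //; rewrite mulr_gt0 ?w0// exprn_even_gt0//=.
    by apply: contra ab; rewrite subr_eq0 => /eqP ->; rewrite -subr_eq0.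
  by apply: (sumr_seq_gt0 ag) => //; rewrite mulr_gt0 ?w0// exprn_even_gt0.
have tbE : \sum_(t <- grid) w t * t = tb * W by rewrite /tb /wmean mulfVK.
have cen : \sum_(t <- grid) w t * (t - tb) = 0.
  under eq_bigr do rewrite mulrBr.
  by rewrite sumrB tbE -mulr_suml mulrC subrr.
exists (fun t => w t / W + w t * (t - tb) / V * (x - tb)); split.
- by rewrite big_split/= -!mulr_suml cen mul0r mul0r addr0 divff.
- under eq_bigr do rewrite mulrDl.
  rewrite big_split/=.
  under eq_bigr do rewrite mulrAC.
  rewrite -mulr_suml tbE mulfK//.
  rewrite (eq_bigr (fun t => (w t * (t - tb) ^+ 2 + tb * (w t * (t - tb))) *
     (V^-1 * (x - tb)))); last by move=> t _; ring.
  by rewrite -mulr_suml big_split/= -mulr_sumr cen mulr0 addr0 mulrA divff// mul1r subrKC.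
- move=> f; rewrite /fitted_line -/tb -/V {1}/wmean -/W.
  rewrite !mulr_suml -big_split/=; apply: eq_bigr => t _.
  by ring.
Qed.

(** Direct evaluation is the case of a single node of weight 1, so that positive and extrapolated
    [sigma2] are handled by one formula with positive nodes and affine-reproducing weights. *)
Lemma psi_weights (grid : seq R) (w : R -> R) (sigma2 : R) :
  (1 < size grid)%N -> uniq grid -> (forall t, t \in grid -> 0 < t) ->
  (forall t, t \in grid -> 0 < w t) ->
  exists (g : seq R) (c : R -> R), [/\ forall t, t \in g -> 0 < t,
    \sum_(t <- g) c t = 1, \sum_(t <- g) c t * t = sigma2 &
    forall m (D : set (pt R m)) y,
      psi grid w sigma2 D y = \sum_(t <- g) c t * psi_pos D y t].
Proof.
move=> gs gu g0 w0; have [s0|s0] := ltP 0 sigma2.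
  exists [:: sigma2], (fun=> 1); split.
  - by move=> t; rewrite inE => /eqP ->.
  - by rewrite big_seq1.
  - by rewrite big_seq1 mul1r.
  - by move=> m D y; rewrite big_seq1 mul1r /psi s0.
have [c [c1 c2 c3]] := fitted_line_weights sigma2 gs gu w0.
exists grid, c; split => // m D y.
by rewrite /psi ltNge s0/= c3.
Qed.

End fitted_line.

Section measurable_pvalues.
Context {R : realType} {m : nat}.
Variables (grid : seq R) (w : R -> R).
Hypotheses (gs : (1 < size grid)%N) (gu : uniq grid)
  (g0 : forall t, t \in grid -> 0 < t) (w0 : forall t, t \in grid -> 0 < w t).

Lemma measurable_psi sigma2 (D : set (pt R m)) : measurable D ->
  measurable_fun setT (psi grid w sigma2 D).
Proof.
move=> mD; have [g [c [_ _ _ H]]] := psi_weights sigma2 gs gu g0 w0.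
rewrite (_ : psi _ _ _ _ = (fun y => \sum_(t <- g) c t * psi_pos D y t)); last first.
  by apply/funext => y; exact: H.
apply: measurable_sum => t; apply: measurable_funM => //.
apply: measurable_funM => //.
apply: (measurableT_comp measurable_Phibar_inv).
by apply: measurable_Pr => //; exact: measurable_id.
Qed.

Lemma measurable_pval sigma2 (D : set (pt R m)) : measurable D ->
  measurable_fun setT (pval grid w sigma2 D).
Proof.
move=> mD; rewrite /pval.
exact: (measurableT_comp measurable_Phibar (measurable_psi sigma2 mD)).
Qed.

Lemma measurable_pBP1 sigma2 muhat (H S : set (pt R m)) :
  measurable_fun setT muhat -> measurable H -> measurable S ->
  measurable_fun setT (pBP1 grid w sigma2 muhat H S).
Proof.
move=> mm mH mS; apply: measurable_div; first exact: measurable_pval.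
exact: measurable_Pr.
Qed.

Lemma measurable_pBP2 sigma2 muhat (H S : set (pt R m)) :
  measurable_fun setT muhat -> measurable H -> measurable S ->
  measurable_fun setT (pBP2 grid w sigma2 muhat H S).
Proof.
move=> mm mH mS; apply: measurable_div; last exact: measurable_Pr.
have mp := measurable_pBP1 sigma2 mm mH mS.
pose E : set (pt R m * pt R m) := [set z |
  pBP1 grid w sigma2 muhat H S z.2 < pBP1 grid w sigma2 muhat H S z.1].
apply: (@measurable_Pr_joint _ _ _ _ _ _ E) => //.
have m1 := measurableT_comp mp (@measurable_fst _ _ (pt R m) (pt R m)).
have m2 := measurableT_comp mp (@measurable_snd _ _ (pt R m) (pt R m)).
have -> : E = setT `&` (fun z => (pBP1 grid w sigma2 muhat H S \o snd) z <
    (pBP1 grid w sigma2 muhat H S \o fst) z) @^-1` [set true].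
  by rewrite setTI; apply/seteqP; split.
exact: (measurable_fun_ltr m2 m1).
Qed.

Lemma measurable_lt_cst (p : pt R m -> R) (c : R) : measurable_fun setT p ->
  measurable [set y | p y < c].
Proof.
move=> mp; rewrite (_ : [set y | _] = (fun y => p y < c) @^-1` [set true]).
  by rewrite -[X in measurable X]setTI; exact: measurable_fun_ltr.
by apply/seteqP; split => y /=.
Qed.

Lemma measurable_gt_cst (p : pt R m -> R) (c : R) : measurable_fun setT p ->
  measurable [set y | c < p y].
Proof.
move=> mp; rewrite (_ : [set y | _] = (fun y => c < p y) @^-1` [set true]).
  by rewrite -[X in measurable X]setTI; exact: measurable_fun_ltr.
by apply/seteqP; split => y /=.
Qed.

Lemma measurable_region (h : 'rV[R]_m -> R) : continuous h ->
  measurable (region h).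
Proof.
move=> /continuous_measurable_rV mh.
rewrite (_ : region h = ~` [set y | - h y.1 < y.2]).
  apply: measurableC; apply: (@measurable_halfspace _ _ (fun u => - h u)).
  exact: measurableT_comp.
by apply/seteqP; split => y /=; rewrite /region /= leNgt => /negP.
Qed.

End measurable_pvalues.

(** * Calculus of uniform asymptotic orders *)

(* An asymptotic context: a family of instances, each attached to a sample size
   [idx i] and weighted by [wt i], which grows at most like a power of the
   logarithm of the sample size.  [pO c k f] says that f = O(n^(-k/2)) uniformly
   over the instances, up to a power of the weight. *)
Record ctx (R : realType) (I : Type) :=
  Ctx { idx : I -> nat; dom : I -> Prop; wt : I -> R }.

Section asymptotic_calculus.
Context {R : realType}.

Lemma rsqrt_ge0 n : 0 <= rsqrt n :> R.
Proof. by rewrite invr_ge0 sqrtr_ge0. Qed.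

Lemma rsqrt_sqr n : rsqrt n ^+ 2 = n%:R^-1 :> R.
Proof. by rewrite /rsqrt exprVn sqr_sqrtr. Qed.

Lemma rsqrt_le1 n : (0 < n)%N -> rsqrt n <= 1 :> R.
Proof.
move=> n0; rewrite /rsqrt invf_le1 ?sqrtr_gt0 ?ltr0n//.
by rewrite -[leLHS]sqrtr1 ler_sqrt ?ler1n ?ltr0n.
Qed.

Lemma near_inftyP (P : nat -> Prop) :
  (\forall n \near \oo, P n) <-> exists N, forall n, (N <= n)%N -> P n.
Proof. by split => [[N _ h]|[N h]]; exists N. Qed.

Lemma ln_large (B : R) : exists N, forall n, (N <= n)%N -> B <= ln (n%:R : R).
Proof.
exists (Num.truncn (expR B)).+1 => n Nn.
rewrite -[leLHS]expRK ler_ln ?posrE ?expR_gt0//; last first.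
  by rewrite ltr0n (leq_trans _ Nn).
apply: (le_trans (ltW (truncnS_gt _))); by rewrite ler_nat.
Qed.

(** With L = ln n, the exponential series gives L^(2p+1) <= (2p+1)! n. The odd exponent leaves one
    spare factor L, which exceeds (2p+1)! / e^2 for large n; hence L^(2p) <= e^2 n, and a square
    root concludes. *)
Lemma polylog_rsqrt (p : nat) (e : R) : 0 < e ->
  exists N, forall n, (N <= n)%N -> (ln (n%:R : R)) ^+ p * rsqrt n <= e.
Proof.
move=> e0; set F : R := ((p.*2).+1)`!%:R.
have F0 : 0 < F by rewrite ltr0n fact_gt0.
have [N hN] := ln_large (Num.max 1 (F / e ^+ 2)).
exists N.+1 => n Nn.
have n0 : 0 < n%:R :> R by rewrite ltr0n (leq_trans _ Nn).
have := hN n (ltnW Nn); rewrite ge_max => /andP[l1 lF].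
set L := ln _ in l1 lF *.
have L0 : 0 < L by exact: lt_le_trans l1.
have h1 : L ^+ (p.*2).+1 <= F * n%:R.
  have h0 : 1 + L ^+ (p.*2).+1 / F <= n%:R.
    by have := @expR_ge1Dxn R L p.*2 (ltW L0); rewrite lnK ?posrE.
  by rewrite mulrC -ler_pdivrMr// (le_trans _ h0)// lerDr.
have h2 : L ^+ p.*2 <= e ^+ 2 * n%:R.
  rewrite -(ler_pM2l L0) -exprS; apply: (le_trans h1).
  rewrite mulrA ler_wpM2r ?(ltW n0)//.
  by rewrite -ler_pdivrMr// exprn_gt0.
have s0 : 0 < Num.sqrt n%:R :> R by rewrite sqrtr_gt0.
rewrite /rsqrt ler_pdivrMr// -(@ler_pXn2r _ 2) ?nnegrE ?exprn_ge0 ?(ltW L0) ?mulr_ge0 ?(ltW e0) ?(ltW s0)//.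
by rewrite -exprM muln2 exprMn sqr_sqrtr ?(ltW n0).
Qed.

Section context.
Context {I : Type}.
Implicit Types (c : ctx R I) (f g : I -> R) (P Q : I -> Prop).

(** One threshold on the sample size serves all instances: this is the source of uniformity. *)
Definition ev c P := exists N, forall i, dom c i -> (N <= idx c i)%N -> P i.

Lemma evI c P : (forall i, dom c i -> P i) -> ev c P.
Proof. by move=> h; exists 0%N => i /h. Qed.

Lemma ev_and c P Q : ev c P -> ev c Q -> ev c (fun i => P i /\ Q i).
Proof.
move=> [N h] [N' h']; exists (maxn N N') => i di.
by rewrite geq_max => /andP[/(h _ di) ? /(h' _ di)].
Qed.

Lemma ev_mono c P Q : ev c P -> (forall i, dom c i -> P i -> Q i) -> ev c Q.
Proof. by move=> [N h] H; exists N => i di Ni; apply: H => //; exact: h. Qed.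

Lemma ev2 c P Q (S : I -> Prop) : ev c P -> ev c Q ->
  (forall i, dom c i -> P i -> Q i -> S i) -> ev c S.
Proof. by move=> p q h; apply: (ev_mono (ev_and p q)) => i di [] ; exact: h. Qed.

Lemma ev_large c (N : nat) : ev c (fun i => (N <= idx c i)%N).
Proof. by exists N. Qed.

Lemma ev_forall c m (P : 'I_m -> I -> Prop) : (forall j, ev c (P j)) ->
  ev c (fun i => forall j, P j i).
Proof.
elim: m P => [|m IH] P h; first by apply: evI => i _ [].
apply: (ev2 (h ord0) (IH (fun j => P (lift ord0 j)) (fun j => h _))) => i _ a b j.
by case: (unliftP ord0 j) => [j'|] ->.
Qed.

Definition ctx_ok c := exists (K : R) (p : nat),
  ev c (fun i => 1 <= wt c i <= K * (ln (idx c i)%:R) ^+ p).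

Definition pO c (k : nat) f := exists (C : R) (q : nat), 0 <= C /\
  ev c (fun i => `|f i| <= C * wt c i ^+ q * rsqrt (idx c i) ^+ k).

(** Stricter than [pO c 0], which tolerates powers of the weight. True boundedness keeps [Phibar]
    and [phi] away from 0 and makes divisions by them harmless. *)
Definition bdd c f := exists C : R, ev c (fun i => `|f i| <= C).

Lemma ctx_wt c : ctx_ok c -> ev c (fun i => 1 <= wt c i).
Proof. by move=> [K [p h]]; apply: (ev_mono h) => i _ /andP[]. Qed.

Lemma pO_ext c k f g : (forall i, dom c i -> f i = g i) -> pO c k f -> pO c k g.
Proof.
move=> fg [C [q [C0 h]]]; exists C, q; split => //.
by apply: (ev_mono h) => i di; rewrite fg.
Qed.

Lemma pO_le c k f g : ev c (fun i => `|g i| <= `|f i|) -> pO c k f -> pO c k g.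
Proof.
move=> fg [C [q [C0 h]]]; exists C, q; split => //.
by apply: (ev2 h fg) => i _ h1 h2; exact: le_trans h2 h1.
Qed.

Lemma pO_norm c k f : pO c k f -> pO c k (fun i => `|f i|).
Proof. by apply: pO_le; apply: evI => i _; rewrite normr_id. Qed.

Lemma bdd_pO c f : bdd c f -> pO c 0 f.
Proof.
move=> [C h]; exists `|C|, 0%N; split => //; apply: (ev_mono h) => i _ hi.
by rewrite !expr0 !mulr1 (le_trans hi)// ler_norm.
Qed.

Lemma bdd_cst c (a : R) : bdd c (fun=> a).
Proof. by exists `|a|; exact: evI. Qed.

Lemma pO_cst c (a : R) : pO c 0 (fun=> a).
Proof. exact/bdd_pO/bdd_cst. Qed.

Lemma pO_opp c k f : pO c k f -> pO c k (fun i => - f i).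
Proof. by apply: pO_le; apply: evI => i _; rewrite normrN. Qed.

Lemma pO_add c k f g : ctx_ok c -> pO c k f -> pO c k g ->
  pO c k (fun i => f i + g i).
Proof.
move=> ok [C [q [C0 h]]] [C' [q' [C0' h']]].
exists (C + C'), (q + q')%N; split; first exact: addr_ge0.
apply: (ev2 (ev_and h h') (ctx_wt ok)) => i _ [h1 h2] w1.
have e0 : 0 <= rsqrt (idx c i) ^+ k :> R by rewrite exprn_ge0// rsqrt_ge0.
have w0 : 0 <= wt c i by exact: le_trans w1.
apply: (le_trans (ler_normD _ _)); rewrite !mulrDl; apply: lerD.
  apply: (le_trans h1); rewrite ler_wpM2r// ler_wpM2l//.
  by rewrite ler_weXn2l// leq_addr.
apply: (le_trans h2); rewrite ler_wpM2r// ler_wpM2l//.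
by rewrite ler_weXn2l// leq_addl.
Qed.

Lemma pO_sub c k f g : ctx_ok c -> pO c k f -> pO c k g ->
  pO c k (fun i => f i - g i).
Proof. by move=> ok hf /pO_opp; exact: pO_add. Qed.

Lemma pO_mul c j k f g : ctx_ok c -> pO c j f -> pO c k g ->
  pO c (j + k) (fun i => f i * g i).
Proof.
move=> ok [C [q [C0 h]]] [C' [q' [C0' h']]].
exists (C * C'), (q + q')%N; split; first exact: mulr_ge0.
apply: (ev2 h h') => i _ h1 h2; rewrite normrM !exprD.
apply: (le_trans (ler_pM _ _ h1 h2)) => //.
by rewrite le_eqVlt; apply/orP; left; apply/eqP; ring.
Qed.

Lemma pO_weak c j k f : ctx_ok c -> (j <= k)%N -> pO c k f -> pO c j f.
Proof.
move=> ok jk [C [q [C0 h]]]; exists C, q; split => //.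
apply: (ev2 (ev_and h (ev_large c 1)) (ctx_wt ok)) => i _ [h1 n1] w1.
apply: (le_trans h1); rewrite ler_wpM2l//.
  by rewrite mulr_ge0// exprn_ge0// (le_trans _ w1).
by rewrite ler_wiXn2l// ?rsqrt_ge0// rsqrt_le1.
Qed.

Lemma pO_scale c k (a : R) f : ctx_ok c -> pO c k f -> pO c k (fun i => a * f i).
Proof. by move=> ok h; exact: (pO_mul ok (pO_cst c a) h). Qed.

Lemma pO_mulr c k f g : ctx_ok c -> pO c 0 f -> pO c k g ->
  pO c k (fun i => f i * g i).
Proof. by move=> ok h h'; exact: (pO_mul ok h h'). Qed.

Lemma pO_mul11 c f g : ctx_ok c -> pO c 1 f -> pO c 1 g ->
  pO c 2 (fun i => f i * g i).
Proof. by move=> ok h h'; exact: (pO_mul ok h h'). Qed.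

Lemma pO_sqr c f : ctx_ok c -> pO c 1 f -> pO c 2 (fun i => f i ^+ 2).
Proof. by move=> ok h; exact: (pO_mul11 ok h h). Qed.

Lemma pO_exp0 c f q : ctx_ok c -> pO c 0 f -> pO c 0 (fun i => f i ^+ q).
Proof.
move=> ok h; elim: q => [|q IH]; first exact: pO_cst.
by apply: pO_ext (pO_mulr ok h IH) => i _; rewrite exprS.
Qed.

Lemma pO_sum c k m (F : I -> 'I_m -> R) : ctx_ok c ->
  (forall j, pO c k (fun i => F i j)) -> pO c k (fun i => \sum_j F i j).
Proof.
move=> ok; elim: m F => [|m IH] F h.
  exists 0, 0%N; split => //; apply: evI => i _.
  by rewrite big_ord0 normr0 !mul0r.
apply: (@pO_ext _ _ (fun i => F i ord0 + \sum_j F i (lift ord0 j))).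
  by move=> i _; rewrite big_ord_recl.
apply: (pO_add ok (h ord0)).
exact: (IH (fun i j => F i (lift ord0 j)) (fun j => h _)).
Qed.

Lemma pO_sum_seq c k (T : eqType) (s : seq T) (F : I -> T -> R) : ctx_ok c ->
  (forall t, t \in s -> pO c k (fun i => F i t)) ->
  pO c k (fun i => \sum_(t <- s) F i t).
Proof.
move=> ok; elim: s => [|a s IH] h.
  exists 0, 0%N; split => //; apply: evI => i _.
  by rewrite big_nil normr0 !mul0r.
apply: (@pO_ext _ _ (fun i => F i a + \sum_(t <- s) F i t)).
  by move=> i _; rewrite big_cons.
apply: pO_add => //; first by apply: h; rewrite mem_head.
by apply: IH => t ts; apply: h; rewrite in_cons ts orbT.
Qed.

Lemma pO_rsqrt c k : pO c k (fun i => rsqrt (idx c i) ^+ k).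
Proof.
exists 1, 0%N; split => //; apply: evI => i _.
by rewrite expr0 !mul1r ger0_norm// exprn_ge0// rsqrt_ge0.
Qed.

(** The weight is at most polylogarithmic, so a single factor n^(-1/2) beats each of its powers. *)
Lemma pO_small c k f (e : R) : ctx_ok c -> pO c k.+1 f -> 0 < e ->
  ev c (fun i => `|f i| <= e).
Proof.
move=> ok hf e0.
have [C [q [C0 h]]] := pO_weak ok (ltn0Sn k) hf.
have [K [p hK]] := ok.
have K1 : 0 < `|C * K ^+ q| + 1 by rewrite ltr_wpDl.
have [N hN] := polylog_rsqrt (p * q) (divr_gt0 e0 K1).
apply: (ev2 (ev_and h (ev_large c N)) hK) => i _ [h1 Ni] /andP[w1 wK].
apply: (le_trans h1); rewrite expr1.
have r0 := rsqrt_ge0 (idx c i).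
apply: (@le_trans _ _ ((`|C * K ^+ q| + 1) * (ln (idx c i)%:R ^+ (p * q) * rsqrt (idx c i)))).
  rewrite mulrA ler_wpM2r//.
  have : wt c i ^+ q <= (K * ln (idx c i)%:R ^+ p) ^+ q.
    by rewrite lerXn2r ?nnegrE ?(le_trans _ w1) ?(le_trans _ wK)// (le_trans _ w1).
  rewrite exprMn -exprM => hw.
  have hw0 : 0 <= wt c i ^+ q by rewrite exprn_ge0// (le_trans _ w1).
  apply: (le_trans (ler_wpM2l C0 hw)); rewrite mulrA.
  have l0 : 0 <= ln (idx c i)%:R ^+ (p * q) :> R.
    have [n0|n0] := posnP (idx c i).
      by rewrite n0 ln0// expr0n; case: (_ == _).
    by rewrite exprn_ge0// ln_ge0// ler1n.
  by rewrite ler_wpM2r//; have := ler_norm (C * K ^+ q); lra.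
rewrite -ler_pdivlMl//; apply: (le_trans (hN _ Ni)).
by rewrite mulrC.
Qed.

Lemma pO_bdd c k f : ctx_ok c -> pO c k.+1 f -> bdd c f.
Proof. by move=> ok /(pO_small ok)/(_ ltr01); exists 1. Qed.

Lemma bdd_add c f g : bdd c f -> bdd c g -> bdd c (fun i => f i + g i).
Proof.
move=> [C h] [D h']; exists (C + D); apply: (ev2 h h') => i _ h1 h2.
by apply: (le_trans (ler_normD _ _)); exact: lerD.
Qed.

Lemma bdd_opp c f : bdd c f -> bdd c (fun i => - f i).
Proof. by move=> [C h]; exists C; apply: (ev_mono h) => i _; rewrite normrN. Qed.

Lemma bdd_sub c f g : bdd c f -> bdd c g -> bdd c (fun i => f i - g i).
Proof. by move=> h /bdd_opp; exact: bdd_add. Qed.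

Lemma bdd_mul c f g : bdd c f -> bdd c g -> bdd c (fun i => f i * g i).
Proof.
move=> [C h] [D h']; exists (C * D); apply: (ev2 h h') => i _ h1 h2.
by rewrite normrM; exact: ler_pM.
Qed.

Lemma bdd_ext c f g : (forall i, dom c i -> f i = g i) -> bdd c f -> bdd c g.
Proof.
by move=> fg [C h]; exists C; apply: (ev_mono h) => i di; rewrite fg.
Qed.

(** A positive order makes b eventually at least e/2, so a lower bound is asked of the approximating
    denominator b' only. *)
Lemma pO_div c k (a a' b b' : I -> R) (e : R) : ctx_ok c -> 0 < e ->
  ev c (fun i => e <= b' i) -> bdd c a' ->
  pO c k.+1 (fun i => a i - a' i) -> pO c k.+1 (fun i => b i - b' i) ->
  pO c k.+1 (fun i => a i / b i - a' i / b' i).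
Proof.
move=> ok e0 be ba ha hb.
have e20 : 0 < e / 2 by rewrite divr_gt0.
have bsmall := pO_small ok hb e20.
have b2 : ev c (fun i => e / 2 <= b i).
  by apply: (ev2 be bsmall) => i _ h1; rewrite ler_norml => h2; lra.
have inv : bdd c (fun i => (b i)^-1).
  exists (e / 2)^-1; apply: (ev_mono b2) => i _ hb2.
  rewrite ger0_norm ?invr_ge0; last by rewrite (le_trans (ltW e20)).
  by rewrite lef_pV2 ?posrE// (lt_le_trans e20).
have inv' : bdd c (fun i => (b' i)^-1).
  exists e^-1; apply: (ev_mono be) => i _ hb'.
  rewrite ger0_norm ?invr_ge0; last by rewrite (le_trans (ltW e0)).
  by rewrite lef_pV2 ?posrE// (lt_le_trans e0).
have h1 := pO_mulr ok (bdd_pO inv) ha.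
have h2 := pO_mulr ok (bdd_pO (bdd_mul (bdd_mul ba inv) inv')) hb.
apply: pO_le (pO_sub ok h1 h2).
apply: (ev2 be b2) => i _ hb' hb2.
rewrite le_eqVlt; apply/orP; left; apply/eqP; congr `|_|.
have b0 : b i != 0 by rewrite gt_eqF// (lt_le_trans e20).
have b0' : b' i != 0 by rewrite gt_eqF// (lt_le_trans e0).
by field; rewrite b0 b0'.
Qed.

End context.

Definition restrict_ctx {I} (c : ctx R I) (P : I -> Prop) : ctx R I :=
  Ctx (idx c) (fun i => dom c i /\ P i) (wt c).

Lemma ev_restrict I (c : ctx R I) P Q : ev c Q -> ev (restrict_ctx c P) Q.
Proof. by move=> [N h]; exists N => i [di _]; exact: h. Qed.

Lemma ok_restrict I (c : ctx R I) P : ctx_ok c -> ctx_ok (restrict_ctx c P).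
Proof. by move=> [K [p h]]; exists K, p; exact: ev_restrict. Qed.

Lemma pO_restrict I (c : ctx R I) P k f : pO c k f -> pO (restrict_ctx c P) k f.
Proof. by move=> [C [q [C0 h]]]; exists C, q; split => //; exact: ev_restrict. Qed.

Lemma ev_comp I J (c : ctx R I) (c' : ctx R J) (g : J -> I) (P : I -> Prop) :
  (forall j, dom c' j -> dom c (g j)) -> (forall j, idx c' j = idx c (g j)) ->
  ev c P -> ev c' (fun j => P (g j)).
Proof.
by move=> hd hi [N h]; exists N => j dj Nj; apply: h; [exact: hd|rewrite -hi].
Qed.

Lemma pO_comp I J (c : ctx R I) (c' : ctx R J) (g : J -> I) k f :
  (forall j, dom c' j -> dom c (g j)) -> (forall j, idx c' j = idx c (g j)) ->
  ctx_ok c -> ctx_ok c' -> pO c' 0 (fun j => wt c (g j)) ->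
  pO c k f -> pO c' k (fun j => f (g j)).
Proof.
move=> hd hi okc ok hw [C [q [C0 h]]].
have h1 := ev_comp hd hi h.
have h2 := ev_comp hd hi (ctx_wt okc).
have := pO_mul ok (pO_scale C ok (pO_exp0 q ok hw)) (pO_rsqrt c' k).
rewrite add0n; apply: pO_le; apply: (ev2 h1 h2) => j _ {}h1 w1.
apply: (le_trans h1); rewrite hi ger0_norm//.
by rewrite !mulr_ge0// exprn_ge0// ?rsqrt_ge0// (le_trans _ w1).
Qed.

End asymptotic_calculus.

Section log_context.
Context {R : realType} {I : Type} (c : ctx R I).
Hypothesis ok : ctx_ok c.

(** Adding ln n to the weight makes every quantity bounded by ln n of order 0, which is the scale on
    which tails of p-values are examined. *)
Definition log_ctx : ctx R I :=
  Ctx (idx c) (dom c) (fun i => wt c i + ln (idx c i)%:R).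

Lemma log_wt : ev c (fun i => 1 <= ln (idx c i)%:R :> R /\ 1 <= wt c i).
Proof.
have [N hN] := @ln_large R 1.
by apply: (ev2 (ev_large c N) (ctx_wt ok)) => i _ /hN.
Qed.

Lemma ok_log : ctx_ok log_ctx.
Proof.
have [K [p h0]] := ok; exists (`|K| + 1), p.+1.
apply: (ev2 h0 log_wt) => i _ /andP[w1 wK] [L1 _] /=.
set L := ln _ in wK L1 *.
have Lp : L <= L ^+ p.+1 by rewrite exprS ler_peMr ?exprn_ege1// (le_trans _ L1).
have Lp' : L ^+ p <= L ^+ p.+1 by rewrite ler_weXn2l // leqnSn.
apply/andP; split; first by lra.
have L0 : 0 <= L ^+ p by rewrite exprn_ge0// (le_trans _ L1).
rewrite mulrDl mul1r; apply: lerD => //; apply: (le_trans wK).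
apply: (@le_trans _ _ (`|K| * L ^+ p)); first by rewrite ler_wpM2r ?ler_norm.
by rewrite ler_wpM2l.
Qed.

Lemma pO_log k (f : I -> R) : pO c k f -> pO log_ctx k f.
Proof.
move=> [C [q [C0 h]]]; exists C, q; split => //.
apply: (ev2 h log_wt) => i _ h1 [L1 w1]; apply: (le_trans h1).
rewrite ler_wpM2r ?exprn_ge0 ?rsqrt_ge0// ler_wpM2l//=.
by rewrite lerXn2r ?nnegrE; lra.
Qed.

Lemma pO_ln : pO log_ctx 0 (fun i => ln (idx c i)%:R).
Proof.
exists 1, 1%N; split => //; apply: (ev_mono log_wt) => i _ /= [L1 w1].
by rewrite mul1r expr1 expr0 mulr1 ger0_norm; lra.
Qed.

End log_context.

(** * Asymptotic probabilities of upper events *)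

Section events.
Context {R : realType}.

Lemma pO_Phibar I (c : ctx R I) k (f g : I -> R) :
  pO c k (fun i => f i - g i) -> pO c k (fun i => Phibar (f i) - Phibar (g i)).
Proof. by apply: pO_le; apply: evI => i _; exact: Phibar_lip. Qed.

Lemma pO_Phibar_taylor I (c : ctx R I) (x t : I -> R) : ctx_ok c -> pO c 1 t ->
  pO c 2 (fun i => Phibar (x i + t i) - Phibar (x i) + phi (x i) * t i).
Proof.
move=> ok /(pO_sqr ok); apply: pO_le; apply: evI => i _.
by apply: (le_trans (Phibar_taylor _ _)); exact: ler_norm.
Qed.

Lemma bdd_phi I (c : ctx R I) (x : I -> R) : bdd c (fun i => phi (x i)).
Proof.
by exists 1; apply: evI => i _; rewrite ger0_norm ?phi_ge0// phi_le1.
Qed.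

Lemma bdd_Phibar I (c : ctx R I) (x : I -> R) : bdd c (fun i => Phibar (x i)).
Proof.
exists 1; apply: evI => i _.
by rewrite ger0_norm ?(ltW (Phibar_gt0 _))// ltW// Phibar_lt1.
Qed.

Lemma Phibar_lb I (c : ctx R I) (x : I -> R) : bdd c x ->
  exists e : R, 0 < e /\ ev c (fun i => e <= Phibar (x i)).
Proof.
move=> [C h]; exists (Phibar C); split; first exact: Phibar_gt0.
apply: (ev_mono h) => i _ hC; rewrite Phibar_le.
by apply: le_trans hC; exact: ler_norm.
Qed.

(** An instance together with a value of the Gaussian noise, truncated at ln n. Only the u-part of
    the noise enters the weight, so powers of the weight become the factors (1 + |z|)^q that
    [gauss_event] integrates. *)
Definition ext_ctx I m (c : ctx R I) : ctx R (I * pt R m) :=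
  Ctx (fun j => idx c j.1)
    (fun j => dom c j.1 /\
       (`|j.2.1| <= ln (idx c j.1)%:R /\ `|j.2.2| <= ln (idx c j.1)%:R))
    (fun j => wt c j.1 * (1 + `|j.2.1|)).

Section ext.
Context {I : Type} {m : nat} (c : ctx R I).
Hypothesis ok : ctx_ok c.

Lemma ok_ext : ctx_ok (ext_ctx m c).
Proof.
have [K [p [N h]]] := ok; have [N' h'] := @ln_large R 1.
exists (2 * `|K|), (p + 1)%N, (maxn N N') => -[i [z v]] /= [di [zl vl]].
rewrite geq_max => /andP[Ni Ni'].
have /andP[w1 wK] := h _ di Ni; have l1 := h' _ Ni'.
have z0 := normr_ge0 z.
apply/andP; split; first by rewrite -[leLHS]mulr1 ler_pM//; lra.
rewrite exprD expr1 [leRHS](_ : _ = (`|K| * ln (idx c i)%:R ^+ p) *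
  (2 * ln (idx c i)%:R)); last by ring.
apply: ler_pM; [lra|lra| |lra].
apply: (le_trans wK); rewrite ler_wpM2r ?ler_norm// exprn_ge0//; lra.
Qed.

Lemma ev_fst (P : I -> Prop) : ev c P -> ev (ext_ctx m c) (fun j => P j.1).
Proof. by apply: ev_comp => // j []. Qed.

Lemma ext_wt_ge : ev (ext_ctx m c) (fun j => wt c j.1 <= wt (ext_ctx m c) j).
Proof.
apply: (ev_mono (ev_fst (ctx_wt ok))) => -[i [z v]] _ /= w1.
by rewrite ler_peMr ?(le_trans _ w1)// lerDl.
Qed.

Lemma pO_fst k (f : I -> R) : pO c k f -> pO (ext_ctx m c) k (fun j => f j.1).
Proof.
apply: pO_comp => //; [by move=> j []|exact: ok_ext|].
exists 1, 1%N; split => //; apply: (ev2 ext_wt_ge (ev_fst (ctx_wt ok))).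
move=> j _ h w1; rewrite mul1r expr1 expr0 mulr1 ger0_norm//.
exact: le_trans w1.
Qed.

Lemma pO_incr : pO (ext_ctx m c) 0 (fun j => `|j.2.1|).
Proof.
exists 1, 1%N; split => //; apply: (ev_mono (ev_fst (ctx_wt ok))).
move=> -[i [z v]] _ /= w1; rewrite normr_id !mul1r expr1 expr0 mulr1.
have z0 := normr_ge0 z; nra.
Qed.

Lemma bdd_fst (f : I -> R) : bdd c f -> bdd (ext_ctx m c) (fun j => f j.1).
Proof. by move=> [C h]; exists C; exact: (ev_fst h). Qed.

(** This is [gauss_event] with L = ln n: the neglected tail e^(-(ln n)^2/2) is at most 1/n as soon
    as ln n >= 2. The hypothesis on E only has to hold eventually and within the truncation. *)
Lemma pO_event (t : R) (mu : I -> pt R m) (E : I -> set (pt R m)) (x : I -> R)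
    (l : I -> 'I_m -> R) (Q : I -> 'I_m -> 'I_m -> R) (e : I * pt R m -> R) :
  (forall i, measurable (E i)) ->
  (forall j, pO c 1 (fun i => l i j)) ->
  (forall j k, pO c 1 (fun i => Q i j k)) ->
  pO (ext_ctx m c) 2 e ->
  ev (ext_ctx m c) (fun j =>
    (x j.1 + quad (l j.1) (Q j.1) j.2.1 + e j < j.2.2 ->
       E j.1 (affine (Num.sqrt t) (mu j.1) j.2)) /\
    (j.2.2 < x j.1 + quad (l j.1) (Q j.1) j.2.1 - e j ->
       ~ E j.1 (affine (Num.sqrt t) (mu j.1) j.2))) ->
  pO c 2 (fun i => Pr t (mu i) (E i) - Phibar (x i + tr (Q i))).
Proof.
move=> mE hl hQ [Ce [q [Ce0 he]]] hE.
have [C [C0 hC]] := @gauss_event R m q.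
pose r i := \sum_j `|l i j| + \sum_j \sum_k `|Q i j k|.
have r0 i : 0 <= r i.
  by rewrite addr_ge0// sumr_ge0// => j _; rewrite sumr_ge0.
have hr : pO c 1 r.
  apply: pO_add => //; first by apply: pO_sum => // j; exact: pO_norm.
  by apply: pO_sum => // j; apply: pO_sum => // k; exact: pO_norm.
have lr i j : `|l i j| <= r i.
  rewrite /r (bigD1 j)//= -addrA lerDl addr_ge0// sumr_ge0// => k _.
  by rewrite sumr_ge0.
have Qr i j k : `|Q i j k| <= r i.
  rewrite /r addrC (bigD1 j)//= (bigD1 k)//= -!addrA lerDl.
  by rewrite !addr_ge0 ?sumr_ge0// => a _; rewrite sumr_ge0.
(* The added 1 keeps the error strictly positive, as [gauss_event] requires, even if Ce = 0. *)
pose A i := (Ce + 1) * wt c i ^+ q * rsqrt (idx c i) ^+ 2.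
have hA : pO c 2 A.
  exists (Ce + 1), q; split; first exact: addr_ge0.
  apply: (ev_mono (ctx_wt ok)) => i _ w1; rewrite ger0_norm//.
  by rewrite /A !mulr_ge0 ?addr_ge0 ?exprn_ge0 ?rsqrt_ge0// (le_trans _ w1).
pose tl i : R := expR (- (ln (idx c i)%:R ^+ 2 / 2)).
have htl : pO c 2 tl.
  have [N hN] := @ln_large R 2.
  exists 1, 0%N; split => //.
  apply: (ev_mono (ev_and (ev_large c N) (ev_large c 1))) => i _ [Ni n1].
  have l2 := hN _ Ni; have n0 : 0 < (idx c i)%:R :> R by rewrite ltr0n.
  rewrite expr0 !mul1r rsqrt_sqr ger0_norm ?expR_ge0//.
  rewrite -[in leRHS](lnK n0) -expRN ler_expR lerN2 expr2; nra.
have := pO_scale C ok (pO_add ok (pO_add ok (pO_sqr ok hr) hA) htl).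
apply: pO_le.
have [N1 h1] := he; have [N2 h2] := hE; have [N3 h3] := ctx_wt ok.
exists (maxn N1 (maxn N2 (maxn N3 1))) => i di.
rewrite !geq_max => /and4P[n1 n2 n3 n4].
have w1 := h3 _ di n3.
have n0 : 0 < (idx c i)%:R :> R by rewrite ltr0n.
have L0 : 0 <= ln (idx c i)%:R :> R by rewrite ln_ge0// ler1n.
have rs0 : 0 < rsqrt (idx c i) :> R by rewrite invr_gt0 sqrtr_gt0.
have w0 : 0 < wt c i by exact: lt_le_trans w1.
have A0 : 0 < A i by rewrite /A !mulr_gt0// ?exprn_gt0// ltr_wpDl.
rewrite PrE; apply: le_trans (ler_norm _).
apply: (hC (x i) (r i) (A i) (ln (idx c i)%:R) (l i) (Q i)) => //.
- by rewrite -[X in measurable X]setTI; exact: measurable_affine.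
- move=> z v zL vL hv.
  have dj : dom (ext_ctx m c) (i, (z, v)) by [].
  have [h4 _] := h2 _ dj n2; apply: h4 => /=; apply: le_lt_trans hv.
  have := h1 _ dj n1; rewrite /= => h5.
  rewrite lerD2l; apply: (le_trans (ler_norm _)); apply: (le_trans h5).
  rewrite /A exprMn [leRHS](_ : _ = (Ce + 1) * (wt c i ^+ q * (1 + `|z|) ^+ q) *
    rsqrt (idx c i) ^+ 2); last by ring.
  rewrite ler_wpM2r ?exprn_ge0 ?rsqrt_ge0// ler_wpM2r ?lerDl//.
  by rewrite mulr_ge0 ?exprn_ge0 ?addr_ge0 ?(ltW w0).
- move=> z v zL vL hv.
  have dj : dom (ext_ctx m c) (i, (z, v)) by [].
  have [_ h4] := h2 _ dj n2; apply: h4 => /=; apply: (lt_le_trans hv).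
  have := h1 _ dj n1; rewrite /= => h5.
  rewrite lerD2l lerN2; apply: (le_trans (ler_norm _)); apply: (le_trans h5).
  rewrite /A exprMn [leRHS](_ : _ = (Ce + 1) * (wt c i ^+ q * (1 + `|z|) ^+ q) *
    rsqrt (idx c i) ^+ 2); last by ring.
  rewrite ler_wpM2r ?exprn_ge0 ?rsqrt_ge0// ler_wpM2r ?lerDl//.
  by rewrite mulr_ge0 ?exprn_ge0 ?addr_ge0 ?(ltW w0).
Qed.

End ext.

(** The linear coefficients of the quadratic polynomial after recentring at a; as Q need not be
    symmetric, both Q j k and Q k j occur. *)
Definition shift_lin m (l : 'I_m -> R) (Q : 'I_m -> 'I_m -> R) (a : 'rV[R]_m)
  : 'I_m -> R := fun j => l j + \sum_k (Q j k + Q k j) * a 0 k.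

Lemma quad_shift m (l : 'I_m -> R) Q (a z : 'rV[R]_m) :
  quad l Q (a + z) = quad l Q a + quad (shift_lin l Q a) Q z.
Proof.
rewrite /quad /shift_lin.
under eq_bigr do rewrite mxE mulrDr.
rewrite big_split/=.
under [X in _ + X = _]eq_bigr => i _.
  under eq_bigr => j _.
    rewrite !mxE (_ : Q i j * ((a 0 i + z 0 i) * (a 0 j + z 0 j)) =
      (Q i j * (a 0 i * a 0 j) + Q i j * (z 0 i * z 0 j)) +
      (Q i j * a 0 j * z 0 i + Q i j * a 0 i * z 0 j)); last by ring.
    over.
  rewrite !big_split/=; over.
rewrite !big_split/=.
under [X in _ = _ + (X + _)]eq_bigr do rewrite mulrDl mulr_suml.
rewrite big_split/=.
under [X in _ = _ + (_ + X + _)]eq_bigr => i _.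
  under eq_bigr do rewrite !mulrDl; rewrite big_split/=; over.
rewrite big_split/=.
rewrite [X in _ + (_ + (_ + X)) = _]exchange_big/=.
set s1 := \sum_i l i * a 0 i; set s2 := \sum_i l i * z 0 i.
set s3 := \sum_i \sum_j Q i j * (a 0 i * a 0 j).
set s4 := \sum_i \sum_j Q i j * (z 0 i * z 0 j).
set s5 := \sum_i \sum_j Q i j * a 0 j * z 0 i.
by rewrite -!addrA; ring.
Qed.

Lemma quad_scale m (l : 'I_m -> R) Q (s : R) (z : 'rV[R]_m) :
  quad l Q (s *: z) = quad (fun i => s * l i) (fun i j => s ^+ 2 * Q i j) z.
Proof.
rewrite /quad; congr (_ + _); apply: eq_bigr => i _.
  by rewrite mxE; ring.
by apply: eq_bigr => j _; rewrite !mxE; ring.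
Qed.

Lemma quad_comb m (l l' : 'I_m -> R) Q Q' (s t : R) (z : 'rV[R]_m) :
  s * quad l Q z + t * quad l' Q' z =
  quad (fun i => s * l i + t * l' i) (fun i j => s * Q i j + t * Q' i j) z.
Proof.
rewrite /quad !mulrDr addrACA; congr (_ + _).
  by rewrite !mulr_sumr -big_split/=; apply: eq_bigr => i _; ring.
rewrite !mulr_sumr -big_split/=; apply: eq_bigr => i _.
by rewrite !mulr_sumr -big_split/=; apply: eq_bigr => j _; ring.
Qed.

Lemma tr_comb m Q Q' (s t : R) :
  @tr R m (fun i j => s * Q i j + t * Q' i j) = s * tr Q + t * tr Q'.
Proof. by rewrite /tr !mulr_sumr -big_split. Qed.

Section pO_quad.
Context {I : Type} {m : nat} (c : ctx R I).
Hypothesis ok : ctx_ok c.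
Variables (l : I -> 'I_m -> R) (Q : I -> 'I_m -> 'I_m -> R).
Hypothesis hl : forall j, pO c 1 (fun i => l i j).
Hypothesis hQ : forall j k, pO c 1 (fun i => Q i j k).

Lemma pO_coord k (a : I -> 'rV[R]_m) j : pO c k (fun i => `|a i|) ->
  pO c k (fun i => a i 0 j).
Proof.
by apply: pO_le; apply: evI => i _; rewrite normr_id; exact: row_coord_le.
Qed.

Lemma pO_quad_gen k (a : I -> 'rV[R]_m) : pO c k (fun i => `|a i|) ->
  pO c k.+1 (fun i => quad (l i) (Q i) (a i)).
Proof.
move=> ha; apply: pO_add => //.
  apply: pO_sum => // j; rewrite -add1n; apply: pO_mul => //; exact: pO_coord.
apply: pO_sum => // j; apply: pO_sum => // j'; rewrite -add1n.
apply: pO_mul => //.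
by apply: (pO_weak ok (leq_addr k k)); apply: pO_mul => //; exact: pO_coord.
Qed.

Lemma pO_shift_lin (a : I -> 'rV[R]_m) j : pO c 0 (fun i => `|a i|) ->
  pO c 1 (fun i => shift_lin (l i) (Q i) (a i) j).
Proof.
move=> ha; apply: pO_add => //; apply: pO_sum => // k.
apply: (@pO_ext _ _ _ _ (fun i => a i 0 k * (Q i j k + Q i k j))).
  by move=> i _; rewrite mulrC.
by apply: pO_mulr => //; [exact: pO_coord|exact: pO_add].
Qed.

End pO_quad.

End events.

(** * Nearly parallel surfaces *)

Section taylor.
Context {R : realType} {m : nat}.
Implicit Types (f h : 'rV[R]_m -> R) (u a : 'rV[R]_m).

Lemma is_derive_line f a u (t : R) : differentiable f (a + t *: u) ->
  is_derive t 1 (fun t => f (a + t *: u))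
    (\sum_i u 0 i * 'D_(delta_mx 0 i) f (a + t *: u)).
Proof.
move=> df.
have E : (fun h : R => h^-1 *: (f (a + (h *: (1 : R) + t) *: u) - f (a + t *: u))) =
         (fun h : R => h^-1 *: (f (h *: u + (a + t *: u)) - f (a + t *: u))).
  apply/funext => h; congr (_ *: (f _ - _)).
  have -> : h *: (1 : R) = h by exact: mulr1.
  by rewrite scalerDl addrCA.
have dv : derivable f (a + t *: u) u by exact: diff_derivable.
apply: DeriveDef; first by rewrite /derivable E.
rewrite {1}/derive E -/('D_u f (a + t *: u)) deriveE//.
transitivity ('d f (a + t *: u) (\sum_j u 0 j *: delta_mx 0 j)).
  by rewrite -row_sum_delta.
rewrite linear_sum; apply: eq_bigr => i _.
by rewrite linearZ deriveE.
Qed.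

Lemma is_derive_continuous (F dF : R -> R) (i : interval R) :
  (forall t : R, is_derive t 1 F (dF t)) -> {within [set` i], continuous F}.
Proof. by move=> h; apply: derivable_within_continuous => t _; case: (h t). Qed.

Lemma increment_le (F dF : R -> R) (A t : R) :
  (forall t : R, is_derive t 1 F (dF t)) ->
  (forall t, 0 <= t <= 1 -> `|dF t| <= A) ->
  0 <= t <= 1 -> `|F t - F 0| <= A.
Proof.
move=> hF hA /andP[t0 t1].
have [c] := @MVT_segment R F dF 0 t t0 (fun x _ => hF x) (is_derive_continuous hF).
rewrite in_itv/= => /andP[c0 ct] ->; rewrite subr0 normrM (ger0_norm t0).
have c1 : 0 <= c <= 1 by rewrite c0 (le_trans ct).
apply: (@le_trans _ _ (`|dF c| * 1)); first by rewrite ler_wpM2l.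
by rewrite mulr1 hA.
Qed.

(** The mean value bound on the unit interval is used three times, on F2, F1 and F, after
    subtracting the polynomial already accounted for; the constant A is merely carried along in
    place of A / 6. *)
Lemma taylor_order2 (F F1 F2 F3 : R -> R) (A : R) :
  (forall t : R, is_derive t 1 F (F1 t)) -> (forall t : R, is_derive t 1 F1 (F2 t)) ->
  (forall t : R, is_derive t 1 F2 (F3 t)) ->
  (forall t, 0 <= t <= 1 -> `|F3 t| <= A) ->
  `|F 1 - F 0 - F1 0 - F2 0 / 2| <= A.
Proof.
move=> d0 d1 d2 hA.
have b2 t : 0 <= t <= 1 -> `|F2 t - F2 0| <= A by exact: increment_le d2 hA.
have dlin c (t : R) : is_derive t 1 (fun t : R => t * c) c.
  rewrite (_ : (fun _ => _) = (c \*: (@idfun R))); last first.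
    by apply/funext => x /=; rewrite mulrC.
  rewrite -[X in is_derive _ _ _ X](mulr1 c); exact: is_deriveZ.
have dsq c (t : R) : is_derive t 1 (fun t : R => t ^+ 2 * (c / 2)) (t * c).
  rewrite (_ : (fun _ => _) = ((c / 2) \*: ((@idfun R) ^+ 2))); last first.
    by apply/funext => x /=; rewrite mulrC.
  rewrite (_ : t * c = (c / 2) *: ((2%:R * (@idfun R t) ^+ 1) *: 1)).
    by apply: is_deriveZ; apply: is_deriveX.
  by rewrite /GRing.scale/= mulr1 expr1; field.
have b1 t : 0 <= t <= 1 -> `|(F1 t - t * F2 0) - (F1 0 - 0 * F2 0)| <= A.
  apply: (@increment_le (fun t : R => F1 t - t * F2 0) (fun t => F2 t - F2 0)) => //.
have := @increment_le (fun t => F t - (t * F1 0) - (t ^+ 2 * (F2 0 / 2)))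
  (fun t => F1 t - F1 0 - t * F2 0) A 1.
have -> : F 1 - F 0 - F1 0 - F2 0 / 2 = (F 1 - 1 * F1 0 - 1 ^+ 2 * (F2 0 / 2)) -
  (F 0 - 0 * F1 0 - 0 ^+ 2 * (F2 0 / 2)) by rewrite expr1n expr0n /=; ring.
apply; last by rewrite ler01 lexx.
move=> t /b1; rewrite mul0r subr0.
by rewrite (_ : F1 t - t * F2 0 - F1 0 = F1 t - F1 0 - t * F2 0)//; ring.
Qed.

Lemma is_derive_line0 f u (t : R) : smooth f ->
  is_derive t 1 (fun t => f (t *: u))
    (\sum_i u 0 i * pderiv [:: i] f (t *: u)).
Proof.
move=> sf; have := @is_derive_line f 0 u t.
rewrite (_ : (fun t => f (0 + t *: u)) = (fun t => f (t *: u))); last first.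
  by apply/funext => s; rewrite add0r.
by rewrite add0r; apply; exact: (sf [::]).
Qed.

Lemma smooth_pderiv f J : smooth f -> smooth (pderiv J f).
Proof.
by move=> sf K u; have := sf (K ++ J) u; rewrite /pderiv foldr_cat.
Qed.

Lemma is_derive_sum_coef p (F dF : 'I_p -> R -> R) (b : 'I_p -> R) (t : R) :
  (forall i, is_derive t 1 (F i) (dF i t)) ->
  is_derive t 1 (fun t => \sum_i b i * F i t) (\sum_i b i * dF i t).
Proof.
move=> h; rewrite (_ : (fun _ => _) = \sum_i (b i \*: F i)); last first.
  by apply/funext => s; rewrite fct_sumE.
by apply: is_derive_sum => i _; apply: is_deriveZ.
Qed.

Lemma taylor_quad h u (A : R) : smooth h ->
  (forall i j k v, `|v| <= `|u| -> `|pderiv [:: i; j; k] h v| <= A) ->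
  `|h u - taylor0 h - quad (taylor1 h) (taylor2 h) u| <=
    m%:R ^+ 3 * (`|u| ^+ 3 * A).
Proof.
move=> sh hA.
pose F t := h (t *: u).
pose F1 t := \sum_j u 0 j * pderiv [:: j] h (t *: u).
pose F2 t := \sum_j u 0 j * \sum_i u 0 i * pderiv [:: i; j] h (t *: u).
pose F3 t := \sum_j u 0 j * \sum_i u 0 i * \sum_k u 0 k * pderiv [:: k; i; j] h (t *: u).
have d0 (t : R) : is_derive t 1 F (F1 t) by exact: is_derive_line0.
have d1 (t : R) : is_derive t 1 F1 (F2 t).
  apply: (@is_derive_sum_coef _ (fun j t => pderiv [:: j] h (t *: u))
    (fun j t => \sum_i u 0 i * pderiv [:: i; j] h (t *: u))) => j.
  exact: (is_derive_line0 _ _ (smooth_pderiv [:: j] sh)).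
have d2 (t : R) : is_derive t 1 F2 (F3 t).
  apply: (@is_derive_sum_coef _ (fun j t => \sum_i u 0 i * pderiv [:: i; j] h (t *: u))
    (fun j t => \sum_i u 0 i * \sum_k u 0 k * pderiv [:: k; i; j] h (t *: u))) => j.
  apply: (@is_derive_sum_coef _ (fun i t => pderiv [:: i; j] h (t *: u))
    (fun i t => \sum_k u 0 k * pderiv [:: k; i; j] h (t *: u))) => i.
  exact: (is_derive_line0 _ _ (smooth_pderiv [:: i; j] sh)).
have sumc (b : R) : \sum_(i < m) b = m%:R * b.
  by rewrite sumr_const card_ord mulr_natl.
have b3 t : 0 <= t <= 1 -> `|F3 t| <= m%:R ^+ 3 * (`|u| ^+ 3 * A).
  move=> /andP[t0 t1].
  have tu : `|t *: u| <= `|u|.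
    by rewrite normrZ (ger0_norm t0) ler_piMl.
  have -> : m%:R ^+ 3 * (`|u| ^+ 3 * A) =
     \sum_(j < m) `|u| * \sum_(i < m) `|u| * \sum_(k < m) `|u| * A.
    by rewrite !sumc; ring.
  do 3 (apply: (le_trans (ler_norm_sum _ _ _)); apply: ler_sum => ? _;
    rewrite normrM; apply: ler_pM => //; first exact: row_coord_le).
  exact: hA.
have := taylor_order2 d0 d1 d2 b3.
rewrite /F scale1r scale0r /F1 /F2 scale0r -/(taylor0 h).
rewrite (_ : h u - taylor0 h - quad _ _ u = h u - taylor0 h -
   \sum_j u 0 j * pderiv [:: j] h 0 -
   (\sum_j u 0 j * \sum_i u 0 i * pderiv [:: i; j] h 0) / 2)//.
rewrite /quad opprD addrA; congr (_ - _ - _).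
  by apply: eq_bigr => i _; rewrite mulrC.
rewrite exchange_big mulr_suml; apply: eq_bigr => j _ /=.
rewrite mulr_sumr mulr_suml; apply: eq_bigr => i _.
by rewrite /taylor2 /pderiv /=; ring.
Qed.

Lemma gradient_increment h u (B A : R) j : smooth h -> 0 <= A ->
  (forall i, `|taylor2 h i j| <= B) ->
  (forall i k v, `|v| <= `|u| -> `|pderiv [:: k; i; j] h v| <= A) ->
  `|pderiv [:: j] h u - taylor1 h j| <=
    m%:R * (`|u| * (2 * B + m%:R * (`|u| * A))).
Proof.
move=> sh A0 hB hA.
have sumc (b : R) : \sum_(i < m) b = m%:R * b.
  by rewrite sumr_const card_ord mulr_natl.
have b2 i t : 0 <= t <= 1 ->
    `|pderiv [:: i; j] h (t *: u)| <= 2 * B + m%:R * (`|u| * A).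
  move=> t01.
  have := @increment_le (fun t => pderiv [:: i; j] h (t *: u))
    (fun t => \sum_k u 0 k * pderiv [:: k; i; j] h (t *: u)) (m%:R * (`|u| * A)) t.
  have h1 (s : R) : is_derive s 1 (fun t : R => pderiv [:: i; j] h (t *: u))
     (\sum_k u 0 k * pderiv [:: k; i; j] h (s *: u)).
    exact: (is_derive_line0 _ _ (smooth_pderiv [:: i; j] sh)).
  move=> /(_ h1); rewrite scale0r.
  have h2 s : 0 <= s <= 1 -> `|\sum_k u 0 k * pderiv [:: k; i; j] h (s *: u)| <=
      m%:R * (`|u| * A).
    move=> /andP[s0 s1]; rewrite -sumc.
    apply: (le_trans (ler_norm_sum _ _ _)); apply: ler_sum => k _.
    rewrite normrM; apply: ler_pM => //; first exact: row_coord_le.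
    by apply: hA; rewrite normrZ (ger0_norm s0) ler_piMl.
  move=> /(_ h2 t01) h3.
  have h4 : `|pderiv [:: i; j] h 0| <= 2 * B.
    have := hB i; rewrite /taylor2 normrM (ger0_norm (_ : 0 <= 2^-1))//.
    by rewrite ler_pdivrMr// mulrC.
  rewrite -[X in `|X|](subrK (pderiv [:: i; j] h 0)).
  by apply: (le_trans (ler_normD _ _)); rewrite addrC; exact: lerD.
have := @increment_le (fun t => pderiv [:: j] h (t *: u))
    (fun t => \sum_i u 0 i * pderiv [:: i; j] h (t *: u))
    (m%:R * (`|u| * (2 * B + m%:R * (`|u| * A)))) 1.
rewrite scale1r scale0r; apply; last by rewrite ler01 lexx.
- by move=> s; exact: (is_derive_line0 _ _ (smooth_pderiv [:: j] sh)).
- move=> t t01; rewrite -sumc.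
  apply: (le_trans (ler_norm_sum _ _ _)); apply: ler_sum => k _.
  by rewrite normrM; apply: ler_pM => //; [exact: row_coord_le|exact: b2].
Qed.

Lemma smooth_continuous h : smooth h -> continuous h.
Proof. by move=> sh u; apply: differentiable_continuous; exact: (sh [::]). Qed.

End taylor.

Section nearly_parallel_expansions.
Context {R : realType}.

Lemma isOP (a f : nat -> R) : isO a f <->
  exists C, exists N, forall n, (N <= n)%N -> `|f n| <= C * `|a n|.
Proof.
rewrite /isO; split.
  move=> /eqO_exP[C C0 /near_inftyP[N hN]]; exists C, N => n Nn.
  exact: hN.
move=> [C [N hN]]; apply/eqO_exP; exists (`|C| + 1); first by rewrite ltr_wpDl.
apply/near_inftyP; exists N => n Nn.
apply: (le_trans (hN n Nn)); rewrite ler_wpM2r//.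
by rewrite (le_trans (ler_norm _))// lerDl.
Qed.

Lemma isO_bdd I (c : ctx R I) (f : nat -> R) :
  isO (fun=> 1) f -> bdd c (fun i => f (idx c i)).
Proof.
move=> /isOP[C [N h]]; exists C, N => i _ Ni.
by apply: (le_trans (h _ Ni)); rewrite normr1 mulr1.
Qed.

Lemma isO_pO I (c : ctx R I) (k : nat) (f : nat -> R) :
  isO (fun n => rsqrt n ^+ k) f -> pO c k (fun i => f (idx c i)).
Proof.
move=> /isOP[C [N h]]; exists `|C|, 0%N; split => //; exists N => i _ Ni.
apply: (le_trans (h _ Ni)); rewrite expr0 mulr1 ger0_norm ?exprn_ge0 ?rsqrt_ge0//.
by rewrite ler_wpM2r ?exprn_ge0 ?rsqrt_ge0 ?ler_norm.
Qed.

(* The sup over the ball of radius |x i| is needed for Taylor remainders. *)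
Lemma locO_ev (V : normedZmodType R) I (c : ctx R I) k (f : nat -> V -> R)
    (x : I -> V) : ctx_ok c -> pO c 0 (fun i => `|x i|) ->
  locO (fun n => rsqrt n ^+ k) f ->
  exists (C : R) (q : nat), 0 <= C /\ ev c (fun i =>
    forall v, `|v| <= `|x i| ->
      `|f (idx c i) v| <= C * (1 + `|x i|) ^+ q * rsqrt (idx c i) ^+ k).
Proof.
move=> ok hx [c0 [C [q [c00 /near_inftyP[N h]]]]].
exists `|C|, q; split => //.
have hx1 : pO c 1 (fun i => `|x i| * rsqrt (idx c i)).
  have := pO_mul ok hx (pO_rsqrt c 1); apply: pO_ext => i _; by rewrite expr1.
have := pO_small ok hx1 c00; move=> hs.
apply: (ev_mono (ev_and hs (ev_and (ev_large c N) (ev_large c 1)))).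
move=> i _ [h1 [Ni n1]] v vx.
have s0 : 0 < Num.sqrt (idx c i)%:R :> R by rewrite sqrtr_gt0 ltr0n.
have h2 : `|v| <= c0 * Num.sqrt (idx c i)%:R.
  apply: (le_trans vx); rewrite -ler_pdivrMr//.
  by apply: le_trans h1; exact: ler_norm.
apply: (le_trans (h _ Ni v h2)).
rewrite ler_wpM2r ?exprn_ge0 ?rsqrt_ge0//.
apply: (@le_trans _ _ (`|C| * (1 + `|v|) ^+ q)).
  by rewrite ler_wpM2r ?exprn_ge0 ?addr_ge0 ?ler_norm.
by rewrite ler_wpM2l// lerXn2r ?nnegrE ?addr_ge0// lerD2l.
Qed.

Lemma locO_pO (V : normedZmodType R) I (c : ctx R I) k (f : nat -> V -> R)
    (x : I -> V) : ctx_ok c -> pO c 0 (fun i => `|x i|) ->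
  locO (fun n => rsqrt n ^+ k) f -> pO c k (fun i => f (idx c i) (x i)).
Proof.
move=> ok hx /(locO_ev ok hx)[C [q [C0 h]]].
have h1 : pO c 0 (fun i => (1 + `|x i|) ^+ q).
  by apply: pO_exp0 => //; apply: pO_add => //; exact: pO_cst.
have := pO_mulr ok (pO_scale C ok h1) (pO_rsqrt c k).
apply: pO_le; apply: (ev_mono h) => i _ /(_ (x i) (lexx _)) h2.
by apply: (le_trans h2); exact: ler_norm.
Qed.

Section expansions.
Context {I : Type} {m : nat} (c : ctx R I).
Hypothesis ok : ctx_ok c.
Variable h : nat -> 'rV[R]_m -> R.
Hypothesis hp : nearly_parallel h.

Definition lin0 (i : I) := taylor1 (h (idx c i)).
Definition quad0 (i : I) := taylor2 (h (idx c i)).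
Definition tr0 (i : I) := taylor2_tr (h (idx c i)).

Lemma np_smooth n : smooth (h n). Proof. by case: hp. Qed.

Lemma np_bdd0 : bdd c (fun i => taylor0 (h (idx c i))).
Proof. by case: hp => _ h0 _ _ _; exact: isO_bdd h0. Qed.

Lemma np_pO1 j : pO c 1 (fun i => lin0 i j).
Proof.
by case: hp => _ _ h1 _ _; apply: (isO_pO c (k := 1) (f := fun n => taylor1 (h n) j)).
Qed.

Lemma np_pO2 j k : pO c 1 (fun i => quad0 i j k).
Proof.
by case: hp => _ _ _ h2 _; apply: (isO_pO c (k := 1) (f := fun n => taylor2 (h n) j k)).
Qed.

Lemma np_pOtr : pO c 1 tr0.
Proof. by apply: pO_sum => // j; exact: np_pO2. Qed.

(** [locO] gives separate constants for each multi-index; summing the bounds over all triples yields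
    a single one. It holds on the whole ball because a Taylor remainder visits the segment from 0 to
    the point. *)
Lemma np_third (u : I -> 'rV[R]_m) : pO c 0 (fun i => `|u i|) ->
  exists A : I -> R, [/\ pO c 2 A, forall i, 0 <= A i & ev c (fun i =>
    forall j k l v, `|v| <= `|u i| -> `|pderiv [:: j; k; l] (h (idx c i)) v| <= A i)].
Proof.
move=> hu; have [_ _ _ _ h3] := hp.
have hB j k l : exists B : I -> R, [/\ pO c 2 B, forall i, 0 <= B i & ev c (fun i =>
    forall v, `|v| <= `|u i| -> `|pderiv [:: j; k; l] (h (idx c i)) v| <= B i)].
  have /(locO_ev ok hu)[C [q [C0 hC]]] := h3 [:: j; k; l] isT.
  exists (fun i => C * (1 + `|u i|) ^+ q * rsqrt (idx c i) ^+ 2); split => //.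
    have h1 : pO c 0 (fun i => (1 + `|u i|) ^+ q).
      by apply: pO_exp0 => //; apply: pO_add => //; exact: pO_cst.
    exact: pO_mulr ok (pO_scale C ok h1) (pO_rsqrt c 2).
  by move=> i; rewrite !mulr_ge0 ?exprn_ge0 ?rsqrt_ge0 ?addr_ge0.
have {}hB t : exists B : I -> R, [/\ pO c 2 B, forall i, 0 <= B i & ev c (fun i =>
    forall v, `|v| <= `|u i| -> `|pderiv [:: t.1.1; t.1.2; t.2] (h (idx c i)) v| <= B i)].
  exact: (hB t.1.1 t.1.2 t.2).
have [B hB'] := choice hB.
exists (fun i => \sum_j \sum_k \sum_l B (j, k, l) i); split.
- apply: pO_sum => // j; apply: pO_sum => // k; apply: pO_sum => // l.
  by case: (hB' (j, k, l)).
- move=> i; do 3 (apply: sumr_ge0 => ? _).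
  by match goal with |- context [B ?t] => case: (hB' t) end.
- apply: ev_forall => j; apply: ev_forall => k; apply: ev_forall => l.
  have B0 t i : 0 <= B t i by case: (hB' t).
  have [_ _ hh] := hB' (j, k, l); apply: (ev_mono hh) => i _ hv v /hv {}hv.
  apply: (le_trans hv); rewrite (bigD1 j)//= (bigD1 k)//= (bigD1 l)//=.
  rewrite -!addrA lerDl !addr_ge0//; by do 3 ?(apply: sumr_ge0 => ? _).
Qed.

Lemma np_taylor (u : I -> 'rV[R]_m) : pO c 0 (fun i => `|u i|) ->
  pO c 2 (fun i => h (idx c i) (u i) - taylor0 (h (idx c i)) -
    quad (lin0 i) (quad0 i) (u i)).
Proof.
move=> hu; have [A [hA A0 h3]] := np_third hu.
have := pO_scale (m%:R ^+ 3) ok (pO_mulr ok (pO_exp0 3 ok hu) hA).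
apply: pO_le; apply: (ev_mono h3) => i _ hi.
apply: le_trans (ler_norm _); apply: taylor_quad; first exact: np_smooth.
by move=> j k l v; exact: hi.
Qed.

Lemma np_grad (u : I -> 'rV[R]_m) j : pO c 1 (fun i => `|u i|) ->
  pO c 2 (fun i => pderiv [:: j] (h (idx c i)) (u i) - lin0 i j).
Proof.
move=> hu; have hu0 := pO_weak ok (leq0n 1) hu.
have [A [hA A0 h3]] := np_third hu0.
pose B i := \sum_k `|quad0 i k j|.
have hB : pO c 1 B by apply: pO_sum => // k; apply/pO_norm/np_pO2.
have h4 : pO c 1 (fun i => 2 * B i + m%:R * (`|u i| * A i)).
  apply: pO_add => //; first exact: pO_scale.
  by apply: pO_scale => //; apply: pO_mulr => //; exact: pO_weak hA.
have := pO_scale m%:R ok (pO_mul11 ok hu h4).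
apply: pO_le; apply: (ev_mono h3) => i _ hi.
apply: le_trans (ler_norm _); apply: gradient_increment => //.
- exact: np_smooth.
- by move=> k; rewrite /B (bigD1 k)//= lerDl sumr_ge0.
- by move=> k l v; exact: hi.
Qed.

Lemma np_quad k (u : I -> 'rV[R]_m) : pO c k (fun i => `|u i|) ->
  pO c k.+1 (fun i => quad (lin0 i) (quad0 i) (u i)).
Proof. by apply: pO_quad_gen => // *; [exact: np_pO1|exact: np_pO2]. Qed.

Lemma np_near0 (u : I -> 'rV[R]_m) : pO c 0 (fun i => `|u i|) ->
  pO c 1 (fun i => h (idx c i) (u i) - taylor0 (h (idx c i))).
Proof.
move=> hu; have := pO_add ok (pO_weak ok (ltnW (ltnSn 1)) (np_taylor hu)) (np_quad hu).
by apply: pO_ext => i _; rewrite subrK.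
Qed.

(** Displacement and coefficients are both O(n^(-1/2)), so the quadratic part is O(n^-1) too and h
    may be replaced by its constant term. *)
Lemma np_near0' (u : I -> 'rV[R]_m) : pO c 1 (fun i => `|u i|) ->
  pO c 2 (fun i => h (idx c i) (u i) - taylor0 (h (idx c i))).
Proof.
move=> hu; have := pO_add ok (np_taylor (pO_weak ok (leq0n 1) hu)) (np_quad hu).
by apply: pO_ext => i _; rewrite subrK.
Qed.

Lemma np_bdd (u : I -> 'rV[R]_m) : pO c 0 (fun i => `|u i|) ->
  bdd c (fun i => h (idx c i) (u i)).
Proof.
move=> hu; have := bdd_add (pO_bdd ok (np_near0 hu)) np_bdd0.
by apply: bdd_ext => i _; rewrite subrK.
Qed.

Lemma np_shift_lin (a : I -> 'rV[R]_m) j : pO c 0 (fun i => `|a i|) ->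
  pO c 1 (fun i => shift_lin (lin0 i) (quad0 i) (a i) j).
Proof. by apply: pO_shift_lin => // *; [exact: np_pO1|exact: np_pO2]. Qed.

Lemma np_shift (a z : I -> 'rV[R]_m) :
  pO c 0 (fun i => `|a i|) -> pO c 0 (fun i => `|z i|) ->
  pO c 2 (fun i => h (idx c i) (a i + z i) - h (idx c i) (a i) -
    quad (shift_lin (lin0 i) (quad0 i) (a i)) (quad0 i) (z i)).
Proof.
move=> ha hz.
have haz : pO c 0 (fun i => `|a i + z i|).
  apply: pO_le (pO_add ok ha hz); apply: evI => i _; rewrite normr_id.
  by apply: (le_trans (ler_normD _ _)); exact: ler_norm.
have := pO_sub ok (np_taylor haz) (np_taylor ha).
by apply: pO_ext => i _; rewrite quad_shift; ring.
Qed.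

(** Coefficients O(n^(-1/2)) times a displacement O(n^(-1/2)) give O(n^-1): this is why an error of
    order n^(-1/2) in the u-coordinates of the projection is harmless. *)
Lemma np_close (a b : I -> 'rV[R]_m) :
  pO c 0 (fun i => `|a i|) -> pO c 1 (fun i => `|b i - a i|) ->
  pO c 2 (fun i => h (idx c i) (b i) - h (idx c i) (a i)).
Proof.
move=> ha hz; have h1 := np_shift ha (pO_weak ok (leq0n 1) hz).
have h2 : pO c 2 (fun i => quad (shift_lin (lin0 i) (quad0 i) (a i)) (quad0 i) (b i - a i)).
  by apply: pO_quad_gen => // *; [exact: np_shift_lin|exact: np_pO2].
have := pO_add ok h1 h2.
by apply: pO_ext => i _; rewrite subrK [X in h _ X - _]addrC subrK.
Qed.

End expansions.
End nearly_parallel_expansions.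

(** * Bootstrap probabilities and p-values of one region *)

Section probabilities_of_regions.
Context {R : realType}.

Section Pr_facts.
Context {m : nat} (t : R) (mu : pt R m).
Implicit Types D E : set (pt R m).

Let mpre D : measurable D -> measurable (affine (Num.sqrt t) mu @^-1` D).
Proof. by move=> mD; rewrite -[X in measurable X]setTI; exact: measurable_affine. Qed.

Lemma Pr_setC D : measurable D -> Pr t mu (~` D) = 1 - Pr t mu D.
Proof. by move=> mD; rewrite (PrE t mu D) PrE preimage_setC; exact: prob_fine_setC (mpre mD). Qed.

Lemma Pr_ge0 D : 0 <= Pr t mu D.
Proof. by rewrite PrE; exact: prob_fine_ge0. Qed.

Lemma Pr_le1 D : measurable D -> Pr t mu D <= 1.
Proof. by move=> /mpre mD; rewrite PrE; exact: prob_fine_le1. Qed.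

Lemma Pr_le D E : measurable D -> measurable E -> D `<=` E ->
  Pr t mu D <= Pr t mu E.
Proof.
move=> mD mE DE; rewrite !PrE; apply: prob_fine_le; [exact: mpre..|].
exact: preimage_subset.
Qed.

End Pr_facts.

Lemma quad_div m (l : 'I_m -> R) Q (s : R) (z : 'rV[R]_m) : s != 0 ->
  quad (fun j => - l j) (fun j k => - (s * Q j k)) z = - quad l Q (s *: z) / s.
Proof.
move=> s0; rewrite quad_scale mulrC /quad mulrN mulrDr opprD; congr (_ + _).
  rewrite mulr_sumr -sumrN; apply: eq_bigr => j _.
  by field.
rewrite mulr_sumr -sumrN; apply: eq_bigr => j _.
rewrite mulr_sumr -sumrN; apply: eq_bigr => k _.
by field.
Qed.

Section one_surface.
Context {I : Type} {m : nat} (c : ctx R I).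
Hypothesis ok : ctx_ok c.
Variable h : nat -> 'rV[R]_m -> R.
Hypothesis hp : nearly_parallel h.
Local Notation H i := (region (h (idx c i))).
Local Notation trh := (tr0 c h).

Lemma np_measurable n : measurable (region (h n)).
Proof. exact: measurable_region (smooth_continuous (np_smooth hp n)). Qed.

(** The complement of H is an upper event for the standardized noise. With s = [Num.sqrt t], scaling
    multiplies the quadratic coefficients by s^2 and solving for the noise in v divides them by s,
    which leaves the trace s h_ii; symmetry of the tail returns to H. *)
Lemma Pr_region (t : R) (y : I -> pt R m) : 0 < t ->
  pO c 0 (fun i => `|(y i).1|) ->
  pO c 2 (fun i => Pr t (y i) (H i) - Phibar
    (((y i).2 + h (idx c i) (y i).1) / Num.sqrt t + Num.sqrt t * trh i)).
Proof.
move=> t0 hy; set s := Num.sqrt t.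
have s0 : 0 < s by rewrite sqrtr_gt0.
have sn0 : s != 0 by rewrite gt_eqF.
pose a i := (y i).1.
pose l i := shift_lin (lin0 c h i) (quad0 c h i) (a i).
pose x i := - (((y i).2 + h (idx c i) (a i)) / s).
pose c' := ext_ctx m c.
have ok' : ctx_ok c' by exact: ok_ext.
pose e (j : I * pt R m) := `|h (idx c j.1) (a j.1 + s *: j.2.1) -
   h (idx c j.1) (a j.1) - quad (l j.1) (quad0 c h j.1) (s *: j.2.1)| / s.
have he : pO c' 2 e.
  apply: (@pO_ext _ _ _ _ (fun j => s^-1 * (e j * s))).
    by move=> j _; rewrite mulrC mulfK.
  apply: pO_scale => //.
  apply: (@pO_ext _ _ _ _ (fun j => `|h (idx c j.1) (a j.1 + s *: j.2.1) -
   h (idx c j.1) (a j.1) - quad (l j.1) (quad0 c h j.1) (s *: j.2.1)|)).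
    by move=> j _; rewrite /e divfK.
  apply: pO_norm.
  apply: (np_shift ok' hp (a := fun j => a j.1) (z := fun j => s *: j.2.1)).
    exact: (pO_fst ok hy).
  apply: (@pO_ext _ _ _ _ (fun j => s * `|j.2.1|)).
    by move=> j _; rewrite normrZ gtr0_norm.
  by apply: pO_scale => //; exact: pO_incr.
have := @pO_event R I m c ok t y (fun i => ~` H i) x (fun i j => - l i j)
  (fun i j k => - (s * quad0 c h i j k)) e.
move=> /(_ (fun i => measurableC (np_measurable _))).
have hl j : pO c 1 (fun i => - l i j) by apply: pO_opp; exact: np_shift_lin.
have hQ j k : pO c 1 (fun i => - (s * quad0 c h i j k)).
  by apply/pO_opp/pO_scale => //; exact: np_pO2.
move=> /(_ hl hQ he).
have trE i : tr (fun j k => - (s * quad0 c h i j k)) = - (s * trh i).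
  rewrite /tr /tr0 /taylor2_tr mulr_sumr -sumrN; exact: eq_bigr.
have evE : ev c' (fun j =>
    (x j.1 + quad (fun k => - l j.1 k) (fun k k' => - (s * quad0 c h j.1 k k')) j.2.1 +
       e j < j.2.2 -> (~` H j.1) (affine s (y j.1) j.2)) /\
    (j.2.2 < x j.1 + quad (fun k => - l j.1 k) (fun k k' => - (s * quad0 c h j.1 k k')) j.2.1 -
       e j -> ~ (~` H j.1) (affine s (y j.1) j.2))).
  apply: evI => -[i [z v]] _ /=; rewrite quad_div//.
  rewrite /region /affine /= -/(a i).
  rewrite /x /e /=; set q := quad _ _ _; set ha := h _ (a i).
  set hz := h _ (a i + _).
  have -> : - (((y i).2 + ha) / s) + - q / s + `|hz - ha - q| / s =
    (- ((y i).2 + ha) - q + `|hz - ha - q|) / s by field.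
  have -> : - (((y i).2 + ha) / s) + - q / s - `|hz - ha - q| / s =
    (- ((y i).2 + ha) - q - `|hz - ha - q|) / s by field.
  rewrite ltr_pdivrMr// ltr_pdivlMr// mulrC.
  have := ler_norm (hz - ha - q); have := ler_normr (hz - ha - q) (hz - ha - q).
  have := ler_norm (- (hz - ha - q)); rewrite normrN.
  set n := `|_| => n1 _ n2; split => hv.
    by apply/negP; rewrite -ltNge; lra.
  by move=> /negP; rewrite -ltNge; lra.
move=> /(_ evE); apply: pO_le; apply: evI => i _.
rewrite le_eqVlt; apply/orP; left; apply/eqP.
rewrite trE Pr_setC; last exact: np_measurable.
have -> : x i + - (s * trh i) = - (((y i).2 + h (idx c i) (y i).1) / s + s * trh i).
  by rewrite /x opprD.
by rewrite PhibarN -normrN; congr `|_|; ring.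
Qed.

(** Multiplication by [Num.sqrt t] turns the argument found in [Pr_region] into an affine function
    of t. Bounded height keeps that argument where [Phibar_inv] is Lipschitz. *)
Lemma psi_pos_near (t : R) (y : I -> pt R m) : 0 < t ->
  pO c 0 (fun i => `|(y i).1|) ->
  bdd c (fun i => (y i).2 + h (idx c i) (y i).1) ->
  pO c 2 (fun i => psi_pos (H i) (y i) t -
    ((y i).2 + h (idx c i) (y i).1 + t * trh i)).
Proof.
move=> t0 hy hb; have hP := Pr_region t0 hy.
have s0 : 0 < Num.sqrt t by rewrite sqrtr_gt0.
set s := Num.sqrt t in s0 hP *.
pose x i := ((y i).2 + h (idx c i) (y i).1) / s + s * trh i.
have [B hB] : bdd c x.
  apply: bdd_add; first by apply: bdd_mul => //; exact: bdd_cst.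
  by apply: bdd_mul; [exact: bdd_cst|exact: (pO_bdd ok (np_pOtr ok hp))].
have [C [e [C0 e0 hC]]] := @Phibar_inv_lip R B.
have := pO_scale (s * C) ok (pO_norm hP).
apply: pO_le; apply: (ev2 hB (pO_small ok hP e0)) => i _ xB pe.
have := hC (x i) _ xB pe => h1.
have -> : psi_pos (H i) (y i) t - ((y i).2 + h (idx c i) (y i).1 + t * trh i) =
  s * (Phibar_inv (Pr t (y i) (H i)) - x i).
  have -> : psi_pos (H i) (y i) t = s * Phibar_inv (Pr t (y i) (H i)) by [].
  have st : t = s * s by rewrite -expr2 sqr_sqrtr ?(ltW t0).
  by rewrite {2}st /x; field; exact: lt0r_neq0.
rewrite normrM (gtr0_norm s0) normrM (ger0_norm (_ : 0 <= s * C)); last first.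
  by rewrite mulr_ge0// ltW.
by rewrite normr_id -mulrA ler_wpM2l// ltW.
Qed.

Let arith1 (u1 u2 u3 T : R) : u1 <= u2 + u3 -> u3 <= T -> 1 - u2 <= 1 - u1 + T.
Proof. by lra. Qed.

Let arith2 (u1 u2 u3 T : R) : u2 <= u1 + u3 -> u3 <= T -> 1 - u1 - T <= 1 - u2.
Proof. by lra. Qed.

Let arith3 (p F F' T e : R) : p <= F + T -> T <= e -> e <= F' - F -> p <= F'.
Proof. by lra. Qed.

Let arith4 (p F F' T e : R) : F - T <= p -> T <= e -> e <= F - F' -> F' <= p.
Proof. by lra. Qed.

Let arith5 (b g C : R) : `|g| <= C -> - (b + g) <= C - b.
Proof. by rewrite ler_norml; lra. Qed.

Let arith6 (b g C : R) : `|g| <= C -> - (b + C) <= - (b + g).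
Proof. by rewrite ler_norml; lra. Qed.

Let arith7 (u v b s : R) : b - v - s <= u -> u <= b + v + s -> `|u - b| <= v + s.
Proof. by rewrite ler_norml; lra. Qed.

(* Tail form: [psi_pos] only needs to be within O(1) of the signed distance
   there, because large arguments decide the p-value by monotonicity. *)
Lemma gauss_lt_le p (s b C r : R) (G : 'rV[R]_p -> R) : 0 < s -> 0 <= r ->
  measurable_fun setT G -> (forall z, `|z| <= r -> `|G z| <= C) ->
  fine (gauss p [set y | b + s * y.2 <= - G y.1]) <=
    Phibar ((b - C) / s) + p%:R * (2 * expR (- (r ^+ 2 / 2))) /\
  Phibar ((b + C) / s) - p%:R * (2 * expR (- (r ^+ 2 / 2))) <=
    fine (gauss p [set y | b + s * y.2 <= - G y.1]).
Proof.
move=> s0 r0 mG hG.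
pose E := [set y : pt R p | (- (b + G y.1) / s) < y.2].
have mE : measurable E.
  apply: (@measurable_halfspace _ _ (fun z => - (b + G z) / s)).
  have m1 : measurable_fun setT (fun z => b + G z) by exact: measurable_funD.
  by apply: measurable_funM => //; exact: measurableT_comp.
have -> : [set y : pt R p | b + s * y.2 <= - G y.1] = ~` E.
  apply/seteqP; split => -[z v]; rewrite /E /= ltr_pdivrMr//.
    by move=> h1; apply/negP; rewrite -leNgt; lra.
  by move=> /negP; rewrite -leNgt; lra.
pose O := [set y : pt R p | r < `|y.1|].
have mO : measurable O by exact: measurable_fst_set (measurable_rV_norm_gt r).
have hO : fine (gauss p O) <= p%:R * (2 * expR (- (r ^+ 2 / 2))).
  rewrite (gauss_fst (A := [set z | r < `|z|])); last exact: measurable_rV_norm_gt.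
  exact: std_normal_tail.
have hc (a : R) : measurable [set y : pt R p | a < y.2] /\
    fine (gauss p [set y : pt R p | a < y.2]) = Phibar a.
  have e : [set y : pt R p | a < y.2] = [set y | `]a, +oo[%classic y.2].
    by apply/seteqP; split => y /=; rewrite in_itv/= andbT.
  have mI : measurable (`]a, +oo[%classic : set R) by [].
  split; first by rewrite e; exact: measurable_snd_set.
  by rewrite e gauss_snd// -PhibarE.
rewrite prob_fine_setC//; split.
- have [m1 e1] := hc ((C - b) / s).
  have -> : (b - C) / s = - ((C - b) / s) by field; exact: lt0r_neq0.
  rewrite PhibarN -e1.
  have : fine (gauss p [set y : pt R p | (C - b) / s < y.2]) <=
      fine (gauss p E) + fine (gauss p O).
    apply: le_trans (prob_fine_setU _ mE mO).
    apply: prob_fine_le => //; first exact: measurableU.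
    move=> [z v] /= hv; have [zr|zr] := ltP r `|z|; first by right.
    left; rewrite /E /=; apply: le_lt_trans hv; rewrite ler_pM2r ?invr_gt0//.
    exact: arith5 (hG z zr).
  by move=> h1; exact: arith1 h1 hO.
- have [m1 e1] := hc (- (b + C) / s).
  have -> : (b + C) / s = - (- (b + C) / s) by field; exact: lt0r_neq0.
  rewrite PhibarN -e1.
  have : fine (gauss p E) <=
      fine (gauss p [set y : pt R p | - (b + C) / s < y.2]) + fine (gauss p O).
    apply: le_trans (prob_fine_setU _ m1 mO).
    apply: prob_fine_le => //; first exact: measurableU.
    move=> [z v]; rewrite /E /= => hv; have [zr|zr] := ltP r `|z|; first by right.
    left; rewrite /=; apply: le_lt_trans hv; rewrite ler_pM2r ?invr_gt0//.
    exact: arith6 (hG z zr).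
  by move=> h1; exact: arith2 h1 hO.
Qed.

(** Over a unit interval contained in [-X, X] the density is at least its value at X. *)
Lemma Phibar_step (x : R) (X : R) : `|x| + 1 <= X ->
  normal_peak 1 * expR (- (X ^+ 2 / 2)) <= Phibar x - Phibar (x + 1) /\
  normal_peak 1 * expR (- (X ^+ 2 / 2)) <= Phibar (x - 1) - Phibar x.
Proof.
move=> hX.
have key a b : b = a + 1 -> `|a| <= X -> `|b| <= X ->
    normal_peak 1 * expR (- (X ^+ 2 / 2)) <= Phibar a - Phibar b.
  move=> -> aX bX.
  have := @Phibar_diff_ge R (normal_peak 1 * expR (- (X ^+ 2 / 2))) a (a + 1).
  rewrite [a + 1]addrC addrK mulr1; apply.
  - by rewrite lerDr.
  - by rewrite mulr_ge0 ?normal_peak_ge0 ?expR_ge0.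
  move=> z az; rewrite phiE ler_pM2l ?normal_peak_gt0 ?oner_neq0// ler_expR.
  have zX : `|z| <= X.
    by move: aX bX; rewrite !ler_norml; lra.
  have : z ^+ 2 <= X ^+ 2.
    by rewrite -(real_normK (num_real z)) lerXn2r ?nnegrE// (le_trans _ zX).
  by rewrite mulNr; lra.
have h1 : `|x + 1| <= X.
  by apply: le_trans hX; apply: (le_trans (ler_normD _ _)); rewrite normr1.
have h2 : `|x - 1| <= X.
  by apply: le_trans hX; apply: (le_trans (ler_normB _ _)); rewrite normr1.
by split; apply: key => //; lra.
Qed.

(** Far from the surface [Phibar_inv] has no uniform Lipschitz constant. Instead, h is bounded for
    noise below the radius r, and r is so large that the neglected tail is smaller than the change
    of [Phibar] over a unit step of its argument; the inverse is thus off by at most one unit beyond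
    the effect of h. *)
Lemma psi_pos_crude (t : R) (y : I -> pt R m) : 0 < t ->
  pO c 0 (fun i => `|(y i).1|) -> pO c 0 (fun i => (y i).2) ->
  bdd c (fun i => psi_pos (H i) (y i) t - (y i).2).
Proof.
move=> t0 hy hb; set s := Num.sqrt t.
have s0 : 0 < s by rewrite sqrtr_gt0.
pose L i : R := ln (idx c i)%:R.
pose r i := `|(y i).2| / s + L i.
pose c' := log_ctx c; have ok' : ctx_ok c' := ok_log ok.
(* Instances paired with a u-noise of norm at most r. As r is at most polylogarithmic, h stays
   bounded at all points so reached. *)
pose J := Ctx (fun j : I * 'rV[R]_m => idx c j.1)
  (fun j => dom c j.1 /\ `|j.2| <= r j.1) (fun j => wt c' j.1).
have domJ j : dom J j -> dom c' j.1 by case.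
have okJ : ctx_ok J.
  have [K [p h0]] := ok'; exists K, p.
  exact: (@ev_comp R _ _ c' J fst _ domJ (fun j => erefl) h0).
have wJ : pO J 0 (fun j => wt c' j.1).
  exists 1, 1%N; split => //.
  apply: (ev_mono (ctx_wt okJ)) => j _ /= w1.
  by rewrite mul1r expr1 expr0 mulr1 ger0_norm// (le_trans ler01).
have lift' k f : pO c' k f -> pO J k (fun j => f j.1) by exact: pO_comp.
have lift k f : pO c k f -> pO J k (fun j => f j.1).
  by move=> /(pO_log ok); exact: lift'.
have LJ : pO J 0 (fun j => L j.1) := lift' 0%N _ (pO_ln ok).
have [C1 hC1] : bdd J (fun j => h (idx c j.1) ((y j.1).1 + s *: j.2)).
  apply: (np_bdd okJ hp (u := fun j => (y j.1).1 + s *: j.2)).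
  have hz : pO J 0 (fun j => s * (`|(y j.1).2| / s + L j.1)).
    apply: pO_scale => //; apply: pO_add => //.
    apply: (@pO_ext _ _ _ _ (fun j => s^-1 * `|(y j.1).2|)).
      by move=> j _; rewrite mulrC.
    by apply: pO_scale => //; apply: pO_norm; exact: (lift 0%N (fun i => (y i).2)).
  apply: pO_le (pO_add okJ (lift 0%N _ hy) hz); apply: evI => -[i z] /= [_ zr].
  rewrite normr_id; apply: le_trans (ler_norm _).
  apply: (le_trans (ler_normD _ _)); rewrite lerD2l normrZ gtr0_norm//.
  by rewrite ler_wpM2l// ltW.
have {}hC1 : ev c (fun i => forall z, `|z| <= r i ->
    `|h (idx c i) ((y i).1 + s *: z)| <= C1).
  by have [N hN] := hC1; exists N => i di Ni z zr; exact: (hN (i, z) (conj di zr) Ni).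
pose P1 : R := normal_peak 1.
have P0 : 0 < P1 by exact: normal_peak_gt0 (oner_neq0 R).
(* Chosen so that r >= X + kap implies 2 m e^(-r^2/2) <= P1 e^(-X^2/2): since kap >= 1, P1
   e^(kap^2/2) >= P1 kap / 2 >= 2 m. *)
pose kap : R := 1 + 4 * m%:R / P1.
have q0 : 0 <= 4 * m%:R / P1 by rewrite mulr_ge0// ?mulr_ge0// invr_ge0 ltW.
have [N2 hN2] := @ln_large R (`|C1| / s + 1 + kap).
exists (`|C1| + s).
apply: (ev_mono (ev_and hC1 (ev_large c N2))) => i _ [hz /hN2 hl].
set b := (y i).2; set p := Pr t (y i) (H i).
have C1s : 0 <= `|C1| / s by rewrite divr_ge0// ltW.
have bs0 : 0 <= `|b| / s by rewrite divr_ge0// ltW.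
have L0 : 0 <= L i by apply: le_trans hl; rewrite /kap; lra.
have r0 : 0 <= r i by rewrite addr_ge0.
have mG : measurable_fun setT (fun z : 'rV[R]_m => h (idx c i) ((y i).1 + s *: z)).
  have ma : measurable_fun setT (fun z : 'rV[R]_m => (y i).1 + s *: z).
    apply: measurable_fun_rVP => k.
    rewrite (_ : (fun _ => _) = (fun z : 'rV[R]_m => (y i).1 0 k + s * z 0 k)).
      by apply: measurable_funD => //; apply: measurable_funM => //; exact: measurable_rV_coord.
    by apply/funext => z; rewrite !mxE.
  have mh := continuous_measurable_rV (smooth_continuous (np_smooth hp (idx c i))).
  exact: (measurableT_comp mh ma).
have hz' z : `|z| <= r i -> `|h (idx c i) ((y i).1 + s *: z)| <= `|C1|.
  by move=> /hz h1; apply: (le_trans h1); exact: ler_norm.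
have := gauss_lt_le b s0 r0 mG hz'.
set T := m%:R * _; set pp := fine _.
have -> : pp = p by [].
move=> [hup hlo].
pose X := `|b| / s + `|C1| / s + 1.
have hT : T <= P1 * expR (- (X ^+ 2 / 2)).
  have Xr : X + kap <= r i.
    rewrite /X /r -/b -(addrA (`|b| / s)) -(addrA (`|b| / s)) lerD2l.
    exact: hl.
  have X0 : 0 <= X by rewrite /X; lra.
  have k1 : 1 <= kap by rewrite /kap; lra.
  have : r i ^+ 2 / 2 >= X ^+ 2 / 2 + kap ^+ 2 / 2.
    have : (X + kap) ^+ 2 <= r i ^+ 2 by rewrite lerXn2r ?nnegrE//; lra.
    have : 0 <= X * kap by rewrite mulr_ge0//; lra.
    by rewrite sqrrD; lra.
  move=> hr; apply: (@le_trans _ _ (m%:R * (2 * (expR (- (X ^+ 2 / 2)) * expR (- (kap ^+ 2 / 2)))))).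
    rewrite /T -expRD ler_wpM2l// ler_wpM2l// ler_expR; lra.
  have eX := expR_gt0 (- (X ^+ 2 / 2)).
  rewrite mulrA mulrCA [leRHS]mulrC ler_wpM2l ?(ltW eX)//.
  have ek := expR_gt0 (kap ^+ 2 / 2).
  rewrite expRN ler_pdivrMr//.
  have h1 := expR_ge1Dx (kap ^+ 2 / 2).
  have h2 : P1 * (kap / 2) <= P1 * expR (kap ^+ 2 / 2).
    rewrite ler_wpM2l ?(ltW P0)//.
    have : kap * 1 <= kap * kap by rewrite ler_wpM2l//; lra.
    by rewrite expr2; lra.
  apply: le_trans h2.
  have -> : P1 * (kap / 2) = P1 / 2 + 2 * m%:R by rewrite /kap; field; exact: lt0r_neq0.
  by rewrite [leLHS]mulrC lerDr divr_ge0// ltW.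
have bX : forall d, `|d| <= `|C1| -> `|(b + d) / s| + 1 <= X.
  move=> d hd; rewrite normrM (gtr0_norm (_ : 0 < s^-1)) ?invr_gt0//.
  rewrite /X lerD2r -mulrDl ler_wpM2r ?invr_ge0 ?(ltW s0)//.
  by apply: (le_trans (ler_normD _ _)); rewrite lerD2l.
have [] := Phibar_step (bX (- `|C1|) (_ : _ <= _)); first by rewrite normrN normr_id.
have [] := Phibar_step (bX `|C1| (_ : _ <= _)); first by rewrite normr_id.
rewrite -/P1 => a1 _ _ a2.
have p1 : p <= Phibar ((b - `|C1|) / s - 1) by exact: arith3 hup hT a2.
have p2 : Phibar ((b + `|C1|) / s + 1) <= p by exact: arith4 hlo hT a1.
have p01 : 0 < p < 1.
  by rewrite (lt_le_trans (Phibar_gt0 _) p2) (le_lt_trans p1 (Phibar_lt1 _)).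
have -> : psi_pos (H i) (y i) t = s * Phibar_inv p by [].
move: p1 p2; have [x <-] := Phibar_onto p01.
rewrite Phibar_invK !Phibar_le => p1 p2.
have s1 : s * ((b - `|C1|) / s - 1) <= s * x by rewrite ler_wpM2l// ltW.
have s2 : s * x <= s * ((b + `|C1|) / s + 1) by rewrite ler_wpM2l// ltW.
have e1 : s * ((b - `|C1|) / s - 1) = b - `|C1| - s by field; exact: lt0r_neq0.
have e2 : s * ((b + `|C1|) / s + 1) = b + `|C1| + s by field; exact: lt0r_neq0.
rewrite e1 in s1; rewrite e2 in s2.
exact: arith7 s1 s2.
Qed.

End one_surface.
End probabilities_of_regions.

Section pvalue_expansions.
Context {R : realType} {I : Type} {m : nat} (c : ctx R I).
Hypothesis ok : ctx_ok c.
Variable h : nat -> 'rV[R]_m -> R.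
Hypothesis hp : nearly_parallel h.
Variables (grid : seq R) (w : R -> R).
Hypotheses (gs : (1 < size grid)%N) (gu : uniq grid)
  (g0 : forall t, t \in grid -> 0 < t) (w0 : forall t, t \in grid -> 0 < w t).
Local Notation H i := (region (h (idx c i))).
Local Notation trh := (tr0 c h).

(** At each positive node psi is affine in t up to O(n^-1), and the weights reproduce affine
    functions, so extrapolation yields the same expression at every [sigma2]. *)
Lemma psi_near sigma2 (y : I -> pt R m) :
  pO c 0 (fun i => `|(y i).1|) ->
  bdd c (fun i => (y i).2 + h (idx c i) (y i).1) ->
  pO c 2 (fun i => psi grid w sigma2 (H i) (y i) -
    ((y i).2 + h (idx c i) (y i).1 + sigma2 * trh i)).
Proof.
move=> hy hb; have [g [a [gp a1 a2 aE]]] := psi_weights sigma2 gs gu g0 w0.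
have : pO c 2 (fun i => \sum_(t <- g) a t * (psi_pos (H i) (y i) t -
    ((y i).2 + h (idx c i) (y i).1 + t * trh i))).
  apply: pO_sum_seq => // t tg; apply: pO_scale => //.
  exact: psi_pos_near (gp _ tg) hy hb.
apply: pO_ext => i _; rewrite aE.
set b := (y i).2 + _; rewrite -a2.
have -> : b + (\sum_(t <- g) a t * t) * trh i =
    \sum_(t <- g) a t * (b + t * trh i).
  under [RHS]eq_bigr do rewrite mulrDr mulrA.
  by rewrite big_split/= -!mulr_suml a1 mul1r.
by rewrite -sumrB; apply: eq_bigr => t _; rewrite mulrBr.
Qed.

Lemma psi_crude sigma2 (y : I -> pt R m) :
  pO c 0 (fun i => `|(y i).1|) -> pO c 0 (fun i => (y i).2) ->
  bdd c (fun i => psi grid w sigma2 (H i) (y i) - (y i).2).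
Proof.
move=> hy hb; have [g [a [gp a1 _ aE]]] := psi_weights sigma2 gs gu g0 w0.
have : bdd c (fun i => \sum_(t <- g) a t * (psi_pos (H i) (y i) t - (y i).2)).
  elim: g gp {a1 aE} => [|t g IH] gp.
    by exists 0; apply: evI => i _; rewrite big_nil normr0.
  have h1 : bdd c (fun i => a t * (psi_pos (H i) (y i) t - (y i).2)).
    apply: bdd_mul; first exact: bdd_cst.
    by apply: psi_pos_crude => //; apply: gp; rewrite mem_head.
  have gp' t' : t' \in g -> 0 < t' by move=> tg; apply: gp; rewrite in_cons tg orbT.
  have h2 := bdd_add h1 (IH gp').
  by apply: bdd_ext h2 => i _; rewrite big_cons.
apply: bdd_ext => i _; rewrite aE -[in RHS](mul1r (y i).2) -a1 mulr_suml -sumrB.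
by apply: eq_bigr => t _; rewrite mulrBr.
Qed.

Lemma pval_near sigma2 (y : I -> pt R m) :
  pO c 0 (fun i => `|(y i).1|) ->
  bdd c (fun i => (y i).2 + h (idx c i) (y i).1) ->
  pO c 2 (fun i => pval grid w sigma2 (H i) (y i) -
    Phibar ((y i).2 + h (idx c i) (y i).1 + sigma2 * trh i)).
Proof. by move=> hy hb; apply: pO_Phibar; exact: psi_near. Qed.

Lemma Pr_selection (mu : I -> pt R m) : pO c 0 (fun i => `|(mu i).1|) ->
  pO c 2 (fun i => Pr 1 (mu i) (~` H i) -
    Phibar (- ((mu i).2 + h (idx c i) (mu i).1 + trh i))).
Proof.
move=> hy; have := Pr_region ok hp ltr01 hy.
apply: pO_le; apply: evI => i _; rewrite sqrtr1 divr1 mul1r.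
rewrite Pr_setC; last exact: np_measurable.
set a := (_ + tr0 _ _ _); rewrite PhibarN.
by rewrite opprB addrC addrA subrK distrC.
Qed.

End pvalue_expansions.

(** * Boundary of a region and projection onto it *)

Section boundary_of_region.
Context {R : realType} {m : nat}.
Implicit Types (h : 'rV[R]_m -> R) (u : 'rV[R]_m) (y nu : pt R m).

Definition sqn u : R := \sum_(i < m) u 0 i ^+ 2.

Lemma sqn_ge u j : u 0 j ^+ 2 <= sqn u.
Proof.
by rewrite /sqn (bigD1 j)//= lerDl sumr_ge0// => i _; exact: sqr_ge0.
Qed.

Lemma sqr_norm_le_sqn u : `|u| ^+ 2 <= sqn u.
Proof.
have [->|[i ->]] := row_norm_witness u.
  by rewrite expr0n sumr_ge0// => i _; exact: sqr_ge0.
by rewrite real_normK ?num_real// sqn_ge.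
Qed.

Lemma continuous_height h : continuous h ->
  continuous (fun y : pt R m => y.2 + h y.1).
Proof.
move=> ch y; apply: cvgD; first exact: cvg_snd.
by apply: continuous_comp; [exact: cvg_fst|exact: ch].
Qed.

Lemma boundary_region h y : continuous h ->
  boundary (region h) y <-> y.2 = - h y.1.
Proof.
move=> ch; have cb := continuous_height ch.
have regE : region h = (fun y : pt R m => y.2 + h y.1) @^-1` [set x | x <= 0].
  by apply/seteqP; split => z; rewrite /region /= -lerBrDr sub0r.
split.
  move=> [cl nint].
  have cr : closed (region h).
    by rewrite regE; apply: preimage_closed; [move=> z _; exact: cb|exact: closed_le].
  have := (closure_id _).1 cr => e; rewrite -e in cl.
  apply/eqP; rewrite eq_le cl leNgt; apply/negP => lt; apply: nint.
  have op : open ((fun y : pt R m => y.2 + h y.1) @^-1` [set x | x < 0]).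
    by apply: open_comp; [move=> z _; exact: cb|exact: open_lt].
  apply: (filterS _ (open_nbhs_nbhs (conj op (_ : _ y)))).
    by move=> z /= /ltW; rewrite regE.
  by rewrite /= -ltrBrDr sub0r.
move=> e; split.
  by apply: subset_closure; rewrite /region /= e.
move=> /nbhs_ballP[eps /= e0 sub].
have : region h (y.1, y.2 + eps / 2).
  apply: sub; split => /=; first exact: ballxx.
  rewrite /ball/= opprD addrA subrr sub0r normrN gtr0_norm ?divr_gt0//.
  by rewrite gtr_pMr// invf_lt1// ltr1n.
rewrite /region /= e gerDl leNgt divr_gt0//.
Qed.

Lemma proj_min h y nu : continuous h -> is_proj (region h) y nu ->
  nu.2 = - h nu.1 /\ forall u,
    sqn (nu.1 - y.1) + (y.2 + h nu.1) ^+ 2 <= sqn (u - y.1) + (y.2 + h u) ^+ 2.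
Proof.
move=> ch [/(boundary_region _ ch) bnu hmin]; split => // u.
have key (v : 'rV[R]_m) : sqn (v - y.1) + (y.2 + h v) ^+ 2 =
    \sum_(i < m) (y - (v, - h v)).1 0 i ^+ 2 + (y - (v, - h v)).2 ^+ 2.
  rewrite /= opprK; congr (_ + _); apply: eq_bigr => i _.
  by rewrite !mxE -sqrrN opprB.
have bu : boundary (region h) (u, - h u) by apply/boundary_region.
rewrite !key; have -> : (nu.1, - h nu.1) = nu by rewrite -bnu; case: (nu).
have := hmin _ bu; rewrite /enorm ler_sqrt//.
by rewrite addr_ge0 ?sqr_ge0// sumr_ge0// => i _; exact: sqr_ge0.
Qed.

Lemma proj_stationary h y nu j : smooth h -> is_proj (region h) y nu ->
  nu.1 0 j - y.1 0 j + (y.2 + h nu.1) * pderiv [:: j] h nu.1 = 0.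
Proof.
move=> sh pr; have ch := smooth_continuous sh.
have [_ hmin] := proj_min ch pr.
pose e : 'rV[R]_m := delta_mx 0 j.
pose a := nu.1 - y.1.
pose G t := h (nu.1 + t *: e).
have dG (t : R) : is_derive t 1 G (pderiv [:: j] h (nu.1 + t *: e)).
  have := is_derive_line (u := e) (sh [::] (nu.1 + t *: e)).
  rewrite (bigD1 j)//= big1 ?addr0; last first.
    by move=> i ij; rewrite /e mxE eqxx (negbTE ij) mul0r.
  by rewrite /e mxE !eqxx mul1r.
(* The squared distance from y to the surface point over nu.1 + t e, without the constant [sqn a];
   it is minimal at t = 0, so its derivative vanishes there. *)
pose F := (2 * a 0 j) \*: (@idfun R) + (@idfun R) ^+ 2 + (cst y.2 + G) ^+ 2.
have dF (t : R) : is_derive t 1 F ((2 * a 0 j) *: 1 + (2%:R * t ^+ 1) *: 1 +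
    (2%:R * (y.2 + G t) ^+ 1) *: (0 + pderiv [:: j] h (nu.1 + t *: e))).
  apply: is_deriveD; apply: is_deriveX; exact: is_deriveD.
have FE t : F t = 2 * a 0 j * t + t ^+ 2 + (y.2 + G t) ^+ 2 by [].
have Fmin t : F 0 <= F t.
  have := hmin (nu.1 + t *: e).
  rewrite addrAC -/a !FE mulr0 expr0n/= addr0 add0r /G scale0r addr0.
  have -> : sqn (a + t *: e) = sqn a + (2 * a 0 j * t + t ^+ 2).
    rewrite /sqn (bigD1 j)//= [in RHS](bigD1 j)//= !mxE !eqxx/=.
    rewrite [X in _ + X = _](eq_bigr (fun i => a 0 i ^+ 2)); first by ring.
    by move=> i ij; rewrite !mxE (negbTE ij) andbF mulr0 addr0.
  by rewrite -addrA lerD2l.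
have i0 : (0 : R) \in `](-1), 1[ by rewrite in_itv/= ltrN10 ltr01.
have H : is_derive (0 : R) 1 F 0.
  apply: (@derive1_at_min R F (-1) 1 0 _ _ i0).
  - by rewrite (le_trans _ ler01)// lerN10.
  - by move=> t _; case: (dF t).
  - by move=> t _; exact: Fmin.
have [_ e1] := dF 0; have [_] := H.
rewrite e1 /G scale0r addr0 add0r !expr1 mulr0 /GRing.scale/= => e2.
by rewrite /a !mxE in e2; lra.
Qed.

End boundary_of_region.

Section projections.
Context {R : realType} {I : Type} {m : nat} (c : ctx R I).
Hypothesis ok : ctx_ok c.
Variable h : nat -> 'rV[R]_m -> R.
Hypothesis hp : nearly_parallel h.

Lemma pO_sqrt k (f : I -> R) : pO c (k + k) (fun i => f i ^+ 2) -> pO c k f.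
Proof.
move=> [C [q [C0 hC]]]; exists (C + 1), q; split; first exact: addr_ge0.
apply: (ev2 hC (ctx_wt ok)) => i _ h1 w1.
have W1 : 1 <= wt c i ^+ q by rewrite exprn_ege1.
have r0 : 0 <= rsqrt (idx c i) ^+ k :> R by rewrite exprn_ge0// rsqrt_ge0.
have W0 : 0 <= wt c i ^+ q by exact: le_trans W1.
have C10 : 0 <= C + 1 by exact: addr_ge0.
rewrite -(@ler_pXn2r _ 2) ?nnegrE ?normr_ge0 ?mulr_ge0//.
rewrite -normrX; apply: (le_trans h1); rewrite exprD !exprMn -expr2.
rewrite ler_wpM2r ?sqr_ge0//.
set W := wt c i ^+ q in W1 W0 *.
have : C * W <= (C + 1) ^+ 2 * W by rewrite ler_wpM2r// sqrrD expr1n; nra.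
move/le_trans; apply; rewrite ler_wpM2l ?sqr_ge0// expr2 ler_peMr//.
Qed.

(** With B = |b|, expanding the square gives d^2 <= 2 B e + 2 B L d + 2 B L d^2. Here 2 B L d <= d^2
    / 4 + 4 (B L)^2, and B L <= 1/4 bounds the last term by d^2 / 2; the remaining d^2 / 4 explains
    the constants 16 and 8. *)
Let close_arith (S b D q e L d : R) : 0 <= d -> 0 <= L -> d ^+ 2 <= S ->
  S + (b + D) ^+ 2 <= b ^+ 2 -> `|D - q| <= e -> `|q| <= L * d + L * d ^+ 2 ->
  `|b| * L <= 4^-1 -> d ^+ 2 <= 16 * (`|b| * L) ^+ 2 + 8 * (`|b| * e).
Proof.
move=> d0 L0 dS hS De qL bL.
have b0 := normr_ge0 b; set B := `|b| in b0 bL *.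
have h1 : S <= 2 * (B * (e + L * d + L * d ^+ 2)).
  have DD : `|D| <= e + L * d + L * d ^+ 2.
    have := ler_normD (D - q) q; rewrite subrK => ?; lra.
  have : B * `|D| <= B * (e + L * d + L * d ^+ 2) by rewrite ler_wpM2l.
  have := ler_norm (- (b * D)); rewrite normrN normrM -/B.
  by have := sqr_ge0 D; rewrite sqrrD in hS; lra.
have h2 : B * L * d ^+ 2 <= 4^-1 * d ^+ 2 by rewrite ler_wpM2r ?sqr_ge0.
have h3 : 0 <= (d / 2 - 2 * (B * L)) ^+ 2 by exact: sqr_ge0.
by lra.
Qed.

(** The minimiser is compared with the point of the surface vertically aligned with y. Moving by d
    in the u-directions can shorten the vertical part only by the increment of h, of order n^(-1/2)
    times d + d^2, so d^2 cannot exceed O(n^-1). *)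
Lemma proj_close (y nu : I -> pt R m) :
  pO c 0 (fun i => `|(y i).1|) -> pO c 0 (fun i => (y i).2) ->
  (forall i, dom c i -> is_proj (region (h (idx c i))) (y i) (nu i)) ->
  pO c 1 (fun i => `|(nu i).1 - (y i).1|).
Proof.
move=> hy hy2 pr.
pose b i := (y i).2 + h (idx c i) (y i).1.
pose d i := (nu i).1 - (y i).1.
have hb : pO c 0 b by apply: pO_add => //; apply/bdd_pO; exact: np_bdd.
have ch n : continuous (h n) by exact: smooth_continuous (np_smooth hp n).
have min i : dom c i -> sqn (d i) + (b i + (h (idx c i) ((y i).1 + d i) - h (idx c i) (y i).1)) ^+ 2 <=
    b i ^+ 2.
  move=> di; have [_ /(_ (y i).1)] := proj_min (ch _) (pr i di).
  rewrite subrr (_ : sqn 0 = 0) ?add0r; last first.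
    by rewrite /sqn big1// => k _; rewrite mxE expr0n.
  by rewrite /d /b (addrC (y i).1) subrK -addrA (addrC (h _ (y i).1)) subrK.
(* A crude bound of d by the height of y, needed before h may be expanded at the projection. *)
have hd0 : pO c 0 (fun i => `|d i|).
  apply: pO_le hb; apply: evI => i di; rewrite normr_id.
  rewrite -(@ler_pXn2r _ 2) ?nnegrE// (real_normK (num_real (b i))).
  apply: (le_trans (sqr_norm_le_sqn _)); apply: le_trans (min i di).
  by rewrite lerDl sqr_ge0.
pose l i := shift_lin (lin0 c h i) (quad0 c h i) (y i).1.
pose L i := \sum_j `|l i j| + \sum_j \sum_k `|quad0 c h i j k|.
have hl j : pO c 1 (fun i => l i j) by exact: np_shift_lin.
have hL : pO c 1 L.
  apply: pO_add => //; first by apply: pO_sum => // j; exact: pO_norm.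
  by apply: pO_sum => // j; apply: pO_sum => // k; apply/pO_norm/np_pO2.
have L0 i : 0 <= L i.
  by rewrite addr_ge0// sumr_ge0// => j _; rewrite sumr_ge0.
pose q i := quad (l i) (quad0 c h i) (d i).
have hq i : `|q i| <= L i * `|d i| + L i * `|d i| ^+ 2.
  apply: (le_trans (ler_normD _ _)); apply: lerD.
    apply: (@le_trans _ _ (\sum_j `|l i j| * `|d i|)).
      apply: (le_trans (ler_norm_sum _ _ _)); apply: ler_sum => j _.
      by rewrite normrM ler_wpM2l// row_coord_le.
    by rewrite -mulr_suml ler_wpM2r// lerDl sumr_ge0// => j _; rewrite sumr_ge0.
  apply: (@le_trans _ _ (\sum_j \sum_k `|quad0 c h i j k| * `|d i| ^+ 2)).
    apply: (le_trans (ler_norm_sum _ _ _)); apply: ler_sum => j _.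
    apply: (le_trans (ler_norm_sum _ _ _)); apply: ler_sum => k _.
    by rewrite !normrM ler_wpM2l// expr2 ler_pM// row_coord_le.
  under eq_bigr do rewrite -mulr_suml.
  by rewrite -mulr_suml ler_wpM2r ?exprn_ge0// lerDr sumr_ge0.
have he := np_shift ok hp hy hd0.
have hbL : pO c 1 (fun i => `|b i| * L i) by exact: pO_mulr ok (pO_norm hb) hL.
have small := pO_small ok hbL (_ : 0 < 4^-1).
apply: pO_sqrt.
have := pO_add ok (pO_scale 16 ok (pO_sqr ok hbL))
  (pO_scale 8 ok (pO_mulr ok (pO_norm hb) (pO_norm he))).
apply: pO_le; apply: (ev_mono (small _)); first by rewrite invr_gt0.
move=> i di sm; rewrite -/(d i) ger0_norm ?exprn_ge0//.
apply: le_trans (ler_norm _).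
apply: (close_arith (normr_ge0 (d i)) (L0 i) (sqr_norm_le_sqn _) (min i di) (lexx _) (hq i)).
by apply: le_trans sm; exact: ler_norm.
Qed.

(** In the stationarity equation h and its gradient at the projection may be replaced by their
    values at 0, since the projection is O(n^(-1/2)) from the axis. *)
Lemma proj_expansion (r0 : I -> R) (nu : I -> pt R m) j : bdd c r0 ->
  (forall i, dom c i -> is_proj (region (h (idx c i))) (0, - r0 i) (nu i)) ->
  pO c 2 (fun i => (nu i).1 0 j +
    (taylor0 (h (idx c i)) - r0 i) * taylor1 (h (idx c i)) j).
Proof.
move=> hr pr.
have hu : pO c 1 (fun i => `|(nu i).1|).
  have := @proj_close (fun i => (0, - r0 i)) nu.
  have z0 : pO c 0 (fun i => `|(0, - r0 i).1 : 'rV[R]_m|).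
    by apply: pO_ext (pO_cst c 0) => i _; rewrite normr0.
  move=> /(_ z0 (bdd_pO (bdd_opp hr)) pr).
  by apply: pO_ext => i _; rewrite subr0.
have h1 := np_near0' ok hp hu.
have h2 := np_grad ok hp j hu.
have bb : bdd c (fun i => h (idx c i) (nu i).1 - r0 i).
  by apply: bdd_sub => //; apply: (np_bdd ok hp); exact: pO_weak hu.
have := pO_sub ok (pO_opp (pO_mulr ok (bdd_pO bb) h2))
  (pO_mul ok h1 (pO_weak ok (leq0n 1) (np_pO1 c hp j))).
apply: pO_ext => i di.
have := proj_stationary j (np_smooth hp (idx c i)) (pr i di).
rewrite /= mxE subr0 addrC -(addrC (h _ _)) => /eqP; rewrite addr_eq0 => /eqP e.
rewrite /lin0 in e *; lra.
Qed.

End projections.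

Section more_calculus.
Context {R : realType} {I : Type} (c : ctx R I).

Lemma pO_if k (P : I -> bool) (f : I -> R) : pO (restrict_ctx c P) k f ->
  ctx_ok c -> pO c k (fun i => if P i then f i else 0).
Proof.
move=> [C [q [C0 [N h]]]] /ctx_wt[N' w1]; exists C, q; split => //.
exists (maxn N N') => i di; rewrite geq_max => /andP[Ni Ni'].
case: ifPn => Pi; first exact: h.
rewrite normr0 !mulr_ge0 ?exprn_ge0 ?rsqrt_ge0//.
by apply: (le_trans ler01); exact: w1.
Qed.

Lemma bdd_restrict P (f : I -> R) : bdd c f -> bdd (restrict_ctx c P) f.
Proof. by move=> [C h]; exists C; exact: ev_restrict. Qed.

Lemma bdd_div (f g : I -> R) (e : R) : 0 < e -> ev c (fun i => e <= g i) ->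
  bdd c f -> bdd c (fun i => f i / g i).
Proof.
move=> e0 he hf; apply: bdd_mul => //; exists e^-1.
apply: (ev_mono he) => i _ hg; rewrite ger0_norm ?invr_ge0 ?(le_trans (ltW e0))//.
by rewrite lef_pV2 ?posrE// (lt_le_trans e0).
Qed.

Lemma phi_lb (x : I -> R) : bdd c x ->
  exists e : R, 0 < e /\ ev c (fun i => e <= phi (x i)).
Proof.
move=> [C h]; exists (phi C); split; first exact: phi_gt0.
apply: (ev_mono h) => i _ hC; rewrite !phiE.
rewrite ler_pM2l ?normal_peak_gt0 ?oner_neq0// ler_expR.
have C0 : 0 <= C by exact: le_trans hC.
have : x i ^+ 2 <= C ^+ 2.
  by rewrite -(real_normK (num_real (x i))) lerXn2r ?nnegrE.
by lra.
Qed.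

(** On a bounded range the density is at least [phi |M|]. This converts an error E in a p-value into
    an error K E in its argument, hence in the position of the level set. *)
Lemma Phibar_gap (M : R) : exists K : R, 0 < K /\ forall a b E : R,
  `|a| <= M -> `|b| <= M -> a + K * E < b -> 0 <= E ->
  Phibar b + E < Phibar a.
Proof.
pose k := phi `|M|; have k0 : 0 < k by exact: phi_gt0.
exists k^-1; split; first by rewrite invr_gt0.
move=> a b E aM bM ab E0.
have KE : 0 <= k^-1 * E by rewrite mulr_ge0// invr_ge0 ltW.
have h : k * (b - a) <= Phibar a - Phibar b.
  apply: Phibar_diff_ge => [||z zab]; [lra|exact: ltW|].
  rewrite /k !phiE ler_pM2l ?normal_peak_gt0 ?oner_neq0// ler_expR.
  have : z ^+ 2 <= `|M| ^+ 2.
    rewrite -(real_normK (num_real z)) lerXn2r ?nnegrE//.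
    move: aM bM; have := ler_norm M.
    by rewrite !ler_norml; lra.
  by lra.
have : E < k * (b - a) by rewrite -ltr_pdivrMl//; lra.
move: h; set u := Phibar a; set v := Phibar b; lra.
Qed.

End more_calculus.

(** * Level sets of p-values *)

Section profiles.
Context {R : realType} {m : nat}.
Variables h s : nat -> 'rV[R]_m -> R.
Hypotheses (hp : nearly_parallel h) (sp : nearly_parallel s).

Definition height I (c : ctx R I) (y : I -> pt R m) (i : I) : R :=
  (y i).2 + h (idx c i) (y i).1.

Definition offset (f : nat -> 'rV[R]_m -> R) I (c : ctx R I)
    (y : I -> pt R m) (i : I) : R :=
  h (idx c i) (y i).1 - s (idx c i) (y i).1 - taylor2_tr (f (idx c i)).

Definition moderate I (c : ctx R I) (y : I -> pt R m) :=
  pO c 0 (fun i => `|(y i).1|) /\ pO c 0 (fun i => (y i).2).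

(* The expansion of p is only required at bounded distance from the surface of
   H; farther away the tails suffice, since they decide p(y) < c for each c
   bounded away from the ends of the range. *)
Definition profile (p : nat -> pt R m -> R) (f : nat -> 'rV[R]_m -> R)
    (tau : R) : Prop :=
  forall I (c : ctx R I) (y : I -> pt R m), ctx_ok c -> moderate c y ->
  (bdd c (height c y) ->
     pO c 2 (fun i => p (idx c i) (y i) * Phibar (offset f c y i) -
                      Phibar (height c y i + tau * tr0 c h i))) /\
  (forall e, 0 < e -> exists B, ev c (fun i =>
     (B <= (y i).2 -> p (idx c i) (y i) * Phibar (offset f c y i) <= e) /\
     ((y i).2 <= - B ->
        1 - e <= p (idx c i) (y i) * Phibar (offset f c y i)))).

Lemma bdd_offset f I (c : ctx R I) (y : I -> pt R m) : nearly_parallel f ->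
  ctx_ok c -> pO c 0 (fun i => `|(y i).1|) -> bdd c (offset f c y).
Proof.
move=> fp ok hy; apply: bdd_sub; last exact: (pO_bdd ok (np_pOtr ok fp)).
by apply: bdd_sub; [exact: (np_bdd ok hp hy)|exact: (np_bdd ok sp hy)].
Qed.

Section probability_of_level_sets.
Context {I : Type} (c : ctx R I).
Hypothesis ok : ctx_ok c.
Variables (p : nat -> pt R m -> R) (f : nat -> 'rV[R]_m -> R) (tau : R).
Hypotheses (fp : nearly_parallel f)
  (mp : forall n, measurable_fun setT (p n)) (pp : profile p f tau).
Variables (mu : I -> pt R m) (x thr : I -> R).
Hypotheses (hmu : pO c 0 (fun i => `|(mu i).1|)) (hmu2 : pO c 2 (height c mu))
  (bx : bdd c x)
  (hthr : pO c 2 (fun i => thr i * Phibar (offset f c mu i) - Phibar (x i))).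

(** The rate K with phi(x) K = thr phi(d0), to first order, where d0 is the offset at [mu] and thr =
    Phibar(x) / Phibar(d0): the argument x must move by K D when the offset moves by D. *)
Definition slope (i : I) : R :=
  Phibar (x i) / phi (x i) * (phi (offset f c mu i) / Phibar (offset f c mu i)).

Let d0 := offset f c mu.
Let rho i := phi (d0 i) / Phibar (d0 i).
Let bd0 : bdd c d0 := bdd_offset fp ok hmu.

Let brho : bdd c rho.
Proof. by have [e [e0 he]] := Phibar_lb bd0; apply: bdd_div e0 he (bdd_phi _ _). Qed.

Lemma bdd_slope : bdd c slope.
Proof.
apply: bdd_mul brho; have [e [e0 he]] := phi_lb bx.
exact: bdd_div e0 he (bdd_Phibar _ _).
Qed.

Let bthr : bdd c thr.
Proof.
have [e [e0 he]] := Phibar_lb bd0.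
have h1 : bdd c (fun i => thr i * Phibar (d0 i)).
  have := bdd_add (pO_bdd ok hthr) (bdd_Phibar c x).
  by apply: bdd_ext => i _; rewrite subrK.
have := bdd_div e0 he h1; apply: bdd_ext => i _; rewrite mulfK//.
exact: lt0r_neq0 (Phibar_gt0 _).
Qed.

Let J := ext_ctx m c.
Let okJ : ctx_ok J := ok_ext ok.
Let Y (j : I * pt R m) : pt R m := affine (Num.sqrt 1) (mu j.1) j.2.

Let Y1 j : (Y j).1 = (mu j.1).1 + j.2.1.
Proof. by rewrite /Y /affine/= sqrtr1 scale1r. Qed.

Let Y2 j : (Y j).2 = (mu j.1).2 + j.2.2.
Proof. by rewrite /Y /affine/= sqrtr1 mul1r. Qed.

Let hY1 : pO J 0 (fun j => `|(Y j).1|).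
Proof.
apply: pO_le (pO_add okJ (pO_fst ok hmu) (pO_incr ok)).
apply: evI => j _; rewrite normr_id Y1.
by apply: (le_trans (ler_normD _ _)); exact: ler_norm.
Qed.

Let shl f' i := shift_lin (lin0 c f' i) (quad0 c f' i) (mu i).1.
Let incr f' (j : I * pt R m) := quad (shl f' j.1) (quad0 c f' j.1) j.2.1.

Let incr_near f' : nearly_parallel f' ->
  pO J 2 (fun j => f' (idx J j) (Y j).1 - f' (idx J j) (mu j.1).1 - incr f' j).
Proof.
move=> f'p; have := np_shift okJ f'p (pO_fst ok hmu) (pO_incr ok).
by apply: pO_ext => j _; rewrite Y1.
Qed.

Let incr1 f' : nearly_parallel f' -> pO J 1 (incr f').
Proof.
move=> f'p; apply: pO_quad_gen (pO_incr ok) => //.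
- move=> k; have h1 : pO c 1 (fun i => shl f' i k) by exact: np_shift_lin.
  exact: (pO_fst ok h1).
- by move=> k k'; have h1 := np_pO2 c f'p k k'; exact: (pO_fst ok h1).
Qed.

Let del j := incr h j - incr s j.

Let hdel : pO J 1 del.
Proof. by apply: pO_sub => //; exact: incr1. Qed.

Let arithO (hY hm qh sY sm qs f0 : R) :
  hY - hm - qh - (sY - sm - qs) = hY - sY - f0 - (hm - sm - f0 + (qh - qs)).
Proof. by ring. Qed.

Let arithH (mu2 v hY hm q : R) :
  hY - hm - q + (mu2 + hm) = mu2 + v + hY - (v + q).
Proof. by ring. Qed.

Let offset_near : pO J 2 (fun j => offset f J Y j - (d0 j.1 + del j)).
Proof.
have := pO_sub okJ (incr_near hp) (incr_near sp).
by apply: pO_ext => j _; exact: arithO.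
Qed.

Let height_near : pO J 2 (fun j => height J Y j - (j.2.2 + incr h j)).
Proof.
have := pO_add okJ (incr_near hp) (pO_fst ok hmu2).
by apply: pO_ext => j _; rewrite /height Y2; exact: arithH.
Qed.

Let arithV (T PY P0 PX PXK f0 fx r K D : R) : P0 * r = f0 -> fx * K = PX * r ->
  T * (PY - P0 + f0 * D) + (T * P0 - PX) * (1 - r * D) -
    (PXK - PX + fx * (K * D)) = T * PY - PXK.
Proof.
move=> h1 h2; have -> : fx * (K * D) = PX * r * D by rewrite mulrA h2.
by rewrite -h1; ring.
Qed.

(** It rewrites p(Y) < thr as a comparison of two values of [Phibar], and so as a lower bound on the
    v-noise. *)
Let threshold_near : pO J 2 (fun j => thr j.1 * Phibar (offset f J Y j) -
  Phibar (x j.1 + slope j.1 * del j)).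
Proof.
have h1 : pO J 2 (fun j => Phibar (offset f J Y j) - Phibar (d0 j.1) +
    phi (d0 j.1) * del j).
  have := pO_add okJ (pO_Phibar offset_near) (pO_Phibar_taylor (fun j => d0 j.1) okJ hdel).
  by apply: pO_ext => j _; rewrite !addrA subrK.
have hrd : pO J 1 (fun j => rho j.1 * del j).
  exact: (pO_mulr okJ (pO_fst ok (bdd_pO brho)) hdel).
have hKd : pO J 1 (fun j => slope j.1 * del j).
  exact: (pO_mulr okJ (pO_fst ok (bdd_pO bdd_slope)) hdel).
have h2 : pO J 0 (fun j => 1 - rho j.1 * del j).
  by apply: pO_sub => //; [exact: pO_cst|exact: pO_weak hrd].
have h3 := pO_Phibar_taylor (fun j => x j.1) okJ hKd.
have := pO_sub okJ (pO_add okJ (pO_mulr okJ (pO_fst ok (bdd_pO bthr)) h1)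
  (pO_mul okJ (pO_fst ok hthr) h2)) h3.
apply: pO_ext => j _; apply: arithV.
  by rewrite mulrC /rho divfK// lt0r_neq0// Phibar_gt0.
rewrite /slope -/(d0 j.1) -/(rho j.1) mulrA [phi _ * _]mulrC divfK//.
by rewrite lt0r_neq0// phi_gt0.
Qed.

Let arith_above (x' T sd ih v hY KE : R) :
  x' - T + (sd - ih) + (`|hY - (v + ih)| + KE) < v -> x' + sd + KE < hY + T.
Proof. by have := ler_norm (- (hY - (v + ih))); rewrite normrN; lra. Qed.

Let arith_below (x' T sd ih v hY KE : R) :
  v < x' - T + (sd - ih) - (`|hY - (v + ih)| + KE) -> hY + T + KE < x' + sd.
Proof. by have := ler_norm (hY - (v + ih)); lra. Qed.

Let arith_lt (a b d Pa Pb : R) : 0 < d ->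
  Pa + (`|a * d - Pa| + `|b * d - Pb|) < Pb -> a < b.
Proof.
move=> dgt0 h1; rewrite -(ltr_pM2r dgt0).
have := ler_norm (a * d - Pa); have := ler_norm (- (b * d - Pb)).
by rewrite normrN; lra.
Qed.

Let arith_tail (a b d P e : R) : 0 < d -> 0 < e ->
  a * d <= e -> 2 * e <= P -> `|b * d - P| <= e / 2 -> a < b.
Proof.
move=> dgt0 egt0 h1 h2; rewrite ler_norml -(ltr_pM2r dgt0) => /andP[h3 _]; lra.
Qed.

Let arith_tail' (a b d P e : R) : 0 < d -> 0 < e ->
  1 - e <= a * d -> P <= 1 - 2 * e -> `|b * d - P| <= e / 2 -> b < a.
Proof.
move=> dgt0 egt0 h1 h2; rewrite ler_norml -(ltr_pM2r dgt0) => /andP[_ h3]; lra.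
Qed.

Let arith_far (B Bm Bx mu2 x' T q v : R) : `|mu2| <= Bm -> `|x'| <= Bx ->
  `|T| <= 1 -> `|q| <= 1 -> `|B| + Bm + Bx + 2 < `|v| ->
  (x' - T + q + 0 < v -> B <= mu2 + v) /\
  (v < x' - T + q - 0 -> mu2 + v <= - B).
Proof.
rewrite addr0 subr0.
have := normr_ge0 B; have := ler_norm B; rewrite !ler_norml => hB ? /andP[? ?] /andP[? ?] /andP[? ?] /andP[? ?].
by rewrite ltr_normr => /orP[] ?; split => ?; lra.
Qed.

Let arithS (k a b : R) : (k - 1) * a + - k * b = k * (a - b) - a.
Proof. by ring. Qed.

Let arithT (x' T k a b : R) : x' - T + ((k - 1) * a + - k * b) = x' - T - a + k * (a - b).
Proof. by ring. Qed.

Let slope_quad i (z : 'rV[R]_m) :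
  quad (fun k => (slope i - 1) * shl h i k + - slope i * shl s i k)
    (fun k k' => (slope i - 1) * quad0 c h i k k' + - slope i * quad0 c s i k k') z =
  slope i * (quad (shl h i) (quad0 c h i) z - quad (shl s i) (quad0 c s i) z) -
  quad (shl h i) (quad0 c h i) z.
Proof. by rewrite -quad_comb; exact: arithS. Qed.

(** The condition p(Y) < thr becomes v + q_h + tau h_ii > x + K (q_h - q_s), with q_h and q_s the
    quadratic increments of h and s. It is an upper event for the quadratic polynomial (K - 1) q_h -
    K q_s, whose trace gives the last two terms. *)
Lemma profile_prob :
  pO c 2 (fun i => Pr 1 (mu i) [set y | p (idx c i) y < thr i] -
    Phibar (x i - tau * tr0 c h i - tr0 c h i +
            slope i * (tr0 c h i - tr0 c s i))).
Proof.
have bsl := bdd_slope.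
have bmu : bdd c (fun i => (mu i).2).
  have := bdd_sub (pO_bdd ok hmu2) (np_bdd ok hp hmu).
  by apply: bdd_ext => i _; rewrite addrK.
have [Bx hBx] := bx; have [Bm hBm] := bmu.
(* As |x| <= Bx, the value [Phibar x] lies between 2 e0 and 1 - 2 e0; a tail within e0 of 0 or 1
   therefore settles the comparison, with room for the error of the threshold. *)
pose e0 : R := Phibar Bx / 2.
have e00 : 0 < e0 by rewrite divr_gt0// Phibar_gt0.
(* The weight of J ignores the v-noise, which may reach ln n; the logarithmic weight is what makes Y
   moderate. *)
have mL : moderate (log_ctx J) Y.
  split; first exact: pO_log.
  have v0 : pO (log_ctx J) 0 (fun j => j.2.2).
    apply: pO_le (pO_ln okJ); apply: evI => j [_ [_ vl]].
    by apply: (le_trans vl); exact: ler_norm.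
  have := pO_add (ok_log okJ) (pO_log okJ (pO_fst ok (bdd_pO bmu))) v0.
  by apply: pO_ext => j _; rewrite Y2.
have [_ /(_ _ e00)[B tail]] := pp (ok_log okJ) mL.
(* Beyond B2 the sign of the v-noise decides both on which side of the quadratic threshold it lies
   and which tail alternative applies. The 2 bounds the trace term and the quadratic increment, each
   eventually at most 1. *)
pose B2 := `|B| + Bm + Bx + 2.
pose P (j : I * pt R m) := `|j.2.2| <= B2.
pose JP := restrict_ctx J P.
have okP : ctx_ok JP by exact: ok_restrict.
have bv : bdd JP (fun j => j.2.2) by exists B2; apply: evI => j [].
have bhY : bdd JP (height JP Y).
  have h1 := bdd_restrict P (pO_bdd okJ height_near).
  have h2 := bdd_restrict P (pO_bdd okJ (incr1 hp)).
  have := bdd_add h1 (bdd_add bv h2).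
  by apply: bdd_ext => j _; rewrite subrK.
have mP : moderate JP Y.
  split; first exact: pO_restrict.
  have := bdd_add (bdd_restrict P (bdd_fst bmu)) bv.
  by move=> /bdd_pO; apply: pO_ext => j _; rewrite Y2.
have [/(_ bhY) near _] := pp okP mP.
have trP : pO c 1 (fun i => tau * tr0 c h i).
  by apply: pO_scale => //; exact: np_pOtr.
have hsd : pO J 1 (fun j => slope j.1 * del j).
  exact: (pO_mulr okJ (pO_fst ok (bdd_pO bsl)) hdel).
have [M1 hM1] : bdd J (fun j => x j.1 + slope j.1 * del j).
  by apply: bdd_add; [exact: (bdd_fst bx)|exact: pO_bdd hsd].
have [M2 hM2] : bdd JP (fun j => height JP Y j + tau * tr0 JP h j).
  apply: bdd_add => //; apply: (pO_bdd okP (k := 0)).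
  exact: (pO_restrict P (pO_fst ok trP)).
pose M := Num.max M1 M2.
have [K [K0 gap]] := @Phibar_gap R M.
pose U j := p (idx J j) (Y j) * Phibar (offset f J Y j) -
  Phibar (height J Y j + tau * tr0 J h j).
pose V j := thr j.1 * Phibar (offset f J Y j) -
  Phibar (x j.1 + slope j.1 * del j).
(* Where the v-noise is bounded, this margin collects the expansion errors, those of p-values being
   scaled by K; elsewhere the tails decide and no margin is required. *)
pose e j := if P j then `|height J Y j - (j.2.2 + incr h j)| +
  K * (`|U j| + `|V j|) else 0.
have he : pO J 2 e.
  apply: pO_if => //; apply: pO_add => //.
    exact/pO_norm/pO_restrict/height_near.
  apply: pO_scale => //; apply: pO_add => //; first exact: pO_norm near.
  exact/pO_norm/pO_restrict/threshold_near.
pose l i k := (slope i - 1) * shl h i k + - slope i * shl s i k.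
pose Q i k k' := (slope i - 1) * quad0 c h i k k' + - slope i * quad0 c s i k k'.
have sl0 : pO c 0 slope by exact: bdd_pO.
have sl1 : pO c 0 (fun i => slope i - 1) by apply: pO_sub => //; exact: pO_cst.
have hl k : pO c 1 (fun i => l i k).
  apply: pO_add => //; apply: pO_mulr => //; try exact: np_shift_lin.
  exact: pO_opp.
have hQ k k' : pO c 1 (fun i => Q i k k').
  apply: pO_add => //; apply: pO_mulr => //; try exact: np_pO2.
  exact: pO_opp.
have mE i : measurable [set y | p (idx c i) y < thr i].
  exact: measurable_lt_cst.
have := @pO_event R I m c ok 1 mu (fun i => [set y | p (idx c i) y < thr i])
  (fun i => x i - tau * tr0 c h i) l Q e mE hl hQ he.
have trE i : tr (Q i) = (slope i - 1) * tr0 c h i + - slope i * tr0 c s i.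
  exact: tr_comb.
have qE j : quad (l j.1) (Q j.1) j.2.1 = slope j.1 * del j - incr h j.
  exact: slope_quad.
move=> H; apply: (pO_ext _ (H _)) => [i _|]; first by rewrite trE arithT.
have W2 : pO J 1 (fun j => thr j.1 * Phibar (offset f J Y j) - Phibar (x j.1)).
  have h1 : pO J 1 (fun j => Phibar (x j.1 + slope j.1 * del j) - Phibar (x j.1)).
    by apply: pO_Phibar; apply: pO_ext hsd => j _; rewrite addrC addKr.
  have := pO_add okJ (pO_weak okJ (ltnW (ltnSn 1)) threshold_near) h1.
  by apply: pO_ext => j _; rewrite addrA subrK.
have e02 : 0 < e0 / 2 by rewrite divr_gt0.
have eW := pO_small okJ W2 e02.
have eT := pO_small okJ (pO_fst ok trP) ltr01.
have hq1 : pO J 1 (fun j => slope j.1 * del j - incr h j).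
  by apply: pO_sub => //; exact: incr1.
have eq1 := pO_small okJ hq1 ltr01.
have eb : ev J (fun j => `|(mu j.1).2| <= Bm /\ `|x j.1| <= Bx).
  by apply: ev_and; [exact: (ev_fst hBm)|exact: (ev_fst hBx)].
have eM2 : ev J (fun j => P j -> `|height J Y j + tau * tr0 J h j| <= M2).
  by have [N hN] := hM2; exists N => j dj Nj Pj; exact: hN.
have ev1 := ev_and (ev_and tail eW) (ev_and (ev_and eT eq1) eb).
apply: (ev_mono (ev_and ev1 (ev_and hM1 eM2))) => j _ [[[tl W] [[T1 q1] [bm1 bx1]]] [m1 m2]].
rewrite qE; rewrite -/(Y j) /=.
have dpos := Phibar_gt0 (offset f J Y j).
have [Pj|nPj] := boolP (P j).
  have e1 : e j = `|height J Y j - (j.2.2 + incr h j)| + K * (`|U j| + `|V j|).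
    by rewrite /e Pj.
  have le1 : `|x j.1 + slope j.1 * del j| <= M by rewrite le_max m1.
  have le2 : `|height J Y j + tau * tr0 J h j| <= M by rewrite le_max m2 ?orbT.
  have E0 : 0 <= `|U j| + `|V j| by exact: addr_ge0.
  rewrite e1; split => hv.
    have := gap _ _ _ le1 le2 (arith_above hv) E0.
    exact: arith_lt.
  have := gap _ _ _ le2 le1 (arith_below hv) E0; rewrite [`|U j| + _]addrC => g.
  by have := arith_lt dpos g => /ltW; rewrite leNgt => /negP.
have e1 : e j = 0 by rewrite /e (negbTE nPj).
rewrite e1.
have {}nPj : B2 < `|j.2.2| by rewrite ltNge.
have [f1 f2] := arith_far bm1 bx1 T1 q1 nPj.
have [t1 t2] := tl; rewrite Y2 in t1 t2.
have x1 : 2 * e0 <= Phibar (x j.1).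
  rewrite /e0 mulrC divfK// Phibar_le.
  by apply: le_trans bx1; exact: ler_norm.
have x2 : Phibar (x j.1) <= 1 - 2 * e0.
  rewrite /e0 [2 * _]mulrC divfK// -PhibarN Phibar_le.
  by move: bx1; rewrite ler_norml => /andP[].
split => hv.
  exact: (arith_tail dpos e00 (t1 (f1 hv)) x1 W).
by have := arith_tail' dpos e00 (t2 (f2 hv)) x2 W => /ltW; rewrite leNgt => /negP.
Qed.

End probability_of_level_sets.
End profiles.

(** * Profiles of the single and the double bootstrap *)

Section bootstrap_profiles.
Context {R : realType} {m : nat}.
Variables h s : nat -> 'rV[R]_m -> R.
Hypotheses (hp : nearly_parallel h) (sp : nearly_parallel s).
Variables (grid : seq R) (w : R -> R).
Hypotheses (gs : (1 < size grid)%N) (gu : uniq grid)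
  (g0 : forall t, t \in grid -> 0 < t) (w0 : forall t, t \in grid -> 0 < w t).
Local Notation H n := (region (h n)).
Local Notation S n := (~` region (s n)).

Lemma measurable_S n : measurable (S n).
Proof. by apply: measurableC; exact: np_measurable. Qed.

Section surface_points.
Context {I : Type} (c : ctx R I).
Hypothesis ok : ctx_ok c.
Variables y mu : I -> pt R m.
Hypotheses (hy : pO c 0 (fun i => `|(y i).1|))
  (hmuy : pO c 1 (fun i => `|(mu i).1 - (y i).1|)) (hmu2 : pO c 2 (height h c mu)).

Lemma close_moderate : pO c 0 (fun i => `|(mu i).1|).
Proof.
apply: pO_le (pO_add ok (pO_weak ok (leq0n 1) hmuy) hy); apply: evI => i _.
rewrite normr_id; apply: le_trans (ler_norm _).
by apply: le_trans (ler_normD _ _); rewrite subrK.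
Qed.

Lemma offset_close f : pO c 2 (fun i => offset h s f c mu i - offset h s f c y i).
Proof.
have := pO_sub ok (np_close ok hp hy hmuy) (np_close ok sp hy hmuy).
by apply: pO_ext => i _; rewrite /offset; set t := taylor2_tr _; move: t => t; ring.
Qed.

Let arith_sel (mu2 hh ss t : R) : - (mu2 + ss + t) - (hh - ss - t) = - (mu2 + hh).
Proof. by ring. Qed.

Lemma Pr_selection_surface :
  pO c 2 (fun i => Pr 1 (mu i) (S (idx c i)) - Phibar (offset h s s c mu i)).
Proof.
have h1 : pO c 2 (fun i => - ((mu i).2 + s (idx c i) (mu i).1 + tr0 c s i) -
    offset h s s c mu i).
  have := pO_opp hmu2; apply: pO_ext => i _; rewrite /offset; exact/esym/arith_sel.
have := pO_add ok (Pr_selection ok sp close_moderate) (pO_Phibar h1).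
by apply: pO_ext => i _; rewrite addrA subrK.
Qed.

Lemma Pr_selection_close :
  pO c 2 (fun i => Pr 1 (mu i) (S (idx c i)) - Phibar (offset h s s c y i)).
Proof.
have := pO_add ok Pr_selection_surface (pO_Phibar (offset_close s)).
by apply: pO_ext => i _; rewrite addrA subrK.
Qed.

(** The argument d is left free so that the denominator can be referred to the offset at y or at the
    point used as its projection. *)
Lemma pBP1_near sigma2 (d : I -> R) : bdd c d ->
  pO c 2 (fun i => Pr 1 (mu i) (S (idx c i)) - Phibar (d i)) ->
  bdd c (height h c y) ->
  pO c 2 (fun i =>
    pBP1_at grid w sigma2 (H (idx c i)) (S (idx c i)) (y i) (mu i) * Phibar (d i) -
    Phibar (height h c y i + sigma2 * tr0 c h i)).
Proof.
move=> bd hd bh; have [e [e0 he]] := Phibar_lb bd.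
have h1 := pO_div ok e0 he (bdd_Phibar c _) (pval_near ok hp gs gu g0 w0 sigma2 hy bh) hd.
have := pO_mulr ok (bdd_pO (bdd_Phibar c d)) h1.
apply: pO_ext => i _; rewrite mulrC mulrBl -[X in _ - X]mulrA mulVf ?mulr1//.
exact: lt0r_neq0 (Phibar_gt0 _).
Qed.

End surface_points.

Lemma pO_pt_norm I (c : ctx R I) (y : I -> pt R m) : ctx_ok c -> moderate c y ->
  pO c 0 (fun i => `|y i|).
Proof.
move=> ok [h1 h2]; apply: pO_le (pO_add ok h1 (pO_norm h2)).
apply: evI => i _; rewrite normr_id; apply: le_trans (ler_norm _).
by rewrite [`|y i|]prod_normE ge_max lerDl lerDr !normr_ge0.
Qed.

Variable muhat : nat -> pt R m -> pt R m.
Hypothesis muP : approx_proj h muhat.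

Lemma muhat_near I (c : ctx R I) (y : I -> pt R m) : ctx_ok c -> moderate c y ->
  pO c 1 (fun i => `|(muhat (idx c i) (y i)).1 - (y i).1|) /\
  pO c 2 (height h c (fun i => muhat (idx c i) (y i))).
Proof.
move=> ok md; have hy := pO_pt_norm ok md.
have [_ [proj [pr h1 h2]]] := muP; split; last first.
  have := @locO_pO _ _ _ c 2 (fun n y => (muhat n y).2 + h n (muhat n y).1) y ok hy.
  by apply; move: h2; rewrite (_ : (fun n => _) = (fun n => rsqrt n ^+ 2))//;
    apply/funext => n; rewrite rsqrt_sqr.
have c1 := @locO_pO _ _ _ c 1
  (fun n y => `|(muhat n y).1 - (proj n y).1|) y ok hy h1.
have [m1 m2] := md.
have c2 := proj_close ok hp m1 m2 (fun i _ => pr (idx c i) (y i)).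
apply: pO_le (pO_add ok c1 c2); apply: evI => i _; rewrite normr_id.
apply: le_trans (ler_norm _); rewrite -[X in `|X|](subrKA (proj (idx c i) (y i)).1).
exact: ler_normD.
Qed.

Variable sigma2 : R.
Local Notation p1 := (fun n => pBP1 grid w sigma2 (muhat n) (H n) (S n)).

Lemma measurable_p1 n : measurable_fun setT (p1 n).
Proof.
have [mm _] := muP.
by apply: measurable_pBP1 => //; [exact: np_measurable|exact: measurable_S].
Qed.

Let arith_tails (pv rat e q : R) : 0 < e -> e <= 1 -> 0 <= rat ->
  `|rat - 1| <= e / 2 ->
  (q <= e / 2) ->
  (pv <= q -> pv * rat <= e) /\ (1 - q <= pv -> 1 - e <= pv * rat).
Proof.
move=> e0 e1 r0; rewrite ler_norml => /andP[r1 r2] qe; split => hv.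
  have : pv * rat <= (e / 2) * rat by rewrite ler_wpM2r//; lra.
  have : (e / 2) * rat <= (e / 2) * 2 by rewrite ler_wpM2l//; lra.
  lra.
have : (1 - e / 2) * rat <= pv * rat by rewrite ler_wpM2r//; lra.
have : (1 - e / 2) * (1 - e / 2) <= (1 - e / 2) * rat by rewrite ler_wpM2l//; lra.
have : 0 <= e / 2 * (e / 2) by rewrite mulr_ge0//; lra.
lra.
Qed.

Lemma Phibar_tails (e C : R) : 0 < e -> exists B, forall q b : R, `|q - b| <= C ->
  (B <= b -> Phibar q <= e) /\ (b <= - B -> 1 - e <= Phibar q).
Proof.
move=> e0; exists (C + 2 / e) => q b; rewrite ler_norml => /andP[h1 h2].
have small := ltW (Phibar_small e0); split => hb.
  by apply: le_trans small; rewrite Phibar_le; lra.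
have : Phibar (- q) <= e by apply: le_trans small; rewrite Phibar_le; lra.
by rewrite PhibarN; set u := Phibar q; lra.
Qed.

(** For the tails, psi stays within O(1) of v, which drives the numerator to 0 or 1, while the ratio
    of the expanded to the actual selection probability tends to 1. *)
Lemma profile_p1 : profile h s p1 s sigma2.
Proof.
move=> I c y ok md; have [m1 m2] := muhat_near ok md; have [y1 y2] := md.
have sel := Pr_selection_close ok y1 m1 m2.
have bo := bdd_offset hp sp sp ok y1.
split=> [bh|e e0]; first exact: (pBP1_near ok y1).
pose e1 := Num.min e 1.
have e10 : 0 < e1 by rewrite lt_min e0 ltr01.
have e11 : e1 <= 1 by rewrite ge_min lexx orbT.
have e1e : e1 <= e by rewrite ge_min lexx.
have e12 : 0 < e1 / 2 by rewrite divr_gt0.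
have [b [b0 hb]] := Phibar_lb bo.
have rat : pO c 2 (fun i => Phibar (offset h s s c y i) /
    Pr 1 (muhat (idx c i) (y i)) (S (idx c i)) - 1).
  have z2 : pO c 2 (fun i => Phibar (offset h s s c y i) - Phibar (offset h s s c y i)).
    by apply: pO_Phibar; apply: pO_ext (pO_scale 0 ok (pO_rsqrt c 2)) => i _; rewrite subrr mul0r.
  have := pO_div ok b0 hb (bdd_Phibar c _) z2 sel.
  by apply: pO_ext => i _; rewrite [X in _ - X]divff// lt0r_neq0// Phibar_gt0.
have [C hC] := psi_crude ok hp gs gu g0 w0 sigma2 y1 y2.
have [B hB] := Phibar_tails C e12.
exists B; apply: (ev2 hC (pO_small ok rat e12)) => i _ {}hC {}rat.
have [t1 t2] := hB _ _ hC.
have r0 : 0 <= Phibar (offset h s s c y i) / Pr 1 (muhat (idx c i) (y i)) (S (idx c i)).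
  exact: divr_ge0 (ltW (Phibar_gt0 _)) (Pr_ge0 _ _ _).
have [a1 a2] := arith_tails (pval grid w sigma2 (H (idx c i)) (y i))
  e10 e11 r0 rat (lexx _).
have pE : p1 (idx c i) (y i) * Phibar (offset h s s c y i) =
  pval grid w sigma2 (H (idx c i)) (y i) *
    (Phibar (offset h s s c y i) / Pr 1 (muhat (idx c i) (y i)) (S (idx c i))).
  by rewrite /pBP1 /pBP1_at mulrAC mulrA.
rewrite pE; split => hv; first exact: le_trans (a1 (t1 hv)) e1e.
by apply: le_trans (a2 (t2 hv)); rewrite lerD2l lerN2.
Qed.

Lemma measurable_p1_lt n (a : R) : measurable [set y | p1 n y < a].
Proof. by apply: measurable_lt_cst => //; exact: measurable_p1. Qed.

Section double_bootstrap.
Context {I : Type} (c : ctx R I).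
Hypothesis ok : ctx_ok c.
Variables y mu : I -> pt R m.
Hypotheses (hy : pO c 0 (fun i => `|(y i).1|))
  (hmuy : pO c 1 (fun i => `|(mu i).1 - (y i).1|)) (hmu2 : pO c 2 (height h c mu)).

Let d0 := offset h s s c mu.
Let hmu := close_moderate ok hy hmuy.
Let bd0 : bdd c d0 := bdd_offset hp sp sp ok hmu.
Let rho i := phi (d0 i) / Phibar (d0 i).
Let del i := tr0 c h i - tr0 c s i.

Let brho : bdd c rho.
Proof. by have [e [e0 he]] := Phibar_lb bd0; apply: bdd_div e0 he (bdd_phi _ _). Qed.

Let hdel : pO c 1 del.
Proof. by apply: pO_sub => //; exact: np_pOtr. Qed.

Let hrd : pO c 1 (fun i => rho i * del i).
Proof. exact: pO_mulr ok (bdd_pO brho) hdel. Qed.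

Let arith_off (A B p b r D : R) : b * r = p ->
  A + (B - b + p * - D) = A + B - b * (1 + r * D).
Proof. by move=> <-; ring. Qed.

Let arith_off' (hh ss th ts : R) : hh - ss - ts + - (th - ts) = hh - ss - th.
Proof. by ring. Qed.

Lemma offset_h_near : pO c 2 (fun i => Phibar (offset h s h c y i) -
  Phibar (d0 i) * (1 + rho i * del i)).
Proof.
have h1 := pO_Phibar_taylor d0 ok (pO_opp hdel).
have h2 := pO_opp (pO_Phibar (offset_close ok hy hmuy h)).
have := pO_add ok h2 h1; apply: pO_ext => i _.
rewrite (@arith_off _ _ _ _ (rho i)); last by rewrite mulrC /rho divfK// lt0r_neq0// Phibar_gt0.
have e : d0 i + - del i = offset h s h c mu i by exact: arith_off'.
by rewrite e opprB subrK.
Qed.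

Let arith_num (A g x' f fx k r D : R) : fx * k = x' * r -> fx != 0 ->
  A - g + f * (k * D) - r * ((f - fx) * (x' / fx) + (x' - g)) * D =
  A - g * (1 - r * D).
Proof.
move=> e fx0; have -> : k = x' * r / fx by rewrite -e [fx * k]mulrC mulfK.
by field.
Qed.

Variable x : I -> R.
Hypothesis bx : bdd c x.

(* [g] is within O(n^(-1/2)) of [x], so the slope at [x] may be replaced by the
   logarithmic derivative [rho]. *)
Lemma Phibar_slope_near (g : I -> R) : pO c 1 (fun i => g i - x i) ->
  pO c 2 (fun i => Phibar (g i + slope h s c s mu x i * del i) -
    Phibar (g i) * (1 - rho i * del i)).
Proof.
move=> gx; have bsl := bdd_slope hp sp ok sp hmu bx.
have hsd : pO c 1 (fun i => slope h s c s mu x i * del i).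
  exact: pO_mulr ok (bdd_pO bsl) hdel.
have [e [e0 he]] := phi_lb bx.
have bq : bdd c (fun i => Phibar (x i) / phi (x i)).
  exact: bdd_div e0 he (bdd_Phibar _ _).
have h1 : pO c 1 (fun i => phi (g i) - phi (x i)).
  by apply: pO_le gx; apply: evI => i _; exact: phi_lip.
have h2 : pO c 1 (fun i => Phibar (x i) - Phibar (g i)).
  by apply: pO_Phibar; apply: pO_ext (pO_opp gx) => i _; rewrite opprB.
have h3 : pO c 1 (fun i => (phi (g i) - phi (x i)) * (Phibar (x i) / phi (x i)) +
    (Phibar (x i) - Phibar (g i))).
  apply: pO_add => //; have := pO_mulr ok (bdd_pO bq) h1.
  by apply: pO_ext => i _; rewrite mulrC.
have h4 := pO_mul11 ok (pO_mulr ok (bdd_pO brho) h3) hdel.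
have := pO_sub ok (pO_Phibar_taylor g ok hsd) h4.
have px0 i : phi (x i) != 0 by rewrite lt0r_neq0// phi_gt0.
apply: pO_ext => i _; apply: arith_num (px0 i).
by rewrite /slope -/(d0 i) -/(rho i) mulrA [phi _ * _]mulrC divfK.
Qed.

Let arith_ratio (N P O g b r D : R) : b != 0 ->
  O * (N / P - g * (1 - r * D) / b) + g * (1 - r * D) / b * (O - b * (1 + r * D)) -
  g * (r * D * (r * D)) = N / P * O - g.
Proof. by move=> b0; move: (N / P) => Q; field. Qed.

(** The factor 1 - rho D of the numerator and the factor 1 + rho D separating the two offsets, with
    D = h_ii - s_ii, multiply to 1 - (rho D)^2, which is 1 up to O(n^-1). *)
Lemma ratio_near (N g : I -> R) : pO c 1 (fun i => g i - x i) ->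
  pO c 2 (fun i => N i - Phibar (g i + slope h s c s mu x i * del i)) ->
  pO c 2 (fun i => N i / Pr 1 (mu i) (S (idx c i)) * Phibar (offset h s h c y i) -
    Phibar (g i)).
Proof.
move=> gx hN.
have hN' : pO c 2 (fun i => N i - Phibar (g i) * (1 - rho i * del i)).
  have := pO_add ok hN (Phibar_slope_near gx).
  by apply: pO_ext => i _; rewrite addrA subrK.
have bN : bdd c (fun i => Phibar (g i) * (1 - rho i * del i)).
  apply: bdd_mul; first exact: bdd_Phibar.
  by apply: bdd_sub; [exact: bdd_cst|exact: pO_bdd hrd].
have [e [e0 he]] := Phibar_lb bd0.
have h1 := pO_div ok e0 he bN hN' (Pr_selection_surface ok hy hmuy hmu2).
have h2 := pO_mulr ok (bdd_pO (bdd_div e0 he bN)) offset_h_near.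
have h3 := pO_mulr ok (bdd_pO (bdd_Phibar c g)) (pO_mul11 ok hrd hrd).
have := pO_sub ok (pO_add ok (pO_mulr ok (bdd_pO (bdd_Phibar c (offset h s h c y))) h1) h2) h3.
apply: pO_ext => i _; apply: arith_ratio.
by rewrite lt0r_neq0// Phibar_gt0.
Qed.

Lemma pBP1_level (thr : I -> R) :
  pO c 2 (fun i => thr i * Phibar (d0 i) - Phibar (x i)) ->
  pO c 2 (fun i => Pr 1 (mu i) [set z | p1 (idx c i) z < thr i] -
    Phibar (x i - sigma2 * tr0 c h i - tr0 c h i +
            slope h s c s mu x i * del i)).
Proof.
exact: (profile_prob hp sp ok sp measurable_p1 profile_p1 hmu hmu2 bx).
Qed.

End double_bootstrap.

Lemma pBP2_near I (c : ctx R I) (y mu : I -> pt R m) : ctx_ok c ->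
  pO c 0 (fun i => `|(y i).1|) -> pO c 1 (fun i => `|(mu i).1 - (y i).1|) ->
  pO c 2 (height h c mu) -> bdd c (height h c y) ->
  pO c 2 (fun i =>
    pBP2_at grid w sigma2 (muhat (idx c i)) (H (idx c i)) (S (idx c i)) (y i) (mu i) *
      Phibar (offset h s h c y i) -
    Phibar (height h c y i + -1 * tr0 c h i)).
Proof.
move=> ok hy hmuy hmu2 bh.
pose x i := height h c y i + sigma2 * tr0 c h i.
have htr : pO c 1 (tr0 c h) by exact: np_pOtr.
have bx : bdd c x by apply: bdd_add => //; exact: (pO_bdd ok (pO_scale sigma2 ok htr)).
have bo := bdd_offset hp sp sp ok (close_moderate ok hy hmuy).
have hthr := pBP1_near ok hy sigma2 bo (Pr_selection_surface ok hy hmuy hmu2) bh.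
have h1 := pBP1_level ok hy hmuy hmu2 bx hthr.
apply: (ratio_near ok hy hmuy hmu2 bx).
  have := pO_scale (-1 - sigma2) ok htr; apply: pO_ext => i _.
  by rewrite /x mulrBl opprD addrACA subrr add0r.
(* The observed p-value is matched by an argument x containing sigma2 h_ii, which the level set
   formula takes away again: here [sigma2] disappears. *)
have gE i : x i - sigma2 * tr0 c h i - tr0 c h i = height h c y i + -1 * tr0 c h i.
  by rewrite /x addrK mulN1r.
by apply: pO_ext h1 => i _; rewrite gE.
Qed.

Local Notation p2 := (fun n => pBP2 grid w sigma2 (muhat n) (H n) (S n)).

Lemma measurable_p2 n : measurable_fun setT (p2 n).
Proof.
have [mm _] := muP.
by apply: measurable_pBP2 => //; [exact: np_measurable|exact: measurable_S].
Qed.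

Let arith_small (N N' rat e v : R) : 0 <= rat -> `|rat - 1| <= e ->
  N <= N' -> `|N' - v| <= e -> v <= e -> 0 < e -> 4 * e <= 1 ->
  N * rat <= 4 * e.
Proof.
rewrite !ler_norml => r0 /andP[_ r2] NN /andP[_ n2] ve e0 e1.
have : N * rat <= (2 * e) * rat by rewrite ler_wpM2r//; lra.
have : (2 * e) * rat <= (2 * e) * 2 by rewrite ler_wpM2l//; lra.
lra.
Qed.

Let arith_large (N N' rat e v : R) : 0 <= rat -> `|rat - 1| <= e ->
  N' <= N -> `|N' - v| <= e -> 1 - e <= v -> 0 < e -> 4 * e <= 1 ->
  1 - 4 * e <= N * rat.
Proof.
rewrite !ler_norml => r0 /andP[r1 _] NN /andP[n1 _] ve e0 e1.
have : (1 - 2 * e) * rat <= N * rat by rewrite ler_wpM2r//; lra.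
have : (1 - 2 * e) * (1 - e) <= (1 - 2 * e) * rat by rewrite ler_wpM2l//; lra.
have : 0 <= e * e by rewrite mulr_ge0//; lra.
lra.
Qed.

Let arith_div (a b q : R) : 0 < q -> (a * q <= b -> a <= b / q) /\
  (b <= a * q -> b / q <= a).
Proof. by move=> q0; rewrite ler_pdivlMr// ler_pdivrMr. Qed.

Let arith_offsets (hh ss th ts : R) : ts - th = hh - ss - th - (hh - ss - ts).
Proof. by ring. Qed.

Section tails.
Context {I : Type} (c : ctx R I) (y : I -> pt R m).
Hypotheses (ok : ctx_ok c) (md : moderate c y).
Let mu i := muhat (idx c i) (y i).
Let hy : pO c 0 (fun i => `|(y i).1|) := md.1.
Let hmuy : pO c 1 (fun i => `|(mu i).1 - (y i).1|) := (muhat_near ok md).1.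
Let hmu2 : pO c 2 (height h c mu) := (muhat_near ok md).2.

(** Far from the surface the observed [pBP1] has no expansion to serve as threshold. These
    thresholds, built from a fixed X, replace it there and have rejection probability close to
    [Phibar X]. *)
Lemma pBP1_level_cst (X e : R) : 0 < e -> ev c (fun i =>
  `|Pr 1 (mu i) [set z | p1 (idx c i) z < Phibar X / Phibar (offset h s s c y i)] -
    Phibar X| <= e).
Proof.
move=> e0.
have bo := bdd_offset hp sp sp ok hy.
have [b [b0 hb]] := Phibar_lb bo.
have hthr : pO c 2 (fun i => Phibar X / Phibar (offset h s s c y i) *
    Phibar (offset h s s c mu i) - Phibar X).
  have h1 := pO_Phibar (offset_close ok hy hmuy s).
  have := pO_mulr ok (bdd_pO (bdd_div b0 hb (bdd_cst c (Phibar X)))) h1.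
  apply: pO_ext => i _; rewrite mulrBr; congr (_ - _).
  by rewrite divfK// lt0r_neq0// Phibar_gt0.
have bX : bdd c (fun=> X) by exact: bdd_cst.
have h1 := pBP1_level ok hy hmuy hmu2 bX hthr.
have bsl := bdd_slope hp sp ok sp (close_moderate ok hy hmuy) bX.
have htr : pO c 1 (tr0 c h) by exact: np_pOtr.
have h2 : pO c 1 (fun i => Phibar (X - sigma2 * tr0 c h i - tr0 c h i +
    slope h s c s mu (fun=> X) i * (tr0 c h i - tr0 c s i)) - Phibar X).
  apply: pO_Phibar.
  have := pO_sub ok (pO_mulr ok (bdd_pO bsl) (pO_sub ok htr (np_pOtr ok sp)))
    (pO_add ok (pO_scale sigma2 ok htr) htr).
  by apply: pO_ext => i _; move: (slope _ _ _ _ _ _ _) (tr0 c h i) (tr0 c s i) => a b' c'; ring.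
have h3 := pO_add ok (pO_weak ok (ltnW (ltnSn 1)) h1) h2.
apply: (ev_mono (pO_small ok h3 e0)) => i _.
by rewrite addrA subrK.
Qed.

Lemma offset_ratio : pO c 1 (fun i =>
  Phibar (offset h s h c y i) / Pr 1 (mu i) (S (idx c i)) - 1).
Proof.
have bo := bdd_offset hp sp sp ok hy.
have [b [b0 hb]] := Phibar_lb bo.
have h1 : pO c 1 (fun i => Phibar (offset h s h c y i) - Phibar (offset h s s c y i)).
  apply: pO_Phibar.
  have := pO_sub ok (np_pOtr ok sp) (np_pOtr ok hp); apply: pO_ext => i _.
  exact: arith_offsets.
have h2 := pO_weak ok (ltnW (ltnSn 1)) (Pr_selection_close ok hy hmuy hmu2).
have := pO_div ok b0 hb (bdd_Phibar c _) h1 h2.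
by apply: pO_ext => i _; rewrite [X in _ - X]divff// lt0r_neq0// Phibar_gt0.
Qed.

(** The probability of {p1 < thr} is monotone in thr. For y far below or above the surface the
    observed p-value passes one of the thresholds built from X or -X, whose probabilities are close
    to 0 and 1. *)
Lemma p2_tails (e : R) : 0 < e -> exists B, ev c (fun i =>
  (B <= (y i).2 -> p2 (idx c i) (y i) * Phibar (offset h s h c y i) <= e) /\
  ((y i).2 <= - B -> 1 - e <= p2 (idx c i) (y i) * Phibar (offset h s h c y i))).
Proof.
move=> e0; pose e1 := Num.min e 1 / 4.
have m0 : 0 < Num.min e 1 by rewrite lt_min e0 ltr01.
have e10 : 0 < e1 by rewrite divr_gt0.
have e14 : 4 * e1 = Num.min e 1 by rewrite /e1 mulrC divfK.
have e1e : 4 * e1 <= e by rewrite e14 ge_min lexx.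
have e11 : 4 * e1 <= 1 by rewrite e14 ge_min lexx orbT.
pose X := 2 / e1.
have Xe : Phibar X <= e1 by exact: ltW (Phibar_small e10).
(* The tolerance [Phibar X] makes both tail alternatives comparisons with these thresholds, as 1 -
   Phibar(X) = Phibar(-X). *)
have [_ /(_ _ (Phibar_gt0 X))[B hB]] := profile_p1 ok md.
have lv1 := pBP1_level_cst X e10; have lv2 := pBP1_level_cst (- X) e10.
have rat := pO_small ok offset_ratio e10.
exists B; apply: (ev2 (ev_and hB rat) (ev_and lv1 lv2)).
move=> i _ [[t1 t2] {}rat] [{}lv1 {}lv2].
have qpos := Phibar_gt0 (offset h s s c y i).
have [q1 _] := arith_div (p1 (idx c i) (y i)) (Phibar X) qpos.
have [_ q2] := arith_div (p1 (idx c i) (y i)) (Phibar (- X)) qpos.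
have pE : p2 (idx c i) (y i) * Phibar (offset h s h c y i) =
  Pr 1 (mu i) [set z | p1 (idx c i) z < p1 (idx c i) (y i)] *
  (Phibar (offset h s h c y i) / Pr 1 (mu i) (S (idx c i))).
  by rewrite /pBP2 /pBP2_at mulrAC mulrA.
have r0 : 0 <= Phibar (offset h s h c y i) / Pr 1 (mu i) (S (idx c i)).
  exact: divr_ge0 (ltW (Phibar_gt0 _)) (Pr_ge0 _ _ _).
rewrite pE; split => hv.
  apply: le_trans e1e; apply: (arith_small r0 rat _ lv1 Xe e10 e11).
  apply: Pr_le; [exact: measurable_p1_lt..|].
  by move=> z /= hz; apply: lt_le_trans hz (q1 (t1 hv)).
have Xe' : 1 - e1 <= Phibar (- X) by rewrite PhibarN lerD2l lerN2.
apply: (@le_trans _ _ (1 - 4 * e1)); first by rewrite lerD2l lerN2.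
apply: (arith_large r0 rat _ lv2 Xe' e10 e11).
apply: Pr_le; [exact: measurable_p1_lt..|].
move=> z /= hz; apply: lt_le_trans hz (q2 _).
by rewrite PhibarN; exact: t2.
Qed.

End tails.

Lemma profile_p2 : profile h s p2 h (-1).
Proof.
move=> I c y ok md; have [m1 m2] := muhat_near ok md; have [y1 _] := md.
split=> [bh|e]; last exact: p2_tails.
exact: (pBP2_near ok y1 m1 m2 bh).
Qed.

End bootstrap_profiles.

(** * Accuracy of p-values with a known profile *)

Section conclusions.
Context {R : realType} {m : nat}.

(** With weight 1, an order [pO] is a plain order without logarithmic factors. *)
Definition seq_ctx : ctx R nat := Ctx id (fun=> True) (fun=> 1).

Lemma ok_unit I (c : ctx R I) : (forall i, wt c i = 1) -> ctx_ok c.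
Proof.
move=> w1; exists 1, 0%N; apply: evI => i _.
by rewrite w1 expr0 mulr1 lexx.
Qed.

Lemma ok_seq : ctx_ok seq_ctx. Proof. exact: ok_unit. Qed.

Lemma pO_unit I (c : ctx R I) k f : (forall i, wt c i = 1) -> pO c k f ->
  exists C, ev c (fun i => `|f i| <= C * rsqrt (idx c i) ^+ k).
Proof.
move=> w1 [C [q [_ h]]]; exists C; apply: (ev_mono h) => i _.
by rewrite w1 expr1n mulr1.
Qed.

Lemma pO_aeq (f g : nat -> R) : pO seq_ctx 2 (fun n => f n - g n) -> aeq f g.
Proof.
move=> /pO_unit[//|C [N h]]; apply/isOP; exists C, N => n Nn.
rewrite -rsqrt_sqr [X in _ * X]ger0_norm ?exprn_ge0 ?rsqrt_ge0//; exact: (h n Logic.I Nn).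
Qed.

Lemma aeq_pO (f g : nat -> R) : aeq f g -> pO seq_ctx 2 (fun n => f n - g n).
Proof.
move=> h; apply: (isO_pO seq_ctx (k := 2) (f := fun n => f n - g n)).
by move: h; rewrite /aeq (_ : (fun n : nat => n%:R^-1) = (fun n => rsqrt n ^+ 2))//;
  apply/funext => n; rewrite rsqrt_sqr.
Qed.

Lemma pO_solve I (c : ctx R I) k (q d P : I -> R) : ctx_ok c -> bdd c d ->
  pO c k (fun i => q i * Phibar (d i) - P i) ->
  pO c k (fun i => q i - P i / Phibar (d i)).
Proof.
move=> ok bd h; have [e [e0 he]] := Phibar_lb bd.
have := pO_mulr ok (bdd_pO (bdd_div e0 he (bdd_cst c 1))) h.
apply: pO_ext => i _; rewrite mul1r mulrBr [X in X - _]mulrC mulfK.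
  by rewrite [X in _ - X]mulrC.
exact: lt0r_neq0 (Phibar_gt0 _).
Qed.

Section one_pair.
Variables h s : nat -> 'rV[R]_m -> R.
Hypotheses (hp : nearly_parallel h) (sp : nearly_parallel s).

Section accuracy.
Variables (p : nat -> pt R m -> R) (f : nat -> 'rV[R]_m -> R) (tau : R).
Hypotheses (fp : nearly_parallel f)
  (mp : forall n, measurable_fun setT (p n)) (pp : profile h s p f tau).
Variables (alpha B : R).
Hypothesis alpha01 : 0 < alpha < 1.

Definition surface_ctx : ctx R (nat * pt R m) :=
  Ctx fst (fun j => boundary (region (h j.1)) j.2 /\ `|j.2| <= B) (fun=> 1).

Let c := surface_ctx.
Let ok : ctx_ok c. Proof. exact: ok_unit. Qed.
Let mu (j : nat * pt R m) := j.2.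

Lemma surface_moderate : pO c 0 (fun j => `|(mu j).1|).
Proof.
apply: bdd_pO; exists B; apply: evI => j [_ jB]; rewrite normr_id.
by apply: le_trans jB; rewrite [leRHS]prod_normE le_max lexx.
Qed.

Let hmu := surface_moderate.

Lemma surface_height j : dom c j -> height h c mu j = 0.
Proof.
move=> [/boundary_region bj _]; rewrite /height bj ?addNr//.
exact: smooth_continuous (np_smooth hp _).
Qed.

Let hmu2 : pO c 2 (height h c mu).
Proof.
apply: pO_ext (pO_scale 0 ok (pO_rsqrt c 2)) => j dj.
by rewrite mul0r surface_height.
Qed.

Let hmuy : pO c 1 (fun j => `|(mu j).1 - (mu j).1|).
Proof.
apply: pO_ext (pO_scale 0 ok (pO_rsqrt c 1)) => j dj.
by rewrite mul0r subrr normr0.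
Qed.

Lemma surface_selection : pO c 2 (fun j =>
  Pr 1 (mu j) (~` region (s (idx c j))) - Phibar (offset h s s c mu j)).
Proof. exact: (Pr_selection_surface sp ok hmu hmuy hmu2). Qed.

Let sel := surface_selection.
Let d0 := offset h s f c mu.
Let bd0 : bdd c d0 := bdd_offset hp sp fp ok hmu.

(** The argument x matching the constant threshold alpha at the surface point. *)
Definition level (j : nat * pt R m) : R := Phibar_inv (alpha * Phibar (d0 j)).

Lemma levelE j : Phibar (level j) = alpha * Phibar (d0 j).
Proof.
have /andP[a0 a1] := alpha01; have p0 := Phibar_gt0 (d0 j).
apply: Phibar_invE; rewrite mulr_gt0//= -[ltRHS]mulr1.
by rewrite ltr_pM// ?ltW// Phibar_lt1.
Qed.

Lemma bdd_level : bdd c level.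
Proof.
have /andP[a0 a1] := alpha01; have [b [b0 hb]] := Phibar_lb bd0.
have ab0 : 0 < alpha * b by rewrite mulr_gt0.
have [X1 hX1] : exists X, Phibar X < alpha * b.
  by exists (2 / (alpha * b)); exact: Phibar_small.
have [X2 hX2] := Phibar_onto alpha01.
exists (`|X1| + `|X2|); apply: (ev_mono hb) => j _ hj.
have l1 : level j <= X1.
  by rewrite -Phibar_le levelE (le_trans (ltW hX1))// ler_wpM2l// ltW.
have l2 : X2 <= level j.
  rewrite -Phibar_le levelE hX2 -[leRHS]mulr1 ler_wpM2l//; first exact: ltW.
  exact: ltW (Phibar_lt1 _).
have := ler_norm X1; have := ler_norm (- X2); rewrite normrN.
have := normr_ge0 X1; have := normr_ge0 X2; rewrite ler_norml.
by move: (level j) l1 l2 => l l1 l2 *; apply/andP; split; lra.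
Qed.

Let bl := bdd_level.

Lemma level_prob : pO c 2 (fun j =>
  Pr 1 (mu j) [set y | p (idx c j) y < alpha] -
  Phibar (level j - tau * tr0 c h j - tr0 c h j +
    slope h s c f mu level j * (tr0 c h j - tr0 c s j))).
Proof.
have thr : pO c 2 (fun j => alpha * Phibar (d0 j) - Phibar (level j)).
  by apply: pO_ext (pO_scale 0 ok (pO_rsqrt c 2)) => j dj; rewrite levelE subrr mul0r.
exact: (profile_prob hp sp ok fp mp pp hmu hmu2 bl thr).
Qed.

Let bsl := bdd_slope hp sp ok fp hmu bl.
Let htr : pO c 1 (tr0 c h) := np_pOtr ok hp.
Let hdel : pO c 1 (fun j => tr0 c h j - tr0 c s j) :=
  pO_sub ok htr (np_pOtr ok sp).

Let os := offset h s s c mu.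
Let bos : bdd c os := bdd_offset hp sp sp ok hmu.

Let arith_expansion (N PE PE' PL PO PO' P0 fl f0 K t th ts tf : R) :
  PL = alpha * P0 -> fl * K = alpha * f0 -> PE = PE' -> PO' = PO ->
  N - PE + (PE' - PL + fl * (K * (th - ts) - (t + 1) * th)) -
    alpha * (PO' - P0 + f0 * (tf - ts)) =
  N - alpha * PO - (fl * ((t + 1) * th) - alpha * f0 * (th - tf)).
Proof.
move=> e1 e2 -> ->; have -> : fl * (K * (th - ts) - (t + 1) * th) =
    alpha * f0 * (th - ts) - fl * ((t + 1) * th) by rewrite -e2; ring.
by rewrite e1; ring.
Qed.

Let arith_offset (hh ss fh ts : R) : hh - ss - fh + (fh - ts) = hh - ss - ts.
Proof. by ring. Qed.

Let arith_level (l t th K d : R) :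
  l - t * th - th + K * d = l + (K * d - (t + 1) * th).
Proof. by ring. Qed.

(** Since phi(level) times the slope equals alpha phi(d0), the slope term contributes -alpha phi(d0)
    (h_ii - s_ii), while passing from d0 to the selection offset contributes -alpha phi(d0) (f_ii -
    s_ii) on the other side. In the difference s_ii cancels. *)
Lemma level_expansion : pO c 2 (fun j =>
  Pr 1 (mu j) [set y | p (idx c j) y < alpha] - alpha * Phibar (os j) -
  (phi (level j) * ((tau + 1) * tr0 c h j) -
   alpha * phi (d0 j) * (tr0 c h j - tr0 c f j))).
Proof.
have ht1 : pO c 1 (fun j => (tau + 1) * tr0 c h j) by exact: pO_scale.
have hsd : pO c 1 (fun j => slope h s c f mu level j * (tr0 c h j - tr0 c s j) -
    (tau + 1) * tr0 c h j).
  by apply: pO_sub => //; exact: (pO_mulr ok (bdd_pO bsl) hdel).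
have hf := pO_sub ok (np_pOtr ok fp) (np_pOtr ok sp).
have h1 := pO_Phibar_taylor level ok hsd.
have h2 := pO_Phibar_taylor d0 ok hf.
have := pO_sub ok (pO_add ok level_prob h1) (pO_scale alpha ok h2).
apply: pO_ext => j _.
have slE : phi (level j) * slope h s c f mu level j = alpha * phi (d0 j).
  rewrite /slope levelE -/(d0 j) mulrA [phi _ * _]mulrC divfK; last first.
    exact: lt0r_neq0 (phi_gt0 _).
  by rewrite -mulrA [Phibar _ * _]mulrC divfK// lt0r_neq0// Phibar_gt0.
apply: arith_expansion (levelE j) slE _ _.
  by congr Phibar; exact: arith_level.
by congr Phibar; exact: arith_offset.
Qed.

Lemma level_ratio k :
  pO c k.+1 (fun j => Pr 1 (mu j) [set y | p (idx c j) y < alpha] -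
    alpha * Phibar (os j)) -> (k <= 1)%N ->
  pO c k.+1 (fun j => Pr 1 (mu j) [set y | p (idx c j) y < alpha] /
     Pr 1 (mu j) (~` region (s (idx c j))) - alpha).
Proof.
move=> h1 k1; have [b [b0 hb]] := Phibar_lb bos.
have ba : bdd c (fun j => alpha * Phibar (os j)).
  by apply: bdd_mul; [exact: bdd_cst|exact: bdd_Phibar].
have k2 : (k.+1 <= 2)%N by [].
have := pO_div ok b0 hb ba h1 (pO_weak ok k2 sel); apply: pO_ext => j _.
by rewrite [alpha * _ / _]mulfK// lt0r_neq0// Phibar_gt0.
Qed.

Lemma level_first_order : pO c 1 (fun j =>
  Pr 1 (mu j) [set y | p (idx c j) y < alpha] /
     Pr 1 (mu j) (~` region (s (idx c j))) - alpha).
Proof.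
apply: level_ratio => //.
have h1 : pO c 1 (fun j => phi (level j) * ((tau + 1) * tr0 c h j) -
    alpha * phi (d0 j) * (tr0 c h j - tr0 c f j)).
  apply: pO_sub => //.
    by apply: (pO_mulr ok (bdd_pO (bdd_phi c level))); exact: pO_scale.
  apply: (pO_mulr ok (bdd_pO (bdd_mul (bdd_cst c alpha) (bdd_phi c d0)))).
  exact: (pO_sub ok htr (np_pOtr ok fp)).
have := pO_add ok (pO_weak ok (ltnW (ltnSn 1)) level_expansion) h1.
by apply: pO_ext => j _; rewrite subrK.
Qed.

End accuracy.

Lemma accurate_of_pO k (a : nat -> R) (p : nat -> pt R m -> R) :
  (forall n, a n = rsqrt n ^+ k) ->
  (forall alpha B, 0 < alpha < 1 -> pO (surface_ctx B) k (fun j =>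
     Pr 1 j.2 [set y | p j.1 y < alpha] / Pr 1 j.2 (~` region (s j.1)) - alpha)) ->
  accurate a (fun n => region (h n)) (fun n => ~` region (s n)) p.
Proof.
move=> aE hO alpha a01 B.
have [//|C [N hC]] := pO_unit _ (hO alpha B a01).
exists C; exists N => // n /= Nn mu bmu muB; rewrite aE.
exact: (hC (n, mu) (conj bmu muB) Nn).
Qed.

Lemma profile_first_order p f tau : nearly_parallel f ->
  (forall n, measurable_fun setT (p n)) -> profile h s p f tau ->
  first_order_accurate (fun n => region (h n)) (fun n => ~` region (s n)) p.
Proof.
move=> fp mp pp; apply: (@accurate_of_pO 1) => [n|alpha B a01].
  by rewrite expr1.
exact: (level_first_order fp mp pp B a01).
Qed.

Lemma profile_second_order p :
  (forall n, measurable_fun setT (p n)) -> profile h s p h (-1) ->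
  second_order_accurate (fun n => region (h n)) (fun n => ~` region (s n)) p.
Proof.
move=> mp pp; apply: (@accurate_of_pO 2) => [n|alpha B a01].
  by rewrite rsqrt_sqr.
apply: (level_ratio (k := 1)) => //.
have := level_expansion hp mp pp B a01; apply: pO_ext => j _.
by rewrite addNr mul0r mulr0 subrr mulr0 subrr subr0.
Qed.

End one_pair.
End conclusions.

(** * Expansions at an axis point and comparison of the p-values *)

Section claims.
Context {R : realType} {m : nat}.
Variables (grid : seq R) (w : R -> R).
Hypotheses (gs : (1 < size grid)%N) (gu : uniq grid)
  (g0 : forall t, t \in grid -> 0 < t) (w0 : forall t, t \in grid -> 0 < w t).

Lemma psi_setC (D : set (pt R m)) y t : measurable D ->
  psi grid w t (~` D) y = - psi grid w t D y.
Proof.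
move=> mD; have [g [c [_ _ _ H]]] := psi_weights t gs gu g0 w0.
rewrite !H -sumrN; apply: eq_bigr => u _; rewrite /psi_pos Pr_setC//.
by rewrite Phibar_invN mulrN mulrN.
Qed.

Variables h s : nat -> 'rV[R]_m -> R.
Hypotheses (hp : nearly_parallel h) (sp : nearly_parallel s).
Local Notation H n := (region (h n)).
Local Notation S n := (~` region (s n)).
Local Notation c := seq_ctx.

Lemma surface_close_level (mu : nat -> pt R m) :
  isO rsqrt (fun n => `|(mu n).1|) ->
  aeq (fun n => (mu n).2) (fun n => - h n (mu n).1) ->
  pO c 1 (fun n => `|(mu n).1 - 0|) /\ pO c 2 (height h c mu).
Proof.
move=> h1 h2; split.
  have h1' : isO (fun n => rsqrt n ^+ 1) (fun n => `|(mu n).1|) by [].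
  by have := isO_pO c h1'; apply: pO_ext => n _; rewrite subr0.
by have := aeq_pO h2; apply: pO_ext => n _; rewrite opprK.
Qed.

Section axis_point.
Variables (r0 : nat -> R) (mu : nat -> pt R m).
Hypotheses (hr : isO (fun=> 1) r0)
  (hmuy : pO c 1 (fun n => `|(mu n).1 - 0|)) (hmu2 : pO c 2 (height h c mu)).
Let y n : pt R m := (0, - r0 n).

Let br : bdd c r0.
Proof. exact: (isO_bdd c hr). Qed.

Let hy : pO c 0 (fun n => `|(y n).1|).
Proof. by apply: pO_ext (pO_cst c 0) => n _; rewrite normr0. Qed.

Let bh : bdd c (height h c y).
Proof.
apply: bdd_add; first exact: bdd_opp.
exact: (np_bdd ok_seq hp hy).
Qed.

Let arith_height (r a b : R) : - r + a + b = a - r + b.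
Proof. by ring. Qed.

Lemma pBP1_claim sigma2 :
  aeq (fun n => pBP1_at grid w sigma2 (H n) (S n) (y n) (mu n))
    (fun n => Phibar (taylor0 (h n) - r0 n + taylor2_tr (h n) * sigma2) /
              Phibar (taylor0 (h n) - taylor0 (s n) - taylor2_tr (s n))).
Proof.
apply: pO_aeq; have bo := bdd_offset hp sp sp ok_seq hy.
have sel := Pr_selection_close hp sp ok_seq hy hmuy hmu2.
have := pO_solve ok_seq bo (pBP1_near hp gs gu g0 w0 ok_seq hy sigma2 bo sel bh).
apply: pO_ext => n _; rewrite [taylor2_tr (h n) * _]mulrC.
by congr (_ - Phibar _ / _); exact: arith_height.
Qed.

Variable muhat : nat -> pt R m -> pt R m.
Hypothesis muP : approx_proj h muhat.

Let target n := Phibar (taylor0 (h n) - r0 n - taylor2_tr (h n)) /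
              Phibar (taylor0 (h n) - taylor0 (s n) - taylor2_tr (h n)).

Lemma pBP2_claim_pO sigma2 : pO c 2 (fun n =>
  pBP2_at grid w sigma2 (muhat n) (H n) (S n) (y n) (mu n) - target n).
Proof.
have bo := bdd_offset hp sp hp ok_seq hy.
have := pO_solve ok_seq bo
  (pBP2_near hp sp gs gu g0 w0 muP sigma2 ok_seq hy hmuy hmu2 bh).
apply: pO_ext => n _; congr (_ - Phibar _ / _).
by rewrite mulN1r; exact: arith_height.
Qed.

(** Complementation changes the sign of psi, so psi_0(S) is r_0 - s_0 up to O(n^-1); added to
    psi_(-1)(H), it cancels r_0 and leaves the offset with h_ii. *)
Lemma pSI_claim_pO : pO c 2 (fun n => pSI grid w (H n) (S n) (y n) - target n).
Proof.
have bh' : bdd c (fun n => (y n).2 + s n (y n).1).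
  by apply: bdd_add; [exact: bdd_opp|exact: (np_bdd ok_seq sp hy)].
have n1 := psi_near ok_seq hp gs gu g0 w0 (-1) hy bh.
have n2 := psi_near ok_seq sp gs gu g0 w0 0 hy bh'.
have a1 : pO c 2 (fun n => psi grid w (-1) (H n) (y n) -
    (taylor0 (h n) - r0 n - taylor2_tr (h n))).
  apply: pO_ext n1 => n _; congr (_ - _).
  by rewrite mulN1r; exact: arith_height.
have a2 : pO c 2 (fun n => psi grid w (-1) (H n) (y n) + psi grid w 0 (S n) (y n) -
    (taylor0 (h n) - taylor0 (s n) - taylor2_tr (h n))).
  have := pO_sub ok_seq a1 n2; apply: pO_ext => n _.
  rewrite psi_setC; last exact: np_measurable.
  move: (psi _ _ _ _ _) (psi _ _ _ _ _) => u v; rewrite /= mul0r addr0 /taylor0.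
  by move: (h n 0) (s n 0) (r0 n) (taylor2_tr _) => *; ring.
have bo := bdd_offset hp sp hp ok_seq hy.
have [e [e0 he]] := Phibar_lb bo.
exact: (pO_div ok_seq e0 he (bdd_Phibar c _) (pO_Phibar a1) (pO_Phibar a2)).
Qed.

Lemma aeq_target (f g : nat -> R) : pO c 2 (fun n => f n - target n) ->
  pO c 2 (fun n => g n - target n) -> aeq f g.
Proof.
move=> h1 h2; apply: pO_aeq; have := pO_sub ok_seq h1 h2.
by apply: pO_ext => n _; rewrite opprB addrA subrK.
Qed.

End axis_point.

Variable muhat : nat -> pt R m -> pt R m.
Hypothesis muP : approx_proj h muhat.
Variable sigma2 : R.
Local Notation p1 := (fun n => pBP1 grid w sigma2 (muhat n) (H n) (S n)).
Local Notation p2 := (fun n => pBP2 grid w sigma2 (muhat n) (H n) (S n)).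

Definition ball_ctx (B : R) : ctx R (nat * pt R m) :=
  Ctx fst (fun j => `|j.2| <= B) (fun=> 1).

Let arith_offsets (hh ss th ts : R) : th - ts = hh - ss - ts - (hh - ss - th).
Proof. by ring. Qed.

(** The two profiles differ only through multiples of traces inside [Phibar], which are
    O(n^(-1/2)). *)
Lemma p1_p2_close (B : R) :
  pO (ball_ctx B) 1 (fun j => p1 j.1 j.2 - p2 j.1 j.2).
Proof.
set cB := ball_ctx B; pose y (j : nat * pt R m) := j.2.
have ok : ctx_ok cB by exact: ok_unit.
have y1 : bdd cB (fun j => `|(y j).1|).
  exists B; apply: evI => j jB; rewrite normr_id.
  by apply: le_trans jB; rewrite [leRHS]prod_normE le_max lexx.
have y2 : bdd cB (fun j => (y j).2).
  exists B; apply: evI => j jB.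
  by apply: le_trans jB; rewrite [leRHS]prod_normE le_max lexx orbT.
have hy := bdd_pO y1.
have md : moderate cB y by split => //; exact: bdd_pO.
have bh : bdd cB (height h cB y) by apply: bdd_add => //; exact: (np_bdd ok hp hy).
have [/(_ bh) a1 _] := profile_p1 hp sp gs gu g0 w0 muP sigma2 ok md.
have [/(_ bh) a2 _] := profile_p2 hp sp gs gu g0 w0 muP sigma2 ok md.
have b1 := bdd_offset hp sp sp ok hy.
have b2 := bdd_offset hp sp hp ok hy.
have s1 := pO_weak ok (ltnW (ltnSn 1)) (pO_solve ok b1 a1).
have s2 := pO_weak ok (ltnW (ltnSn 1)) (pO_solve ok b2 a2).
have htr : pO cB 1 (tr0 cB h) by exact: np_pOtr.
have [e [e0 he]] := Phibar_lb b2.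
have n1 : pO cB 1 (fun j => Phibar (height h cB y j + sigma2 * tr0 cB h j) -
    Phibar (height h cB y j + -1 * tr0 cB h j)).
  apply: pO_Phibar; have := pO_scale (sigma2 + 1) ok htr; apply: pO_ext => j _.
  by move: (height _ _ _ _) (tr0 cB h j) => *; ring.
have d1 : pO cB 1 (fun j => Phibar (offset h s s cB y j) - Phibar (offset h s h cB y j)).
  apply: pO_Phibar; have := pO_sub ok htr (np_pOtr ok sp); apply: pO_ext => j _.
  exact: arith_offsets.
have q := pO_div ok e0 he (bdd_Phibar cB _) n1 d1.
have := pO_add ok (pO_sub ok s1 s2) q; apply: pO_ext => j _.
move: (Phibar _ / _) (Phibar _ / _) => u v.
by move: (p1 _ _) (p2 _ _) => a b /=; ring.
Qed.

Lemma Pr_outside_le (B e : R) : 0 < e -> exists B' : R, forall (mu : pt R m) (D : set (pt R m)),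
  `|mu| <= B -> measurable D -> (forall y, D y -> B' < `|y|) -> Pr 1 mu D <= e.
Proof.
move=> e0; pose K : R := m.+1%:R * 2; have K0 : 0 < K by rewrite mulr_gt0.
pose L := 1 + 2 * (K / e); have Ke : 0 < K / e by rewrite divr_gt0.
have L0 : 0 <= L by rewrite /L; lra.
exists (B + L) => mu D muB mD DB; rewrite PrE.
apply: (@le_trans _ _ (fine (gauss m (outside L)))).
  apply: prob_fine_le; last 2 first.
  - exact: measurable_outside.
  - move=> z /= /DB; rewrite /affine sqrtr1 scale1r mul1r prod_normE/=.
    move: muB; rewrite prod_normE ge_max => /andP[m1 m2].
    rewrite lt_max => /orP[] hz; [left|right] => /=.
      by have := ler_normD mu.1 z.1; lra.
    by have := ler_normD mu.2 z.2; lra.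
  by rewrite -[X in measurable X]setTI; exact: measurable_affine.
apply: (le_trans (gauss_tail _ L0)); rewrite mulrA -/K.
rewrite expRN ler_pdivrMr ?expR_gt0// mulrC -ler_pdivrMr// mulrC.
apply: le_trans (expR_ge1Dx _); rewrite [_^-1 * _]mulrC.
by rewrite /L; move: (K / e) Ke => u u0; rewrite sqrrD; nra.
Qed.

Lemma p1_p2_isOp : isOp rsqrt (fun n y => p1 n y - p2 n y).
Proof.
move=> B e e0; have [B' hB'] := Pr_outside_le B e0.
have [//|C [N hC]] := pO_unit _ (p1_p2_close B').
exists C; exists N => // n /= Nn mu muB; apply: hB' => //.
  apply: (@measurable_gt_cst _ _ (fun y => `|p1 n y - p2 n y|)).
  apply: measurableT_comp => //; apply: measurable_funB.
    exact: measurable_p1.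
  exact: measurable_p2.
move=> y /=; rewrite !ltNge => /negP hy; apply/negP => yB; apply: hy.
by have := hC (n, y) yB Nn; rewrite expr1.
Qed.

End claims.

(** * Failure of second order accuracy *)

(* With h = 0 the error of p_BP1 is, to leading order, alpha times the ratio
   phi / Phibar at -s_0 - s_ii times s_ii, whatever sigma2 is; for
   s(u) = n^(-1/2) u_1^2 this is of order n^(-1/2). *)
Section counterexample.
Context {R : realType} {m : nat} (i : 'I_m).

Definition coord (u : 'rV[R]_m) : R := u 0 i.

(** The lower coefficients make the family closed under partial derivatives, so that all of them are
    computed by one rule. *)
Definition parabola (a b d : R) (u : 'rV[R]_m) : R :=
  a * (coord u * coord u) + b * coord u + d.

Lemma parabolaE a b d : parabola a b d =
  (a \*: (coord * coord) + b \*: coord + cst d :> ('rV[R]_m -> R)).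
Proof. by apply/funext => u. Qed.

Lemma is_derive_coord (u v : 'rV[R]_m) :
  is_derive u v coord (coord v).
Proof.
have df := @differentiable_coord R _ _ u 0 i.
apply: DeriveDef; first exact: diff_derivable.
have lf : linear (fun u : 'rV[R]_m => u 0 i : R^o) by move=> a x y; rewrite !mxE.
pose lX := GRing.isLinear.Build _ _ _ _ _ lf.
pose f : {linear 'rV[R]_m -> R^o} := HB.pack (fun u : 'rV[R]_m => u 0 i : R^o) lX.
rewrite deriveE//.
have := @diff_lin R _ _ f u; rewrite /f /= => -> //.
exact: coord_continuous.
Qed.

Lemma is_derive_parabola a b d (u v : 'rV[R]_m) :
  is_derive u v (parabola a b d)
    (a *: (coord u *: coord v + coord u *: coord v) + b *: coord v + 0).
Proof.
have dX := is_derive_coord u v.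
rewrite parabolaE; apply: is_deriveD; apply: is_deriveD.
Qed.

Lemma differentiable_parabola a b d u : differentiable (parabola a b d) u.
Proof.
have dX : differentiable coord u by exact: differentiable_coord.
rewrite parabolaE.
apply: differentiableD; last exact: differentiable_cst.
by apply: differentiableD; apply: differentiableZ => //; exact: differentiableM.
Qed.

Lemma derive_parabola a b d j :
  'D_(delta_mx 0 j) (parabola a b d) =
  parabola 0 (2 * a * (j == i)%:R) (b * (j == i)%:R).
Proof.
apply/funext => u; have [_ ->] := is_derive_parabola a b d u (delta_mx 0 j).
have -> : coord (delta_mx 0 j) = (j == i)%:R.
  by rewrite /coord mxE eqxx/= eq_sym.
rewrite /parabola; move: (coord u) (j == i)%:R => x e.
by rewrite /GRing.scale/=; ring.
Qed.

Lemma pderiv1_parabola a b d j : pderiv [:: j] (parabola a b d) =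
  parabola 0 (2 * a * (j == i)%:R) (b * (j == i)%:R).
Proof. exact: derive_parabola. Qed.

Lemma pderiv_cat (I J : seq 'I_m) (f : 'rV[R]_m -> R) :
  pderiv (I ++ J) f = pderiv I (pderiv J f).
Proof. exact: foldr_cat. Qed.

Lemma pderiv_parabola I a b d : exists a' b' d',
  pderiv I (parabola a b d) = parabola a' b' d'.
Proof.
elim: I => [|j I [a' [b' [d' IH]]]]; first by exists a, b, d.
by rewrite (pderiv_cat [:: j]) IH pderiv1_parabola; do 3 eexists.
Qed.

Lemma smooth_parabola a b d : smooth (parabola a b d).
Proof.
move=> I u; have [a' [b' [d' ->]]] := pderiv_parabola I a b d.
exact: differentiable_parabola.
Qed.

Lemma pderiv_parabola_ge3 I a b d : (3 <= size I)%N ->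
  pderiv I (parabola a b d) = parabola 0 0 0.
Proof.
move=> I3; have := size_drop (size I - 3)%N I; rewrite subKn//.
rewrite -[in pderiv _ _](cat_take_drop (size I - 3) I) pderiv_cat.
case: (drop _ _) => [|j [|k [|l []]]]// _.
rewrite (pderiv_cat [:: j] [:: k; l]) (pderiv_cat [:: k] [:: l]).
rewrite !pderiv1_parabola !(mulr0, mul0r).
elim: (take _ _) => // j0 J0 IH; rewrite (pderiv_cat [:: j0]) IH pderiv1_parabola.
by rewrite !(mulr0, mul0r).
Qed.

Lemma taylor0_parabola a b d : taylor0 (parabola a b d) = d.
Proof. by rewrite /taylor0 /parabola /coord mxE !mulr0 !add0r. Qed.

Lemma taylor1_parabola a b d j : taylor1 (parabola a b d) j = b * (j == i)%:R.
Proof.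
by rewrite /taylor1 pderiv1_parabola; exact: taylor0_parabola.
Qed.

Lemma taylor2_parabola a b d j k :
  taylor2 (parabola a b d) j k = a * (k == i)%:R * (j == i)%:R.
Proof.
rewrite /taylor2 (pderiv_cat [:: j] [:: k]) !pderiv1_parabola.
rewrite [X in X / _]taylor0_parabola.
by move: (k == i)%:R (j == i)%:R => x y; field.
Qed.

Lemma taylor2_tr_parabola a b d : taylor2_tr (parabola a b d) = a.
Proof.
rewrite /taylor2_tr (bigD1 i)//= taylor2_parabola eqxx !mulr1 big1 ?addr0//.
by move=> j ji; rewrite taylor2_parabola (negbTE ji) mulr0.
Qed.

Lemma nearly_parallel_parabola (a : nat -> R) : isO rsqrt a ->
  nearly_parallel (fun n => parabola (a n) 0 0).
Proof.
move=> /isOP[C [N hC]]; split.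
- by move=> n; exact: smooth_parabola.
- apply/isOP; exists 0, 0%N => n _.
  by rewrite taylor0_parabola normr0 mul0r.
- move=> j; apply/isOP; exists 0, 0%N => n _.
  by rewrite taylor1_parabola mul0r normr0 mul0r.
- move=> j k; apply/isOP; exists C, N => n Nn; apply: le_trans (hC n Nn).
  by rewrite taylor2_parabola -mulrA -natrM mulnb; case: (_ && _);
    rewrite ?mulr1// mulr0 normr0.
- move=> I I3; exists 1, 0, 0%N; split => //; apply/near_inftyP; exists 0%N.
  move=> n _ x _; rewrite pderiv_parabola_ge3// /parabola !mul0r !addr0.
  by rewrite normr0.
Qed.

Variables (grid : seq R) (w : R -> R).
Hypotheses (gs : (1 < size grid)%N) (gu : uniq grid)
  (g0 : forall t, t \in grid -> 0 < t) (w0 : forall t, t \in grid -> 0 < w t).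
Local Notation h := (fun n : nat => parabola 0 0 0).
Local Notation s := (fun n : nat => parabola (rsqrt n) 0 0).
Local Notation H n := (region (h n)).
Local Notation S n := (~` region (s n)).

Lemma flat_nearly_parallel : nearly_parallel h.
Proof.
apply: (@nearly_parallel_parabola (fun=> 0)); apply/isOP; exists 0, 0%N => n _.
by rewrite normr0 mul0r.
Qed.

Lemma curved_nearly_parallel : nearly_parallel s.
Proof.
by apply: nearly_parallel_parabola; apply/isOP; exists 1, 0%N => n _; rewrite mul1r.
Qed.

Let hp := flat_nearly_parallel.
Let sp := curved_nearly_parallel.

Let arith_gap (N P O a f t r : R) : P != 0 -> a != 0 ->
  a^-1 * (P * (N / P - a) + a * (P - O) -
    (N - a * O - (t - a * f * (0 - r)))) - a^-1 * t = f * r.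
Proof. by move=> P0 a0; field; rewrite a0. Qed.

Lemma not_second_order sigma2 muhat : approx_proj h muhat ->
  ~ second_order_accurate (fun n => H n) (fun n => S n)
    (fun n => pBP1 grid w sigma2 (muhat n) (H n) (S n)).
Proof.
move=> muP acc.
pose p n := pBP1 grid w sigma2 (muhat n) (H n) (S n).
have half0 : (2^-1 : R) != 0 by rewrite invr_eq0.
have a01 : 0 < (2^-1 : R) < 1 by apply/andP; split; lra.
(* Radius 0: accuracy is tested at the origin alone, a point of the flat surface. *)
pose c := surface_ctx h (0 : R); pose mu (j : nat * pt R m) := j.2.
have ok : ctx_ok c by exact: ok_unit.
have [C /near_inftyP[N0 hC]] := acc _ a01 0.
have hN : pO c 2 (fun j => Pr 1 (mu j) [set y | p (idx c j) y < 2^-1] /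
    Pr 1 (mu j) (S (idx c j)) - 2^-1).
  exists `|C|, 0%N; split => //; exists N0 => j [dj1 dj2] Nj.
  rewrite expr0 mulr1 rsqrt_sqr; apply: (le_trans (hC _ Nj _ dj1 dj2)).
  by rewrite ler_wpM2r ?invr_ge0// ler_norm.
have hmu := @surface_moderate R m h 0.
have mp n : measurable_fun setT (p n) by exact: (measurable_p1 hp sp gs gu g0 w0 muP sigma2).
have pp := profile_p1 hp sp gs gu g0 w0 muP sigma2.
have ex := level_expansion hp sp sp mp pp 0 a01.
have sel := surface_selection hp sp 0.
have bo := bdd_offset hp sp sp ok hmu.
have [b [b0 hb]] := Phibar_lb bo.
have b20 : 0 < b / 2 by rewrite divr_gt0.
have bP : bdd c (fun j => Pr 1 (mu j) (S (idx c j))).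
  exists 1; apply: evI => j _; rewrite ger0_norm ?Pr_ge0// Pr_le1//.
  exact: (measurable_S sp).
have hP := pO_mulr ok (bdd_pO bP) hN.
have Pgt : ev c (fun j => 0 < Pr 1 (mu j) (S (idx c j))).
  apply: (ev2 hb (pO_small ok sel b20)) => j _ bj.
  rewrite -/(mu j) ler_norml => /andP[+ _].
  by move: (Pr _ _ _) (Phibar _) bj => u v *; lra.
have [f [f0 hf]] := phi_lb bo.
(* The supposed O(n^-1) accuracy and the explicit expansion together force the leading error to be
   O(n^-1); its trace factor is s_ii = n^(-1/2). *)
have fr : pO c 2 (fun j => phi (offset h s s c mu j) * rsqrt j.1).
  have := pO_scale 2 ok (pO_sub ok (pO_add ok hP (pO_scale 2^-1 ok sel)) ex).
  apply: pO_le; apply: (ev_mono Pgt) => j _ Pj.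
  rewrite /tr0 !taylor2_tr_parabola mulr0 mulr0.
  rewrite le_eqVlt; apply/orP; left; apply/eqP; congr `|_|.
  have := arith_gap (Pr 1 (mu j) [set y | p (idx c j) y < 2^-1])
    (Phibar (offset h s s c mu j)) (phi (offset h s s c mu j)) 0 (rsqrt j.1)
    (lt0r_neq0 Pj) half0.
  by rewrite invrK mulr0 subr0 => ->.
have [//|K [N1 hK]] := pO_unit _ fr.
have [N2 hN2] := hf.
have K0 : 0 < `|K| + 1 by rewrite ltr_wpDl.
(* With exponent 0 this supplies n with n^(-1/2) <= f / (|K| + 1), which contradicts f n^(-1/2) <= K
   n^-1. *)
have [N3 hN3] := @polylog_rsqrt R 0 (f / (`|K| + 1)) (divr_gt0 f0 K0).
pose n := maxn (maxn N1 N2) (maxn N3 1).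
have dn : dom c (n, 0).
  split; last by rewrite normr0.
  apply/boundary_region; first exact: smooth_continuous (np_smooth hp n).
  by rewrite /parabola !mul0r !addr0 oppr0.
have n1 : (N1 <= n)%N by rewrite !leq_max leqnn.
have n2 : (N2 <= n)%N by rewrite !leq_max leqnn !orbT.
have n3 : (N3 <= n)%N by rewrite !leq_max leqnn !orbT.
have n4 : (0 < n)%N by rewrite !leq_max !orbT.
have := hK _ dn n1; have := hN2 _ dn n2; have := hN3 _ n3.
have rs0 : 0 < rsqrt n :> R by rewrite invr_gt0 sqrtr_gt0 ltr0n.
rewrite expr0 mul1r /= ler_pdivlMr// => h3 h2.
rewrite ger0_norm ?mulr_ge0 ?phi_ge0 ?(ltW rs0)// expr2 mulrA ler_pM2r// => h1.
have := ler_norm K; move: (phi _) h2 h1 => u h2 h1 h4.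
have : K * rsqrt n <= `|K| * rsqrt n by rewrite ler_wpM2r// ltW.
rewrite mulrDr mulr1 [rsqrt n * _]mulrC in h3.
lra.
Qed.

End counterexample.

Theorem theorem4p5 (R : realType) (m : nat) (grid : seq R) (w : R -> R)
    (grid_size : (1 < size grid)%N) (grid_uniq : uniq grid)
    (grid_pos : forall t, t \in grid -> 0 < t)
    (w_pos : forall t, t \in grid -> 0 < w t) :
  (forall (h s : nat -> 'rV[R]_m -> R) (muhat : nat -> pt R m -> pt R m)
      (sigma2 : R),
    nearly_parallel h -> nearly_parallel s -> approx_proj h muhat ->
    let H := fun n => region (h n) in
    let S := fun n => ~` region (s n) in
    let p1 := fun n => pBP1 grid w sigma2 (muhat n) (H n) (S n) in
    let p2 := fun n => pBP2 grid w sigma2 (muhat n) (H n) (S n) in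
    (forall r0 : nat -> R, isO (fun=> 1) r0 ->
      let y := fun n => (0, - r0 n) : pt R m in
      (forall nu : nat -> pt R m, (forall n, is_proj (H n) (y n) (nu n)) ->
        forall i, aeq (fun n => (nu n).1 0 i)
                      (fun n => - (taylor0 (h n) - r0 n) * taylor1 (h n) i)) /\
      (forall mu : nat -> pt R m,
        isO rsqrt (fun n => `|(mu n).1|) ->
        aeq (fun n => (mu n).2) (fun n => - h n (mu n).1) ->
        let q1 := fun n =>
          pBP1_at grid w sigma2 (H n) (S n) (y n) (mu n) in
        let q2 := fun tau2 n =>
          pBP2_at grid w tau2 (muhat n) (H n) (S n) (y n) (mu n) in
        [/\ aeq q1 (fun n =>
              Phibar (taylor0 (h n) - r0 n + taylor2_tr (h n) * sigma2) /
              Phibar (taylor0 (h n) - taylor0 (s n) - taylor2_tr (s n))),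
            aeq (q2 sigma2) (fun n =>
              Phibar (taylor0 (h n) - r0 n - taylor2_tr (h n)) /
              Phibar (taylor0 (h n) - taylor0 (s n) - taylor2_tr (h n))),
            aeq (q2 sigma2) (fun n => pSI grid w (H n) (S n) (y n)) &
            forall tau2 : R, aeq (q2 sigma2) (q2 tau2)])) /\
    [/\ second_order_accurate H S p2,
        isOp rsqrt (fun n y => p1 n y - p2 n y),
        first_order_accurate H S p1 &
        (forall n, S n = ~` H n) -> sigma2 = -1 ->
          second_order_accurate H S p1]) /\
  ((0 < m)%N -> forall sigma2 : R,
    exists h s : nat -> 'rV[R]_m -> R,
      [/\ nearly_parallel h, nearly_parallel s &
        forall muhat : nat -> pt R m -> pt R m, approx_proj h muhat ->
          ~ second_order_accurate (fun n => region (h n))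
              (fun n => ~` region (s n))
              (fun n => pBP1 grid w sigma2 (muhat n)
                 (region (h n)) (~` region (s n)))]).
Proof.
split; last first.
  move=> m0 sigma2; pose i := Ordinal m0.
  exists (fun=> parabola i 0 0 0), (fun n => parabola i (rsqrt n) 0 0); split.
  - exact: flat_nearly_parallel.
  - exact: curved_nearly_parallel.
  - move=> muhat muP.
    exact: (not_second_order grid_size grid_uniq grid_pos w_pos muP).
move=> h s muhat sigma2 hp sp muP H S p1 p2.
have mp1 := measurable_p1 hp sp grid_size grid_uniq grid_pos w_pos muP sigma2.
have mp2 := measurable_p2 hp sp grid_size grid_uniq grid_pos w_pos muP sigma2.
have pp1 := profile_p1 hp sp grid_size grid_uniq grid_pos w_pos muP sigma2.
have pp2 := profile_p2 hp sp grid_size grid_uniq grid_pos w_pos muP sigma2.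
split.
  move=> r0 hr y; split.
    move=> nu pr i; apply: pO_aeq.
    have br := isO_bdd seq_ctx hr.
    have := proj_expansion ok_seq hp i br (fun n _ => pr n).
    by apply: pO_ext => n _; rewrite mulNr opprK.
  move=> mu mu1 mu2 q1 q2.
  have [c1 c2] := surface_close_level mu1 mu2.
  have near2 tau2 := pBP2_claim_pO grid_size grid_uniq grid_pos w_pos hp sp hr c1 c2 muP tau2.
  have nearSI := pSI_claim_pO grid_size grid_uniq grid_pos w_pos hp sp hr.
  split.
  - exact: (pBP1_claim grid_size grid_uniq grid_pos w_pos hp sp hr c1 c2).
  - exact: (pO_aeq (near2 sigma2)).
  - exact: (aeq_target (near2 sigma2) nearSI).
  - by move=> tau2; exact: (aeq_target (near2 sigma2) (near2 tau2)).
split.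
- exact: (profile_second_order hp sp mp2 pp2).
- exact: (p1_p2_isOp grid_size grid_uniq grid_pos w_pos hp sp muP).
- exact: (profile_first_order hp sp sp mp1 pp1).
(* Equal complements give equal regions, and each region contains the graph that bounds the other;
   hence s = h, and the profile of p1 has tau = -1 and f = h. *)
- move=> SH s1; have sE : s = h.
    apply/funext => n; apply/funext => u.
    have rE : region (s n) = region (h n) by exact: setC_inj (SH n).
    apply/eqP; rewrite eq_le; apply/andP; split; rewrite -lerN2.
      have : region (h n) (u, - h n u) by exact: lexx.
      by rewrite -rE.
    have : region (s n) (u, - s n u) by exact: lexx.
    by rewrite rE.
  subst s sigma2.
  exact: (profile_second_order hp hp mp1 pp1).
Qed.
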